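(* Let $e_1,e_2,e_3\in\mathbb{Z}$ be three distinct integers, $\mathbf{e}=(e_1,e_2,e_3)$. For $n\geq1$ let $E_{n,\mathbf{e}}$ be the elliptic curve $y^2=(x-e_1n)(x-e_2n)(x-e_3n)$. Then there are constants $c,C>0$ depending only on $\mathbf{e}$ such that for all sufficiently large $B$, $$c\,B\leq \sum_{n\geq1}\#\{P\in E^{\ast}_{n,\mathbf{e}}(\mathbb{Z}):\ \mathcal{H}(P)\leq B\}\leq C\,B(\log B)^{\delta_{\mathbf{e}}},$$ where $\delta_{\mathbf{e}}=4$ if $e_1e_2e_3\neq0$ and $\delta_{\mathbf{e}}=6$ otherwise.
   Context: $E_{n,\mathbf{e}}(\mathbb{Z})=\{P\in E_{n,\mathbf{e}}(\mathbb{Q}): x(P)\in\mathbb{Z}\}$ (affine points with integral $x$-coordinate, hence integral $y$), and $E^{\ast}_{n,\mathbf{e}}(\mathbb{Z})=\{P\in E_{n,\mathbf{e}}(\mathbb{Z}): y(P)\neq0\}$. For $P\in E_{n,\mathbf{e}}(\mathbb{Z})$ with coordinates $(x,y)\in\mathbb{Z}^2$, $\mathcal{H}(P)=\max\{|y|^{1/3},|x|^{1/2}\}$. *)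

(* Defs.v *)
From HB Require Import structures.
From mathcomp Require Import all_boot all_order all_algebra.
From mathcomp Require Import all_classical all_reals all_analysis.

Set Implicit Arguments.
Unset Strict Implicit.
Unset Printing Implicit Defensive.

Import Order.TTheory GRing.Theory Num.Theory.
Import numFieldNormedType.Exports.

Local Open Scope classical_set_scope.
Local Open Scope ring_scope.

(* Affine rational points, as pairs P = (x(P), y(P)). The point at infinity is
   left out: it has no x-coordinate, so it never belongs to E_{n,e}(Z). *)
Definition E_rat (e1 e2 e3 : int) (n : nat) : set (rat * rat) :=
  [set P | P.2 ^+ 2 = (P.1 - e1%:~R * n%:R) * (P.1 - e2%:~R * n%:R)
                      * (P.1 - e3%:~R * n%:R)].

Definition E_int (e1 e2 e3 : int) (n : nat) : set (rat * rat) :=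
  [set P | E_rat e1 e2 e3 n P /\ P.1 \is a Num.int].

Definition E_star (e1 e2 e3 : int) (n : nat) : set (rat * rat) :=
  [set P | E_int e1 e2 e3 n P /\ P.2 != 0].

Definition height (R : realType) (P : rat * rat) : R :=
  Num.max (`|ratr P.2| `^ 3^-1) (`|ratr P.1| `^ 2^-1).

Definition delta (e1 e2 e3 : int) : nat :=
  if e1 * e2 * e3 != 0 then 4%N else 6%N.

(* [counting] is +oo on infinite sets and the sum is the limit in [0, +oo]
   of its (nondecreasing) partial sums, so an upper bound by a real number carries the
   finiteness of each point set and of the whole sum. *)
Definition point_count (R : realType) (e1 e2 e3 : int) (B : R) : \bar R :=
  (\sum_(1 <= n <oo)
     counting [set P | E_star e1 e2 e3 n P /\ (height R P <= B)%R])%E.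

(* Main.v *)
Require Import Defs.
From HB Require Import structures.
From mathcomp Require Import all_boot all_order all_algebra.
From mathcomp Require Import all_classical all_reals all_analysis.
From mathcomp Require Import ring lra zify.

(** Write X_i = x - e_i n, so that sum a_i X_i = 0 for a fixed nonzero triple a, and
    X_i = k g_i z_i^2 with k the gcd of the X_i and g_i squarefree. Since X_1 X_2 X_3 is a
    square, k g_1 g_2 g_3 is a square, so for given (g, z) there are
    O((k_max / |g_1 g_2 g_3|)^(1/2)) choices of k. It remains to count pairs (g, z) with
    sum a_i g_i z_i^2 = 0 and all sizes fixed up to a bounded factor, in two ways.
    For fixed z the equation is linear in g, and the slopes g_2 / g_1 of its primitive
    solutions are well spaced. For fixed g it is a conic. Two of its points z, y are in the
    same class if g_1 g_2 g_3 divides a fixed multiple of the polar form of z and y; points of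
    one class are well spaced on the conic. Every class contains a point with all
    |g_i| z_i^2 = O(|g_1 g_2 g_3|): a line through z with small integer coefficients, provided by
    the pigeonhole principle, meets the conic again in such a point. The classes are then
    counted by these small points, for which the first method is efficient.
    For the lower bound, fix x0 with v := prod (x0 - e_i) > 0; every t >= 1 gives the point
    (v t^2 x0, v^2 t^3) for n = v t^2. *)

Set Implicit Arguments.
Unset Strict Implicit.
Unset Printing Implicit Defensive.

Import Order.TTheory GRing.Theory Num.Theory.
Import numFieldNormedType.Exports.

Local Open Scope classical_set_scope.
Local Open Scope ring_scope.

(** * Divisibility and squarefree integers *)

(** Write X = 8^(k1+k2+k3), where 64^k_i is the size of g_i, and let P^6 and Q^6 be the sizes of the
    largest and of the smallest term g_i z_i^2. Up to constants the plane count of a box is Q^3 P^6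
    / X + Q^3 X and the class count is X^2 + Q^3 X; as Q <= P, the better one is O(X P^2 Q). The
    number of choices of k cancels this down to O(B) for each box, so the exponent of the logarithm
    counts size parameters. If the e_i belonging to the smallest |X_i| is nonzero, the height forces
    n = O(B^2), which bounds k P^6: the parameters k1, k2, k3, P give the exponent 4. If that e_i is
    0, n escapes this bound and only the product y^2 of the X_i is controlled; boxes with small Q
    then weigh as much as the others, and Q is a fifth parameter. The sixth logarithm is a crude
    bound for the classes whose small point has a zero coordinate; for the exponent 4 they are
    treated exactly, as they occur in few boxes. *)

Definition sqfree (g : int) := forall d : int, (d * d %| g)%Z -> (d %| 1)%Z.

Definition prim3 (x y z : int) :=
  forall d : int, (d %| x)%Z -> (d %| y)%Z -> (d %| z)%Z -> (d %| 1)%Z.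

Lemma dvdz1_norm (d : int) : (d %| 1)%Z -> `|d| = 1.
Proof. by rewrite dvdz1 => /eqP h; rewrite -abszE h. Qed.

Lemma dvdz1_dvd (d x : int) : (d %| 1)%Z -> (d %| x)%Z.
Proof. by move=> h; rewrite -[x]mul1r dvdz_mulr. Qed.

(** This and the next lemmas replace coprimality by coprimality up to a fixed number: a common
    factor that divides [a] is paid for by a factor [a] in the conclusion. *)
Lemma dvdz_mul_gcdz (g X m a : int) :
  (g %| X * m)%Z -> (gcdz g m %| a)%Z -> (g %| X * a)%Z.
Proof.
move=> h /dvdzP[q ->]; have [u [v e]] := Bezoutz g m.
rewrite -e (_ : _ * _ = q * X * u * g + q * v * (X * m)); last by ring.
by rewrite rpredD // dvdz_mull.
Qed.

Lemma dvdz_mulM_gcdz (m n X a : int) :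
  (m %| X)%Z -> (n %| X)%Z -> (gcdz m n %| a)%Z -> (m * n %| X * a)%Z.
Proof.
move=> mX nX /dvdzP[q ->]; have [u [v e]] := Bezoutz m n.
rewrite -e (_ : _ * _ = q * u * (m * X) + q * v * (X * n)); last by ring.
by rewrite rpredD // dvdz_mull // dvdz_mul.
Qed.

Lemma dvdz_gcdzM (m n k : int) : (gcdz (m * n) k %| gcdz m k * gcdz n k)%Z.
Proof.
have [u [v <-]] := Bezoutz m k; have [u' [v' <-]] := Bezoutz n k.
rewrite (_ : _ * _ = u * u' * (m * n) + (u * m * v' + v * u' * n + v * v' * k) * k);
  last by ring.
by rewrite rpredD // dvdz_mull // ?dvdz_gcdl ?dvdz_gcdr.
Qed.

Lemma dvdz_gcdzMr (k m n a b : int) : (gcdz k m %| a)%Z -> (gcdz k n %| b)%Z ->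
  (gcdz k (m * n) %| a * b)%Z.
Proof.
move=> ha hb; rewrite gcdzC; apply: dvdz_trans (dvdz_gcdzM m n k) _.
by rewrite dvdz_mul // gcdzC.
Qed.

Lemma dvdz_gcdz_trans (m n m' n' a : int) : (m %| m')%Z -> (n %| n')%Z ->
  (gcdz m' n' %| a)%Z -> (gcdz m n %| a)%Z.
Proof.
move=> hm hn; apply: dvdz_trans; rewrite dvdz_gcd.
by rewrite (dvdz_trans (dvdz_gcdl _ _) hm) (dvdz_trans (dvdz_gcdr _ _) hn).
Qed.

Lemma prim3_gcdz (x y z : int) : prim3 x y z -> coprimez x (gcdz y z).
Proof.
move=> h; rewrite /coprimez.
have := h (gcdz x (gcdz y z)); rewrite dvdz_gcdl.
have d : (gcdz x (gcdz y z) %| gcdz y z)%Z by rewrite dvdz_gcdr.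
rewrite (dvdz_trans d (dvdz_gcdl _ _)) (dvdz_trans d (dvdz_gcdr _ _)).
by move=> /(_ isT isT isT) /dvdz1_norm; rewrite ger0_norm // => ->.
Qed.

Lemma dvdz_prim3 (r X x y z : int) : prim3 x y z ->
  (r %| X * x)%Z -> (r %| X * y)%Z -> (r %| X * z)%Z -> (r %| X)%Z.
Proof.
move=> /prim3_gcdz /coprimezP[[u v] /= e] hx hy hz.
have [s [t et]] := Bezoutz y z.
rewrite -[X]mulr1 -e -et.
rewrite (_ : _ * _ = u * (X * x) + (v * s * (X * y) + v * t * (X * z))); last by ring.
by rewrite !rpredD // dvdz_mull.
Qed.

(** Prime factors are avoided: the gcd of a common divisor d with [x] is shown to divide 1, so d is
    coprime to [x], and its divisibility of x * x forces it to divide [x], hence 1. *)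
Lemma prim3_sqr (x y z : int) : prim3 x y z -> prim3 (x * x) (y * y) (z * z).
Proof.
move=> h d dx dy dz.
have h1 : (d %| x)%Z -> (d %| y)%Z -> (d %| z)%Z -> (d %| 1)%Z by apply: h.
have key : forall r, (r %| x * x)%Z -> (r %| y * y)%Z -> (r %| z * z)%Z ->
   (r %| x)%Z -> (r %| 1)%Z.
  move=> r rx ry rz r1.
  have key2 : forall s, (s %| r)%Z -> (s %| y)%Z -> (s %| 1)%Z.
    move=> s sr sy; apply: (@dvdz_prim3 s 1 _ _ _ h); rewrite ?mul1r //.
      exact: dvdz_trans sr r1.
    apply: (@dvdz_prim3 s z _ _ _ h).
    - exact/dvdz_mull/(dvdz_trans sr).
    - exact: dvdz_mull.
    - exact: dvdz_trans sr rz.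
  have cry : coprimez r y.
    by rewrite /coprimez; have := key2 _ (dvdz_gcdl r y) (dvdz_gcdr r y) => /dvdz1_norm;
      rewrite ger0_norm // => ->.
  by move: ry; rewrite (Gauss_dvdzr y cry) => /(key2 r (dvdzz r)).
have cdx : coprimez d x.
  rewrite /coprimez; have := key (gcdz d x).
  rewrite (dvdz_trans (dvdz_gcdl d x) dx) (dvdz_trans (dvdz_gcdl d x) dy).
  rewrite (dvdz_trans (dvdz_gcdl d x) dz) dvdz_gcdr => /(_ isT isT isT isT) /dvdz1_norm.
  by rewrite ger0_norm // => ->.
by apply: key; rewrite // (Gauss_dvdzr x cdx) in dx.
Qed.

Lemma sqfree_neq0 (g : int) : sqfree g -> g != 0.
Proof. by move=> h; apply/eqP=> g0; have := h 2; rewrite g0 dvdz0 => /(_ isT). Qed.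

Lemma sqfree_dvd (r g : int) : (r %| g)%Z -> sqfree g -> sqfree r.
Proof. by move=> rg h d hd; apply: h; exact: dvdz_trans rg. Qed.

Lemma sqfree_coprime (r s : int) : sqfree (r * s) -> coprimez r s.
Proof.
move=> h; rewrite /coprimez.
have := h (gcdz r s); rewrite dvdz_mul ?dvdz_gcdl ?dvdz_gcdr // => /(_ isT) /dvdz1_norm.
by rewrite ger0_norm // => ->.
Qed.

(** With d = gcd(g, m) and g = q d, the cofactor q is coprime to m / d because d is the gcd, and to
    d because g is squarefree; so q divides 1. *)
Lemma sqfree_dvd_sqr (g m : int) : sqfree g -> (g %| m * m)%Z -> (g %| m)%Z.
Proof.
move=> sg h; have g0 := sqfree_neq0 sg.
have [q e] : exists q, g = q * gcdz g m by apply/dvdzP; rewrite dvdz_gcdl.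
have [n en] : exists n, m = n * gcdz g m by apply/dvdzP; rewrite dvdz_gcdr.
set d := gcdz g m in e en.
have d0 : d != 0 by apply: contra_neq g0 => d0; rewrite e d0 mulr0.
have cqn : coprimez q n.
  have [u [v]] := Bezoutz g m; rewrite -/d {1}e {1}en => ed.
  apply/coprimezP; exists (u, v) => /=; apply: (mulIf d0); rewrite mul1r -[RHS]ed; ring.
have cqd : coprimez q d by apply: sqfree_coprime; rewrite -e.
suff q1 : (q %| 1)%Z by rewrite e en; apply: dvdz_mul => //; exact: dvdz1_dvd.
move: h; rewrite e en => /(dvdz_trans (dvdz_mulr d (dvdzz q))).
rewrite (_ : _ * _ * _ = n * (n * (d * (d * 1)))); last by ring.
by rewrite !Gauss_dvdzr.
Qed.

Lemma sqfree_decomposition (p : int) : p != 0 ->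
  exists g z : int, [/\ p = g * (z * z), 0 < z & sqfree g].
Proof.
have [n] := ubnP `|p|%N; elim: n p => // n IH p; rewrite ltnS => pn p0.
have [h|h] := boolP [exists d : 'I_(`|p|.+1), (1 < d)%N && ((d : nat)%:Z * (d : nat)%:Z %| p)%Z].
  case/existsP: h => -[d dp] /= /andP[d1 /dvdzP[q eq]]; clear dp.
  have q0 : q != 0 by apply: contra_neq p0 => q0; rewrite eq q0 mul0r.
  have qp : (`|q| < n)%N.
    apply: leq_trans pn; rewrite eq abszM abszM /= -[X in (X < _)%N]muln1 ltn_pmul2l ?absz_gt0 //.
    by apply: (@leq_trans (2*2)%N) => //; apply: leq_mul.
  have [g [z [eg z0 sg]]] := IH q qp q0.
  exists g, (z * d%:Z); split => //; first by rewrite eq {1}eg; ring.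
  by rewrite mulr_gt0 // ltz_nat; apply: leq_trans d1.
exists p, 1; split => //; first by rewrite !mulr1.
move=> d hd; rewrite dvdz1.
move/existsPn: h => h.
have d0 : d != 0 by apply: contraTneq hd => ->; rewrite mul0r dvd0z.
have hN : (`|d| * `|d| %| `|p|)%N by rewrite -abszM.
have le : (`|d| < `|p|.+1)%N.
  rewrite ltnS; apply: leq_trans (dvdn_leq _ hN); rewrite ?absz_gt0 //.
  by rewrite leq_pmulr // absz_gt0.
have := h (Ordinal le) => /=; rewrite dvdzE abszM /= hN andbT -leqNgt => h1.
by rewrite eqn_leq h1 absz_gt0.
Qed.

(* A divisor of g1 meeting both e2 and e3 only shares primes with a1: the equation
   would otherwise force a square factor of g1 or a common factor of the e_i. *)
Lemma isotropic_dvd (a1 a2 a3 g1 g2 g3 e1 e2 e3 r K : int) :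
  a1 * g1 * (e1 * e1) + a2 * g2 * (e2 * e2) + a3 * g3 * (e3 * e3) = 0 ->
  sqfree g1 -> prim3 e1 e2 e3 -> (r %| g1)%Z -> (r %| K * e2)%Z -> (r %| K * e3)%Z ->
  (r %| K * K * a1)%Z.
Proof.
move=> eq sg pe /dvdzP[s es] r2 r3.
have crs : coprimez r s by apply: sqfree_coprime; rewrite mulrC -es.
have r0 : r != 0 by apply: contra_neq (sqfree_neq0 sg) => r0; rewrite es r0 mulr0.
have h1 : (r * r %| r * (s * (K * K * a1 * (e1 * e1))))%Z.
  have -> : r * (s * (K * K * a1 * (e1 * e1))) =
     - (a2 * g2 * ((K * e2) * (K * e2)) + a3 * g3 * ((K * e3) * (K * e3))).
    have -> : a2 * g2 * ((K * e2) * (K * e2)) + a3 * g3 * ((K * e3) * (K * e3)) =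
      K * K * ((a1 * g1 * (e1 * e1) + a2 * g2 * (e2 * e2) + a3 * g3 * (e3 * e3))
               - a1 * g1 * (e1 * e1)) by ring.
    by rewrite eq es; ring.
  by rewrite rpredN rpredD // dvdz_mull // dvdz_mul.
rewrite dvdz_mul2l // Gauss_dvdzr // in h1.
apply: (@dvdz_prim3 r _ _ _ _ (prim3_sqr pe)) => //.
- have -> : K * K * a1 * (e2 * e2) = K * a1 * e2 * (K * e2) by ring.
  exact: dvdz_mull.
- have -> : K * K * a1 * (e3 * e3) = K * a1 * e3 * (K * e3) by ring.
  exact: dvdz_mull.
Qed.

(** The quotient of [r] by gcd(r, b) is squarefree, hence divides [e2] and [e3] themselves, and
    [isotropic_dvd] with K = 1 makes it divide [a1]. *)
Lemma isotropic_dvd_cancel (a1 a2 a3 g1 g2 g3 e1 e2 e3 r b : int) :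
  a1 * g1 * (e1 * e1) + a2 * g2 * (e2 * e2) + a3 * g3 * (e3 * e3) = 0 ->
  sqfree g1 -> prim3 e1 e2 e3 -> (r %| g1)%Z ->
  (r %| b * (e2 * e2))%Z -> (r %| b * (e3 * e3))%Z -> (r %| b * a1)%Z.
Proof.
move=> eq sg pe rg r2 r3.
have [b0|b0] := eqVneq b 0; first by rewrite b0 mul0r dvdz0.
have [q e] : exists q, r = q * gcdz r b by apply/dvdzP; rewrite dvdz_gcdl.
have [n en] : exists n, b = n * gcdz r b by apply/dvdzP; rewrite dvdz_gcdr.
set h := gcdz r b in e en.
have h0 : h != 0 by apply: contra_neq b0 => h0; rewrite en h0 mulr0.
have cqn : coprimez q n.
  have [u [v]] := Bezoutz r b; rewrite -/h {1}e {1}en => ed.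
  apply/coprimezP; exists (u, v) => /=; apply: (mulIf h0); rewrite mul1r -[RHS]ed; ring.
have qg : (q %| g1)%Z by apply: dvdz_trans rg; rewrite e dvdz_mulr.
have sq := sqfree_dvd qg sg.
have aux : forall x, (r %| b * (x * x))%Z -> (q %| 1 * x)%Z.
  move=> x; rewrite mul1r e en (_ : n * h * (x * x) = n * (x * x) * h); last by ring.
  by rewrite dvdz_mul2r // Gauss_dvdzr // => /(sqfree_dvd_sqr sq).
have := isotropic_dvd eq sg pe qg (aux _ r2) (aux _ r3); rewrite !mul1r => qa.
by rewrite e en (_ : n * h * a1 = n * (a1 * h)); [apply/dvdz_mull/dvdz_mul | ring].
Qed.

(** * Diagonal conics *)

Definition isotropic (a1 a2 a3 g1 g2 g3 z1 z2 z3 : int) :=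
  a1 * g1 * (z1 * z1) + a2 * g2 * (z2 * z2) + a3 * g3 * (z3 * z3) = 0.

(** Primitivity is asked of the three terms g_i z_i^2 and not only of z: together with the equation
    it makes these terms coprime in pairs up to the a_i. *)
Record conic_sol (a1 a2 a3 g1 g2 g3 z1 z2 z3 : int) : Prop := ConicSol {
  sol_sq1 : sqfree g1; sol_sq2 : sqfree g2; sol_sq3 : sqfree g3;
  sol_z1 : 0 < z1; sol_z2 : 0 < z2; sol_z3 : 0 < z3;
  sol_eq : isotropic a1 a2 a3 g1 g2 g3 z1 z2 z3;
  sol_prim : prim3 (g1 * (z1 * z1)) (g2 * (z2 * z2)) (g3 * (z3 * z3)) }.

Lemma isotropic_rot a1 a2 a3 g1 g2 g3 z1 z2 z3 :
  isotropic a1 a2 a3 g1 g2 g3 z1 z2 z3 -> isotropic a2 a3 a1 g2 g3 g1 z2 z3 z1.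
Proof. by rewrite /isotropic => h; rewrite -[RHS]h; ring. Qed.

Lemma prim3_rot x y z : prim3 x y z -> prim3 y z x.
Proof. by move=> h d dy dz dx; apply: h. Qed.

Lemma sol_rot a1 a2 a3 g1 g2 g3 z1 z2 z3 :
  conic_sol a1 a2 a3 g1 g2 g3 z1 z2 z3 -> conic_sol a2 a3 a1 g2 g3 g1 z2 z3 z1.
Proof.
case=> s1 s2 s3 h1 h2 h3 he hp; split => //; first exact: isotropic_rot.
exact: prim3_rot.
Qed.

Lemma sol_gcd12 a1 a2 a3 g1 g2 g3 z1 z2 z3 :
  conic_sol a1 a2 a3 g1 g2 g3 z1 z2 z3 ->
  (gcdz (g1 * (z1 * z1)) (g2 * (z2 * z2)) %| a3)%Z.
Proof.
case=> _ _ _ _ _ _ he hp; set c := gcdz _ _.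
have c1 : (c %| g1 * (z1 * z1))%Z by rewrite dvdz_gcdl.
have c2 : (c %| g2 * (z2 * z2))%Z by rewrite dvdz_gcdr.
apply: (dvdz_prim3 hp); [exact: dvdz_mull | exact: dvdz_mull | ].
have -> : a3 * (g3 * (z3 * z3)) = - (a1 * (g1 * (z1 * z1)) + a2 * (g2 * (z2 * z2))).
  by apply/eqP; rewrite -addr_eq0 -he; apply/eqP; ring.
by rewrite rpredN rpredD // dvdz_mull.
Qed.

Lemma sol_gcd23 a1 a2 a3 g1 g2 g3 z1 z2 z3 :
  conic_sol a1 a2 a3 g1 g2 g3 z1 z2 z3 ->
  (gcdz (g2 * (z2 * z2)) (g3 * (z3 * z3)) %| a1)%Z.
Proof. by move/sol_rot/sol_gcd12. Qed.

Lemma sol_gcd13 a1 a2 a3 g1 g2 g3 z1 z2 z3 :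
  conic_sol a1 a2 a3 g1 g2 g3 z1 z2 z3 ->
  (gcdz (g1 * (z1 * z1)) (g3 * (z3 * z3)) %| a2)%Z.
Proof. by move/sol_rot/sol_rot/sol_gcd12; rewrite gcdzC. Qed.

Lemma sol_primz a1 a2 a3 g1 g2 g3 z1 z2 z3 :
  conic_sol a1 a2 a3 g1 g2 g3 z1 z2 z3 -> prim3 z1 z2 z3.
Proof. by case=> _ _ _ _ _ _ _ hp d h1 h2 h3; apply: hp; rewrite !dvdz_mull. Qed.

Lemma sol_primg a1 a2 a3 g1 g2 g3 z1 z2 z3 :
  conic_sol a1 a2 a3 g1 g2 g3 z1 z2 z3 -> prim3 g1 g2 g3.
Proof. by case=> _ _ _ _ _ _ _ hp d h1 h2 h3; apply: hp; rewrite dvdz_mulr. Qed.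

Lemma sol_gcdg12 a1 a2 a3 g1 g2 g3 z1 z2 z3 :
  conic_sol a1 a2 a3 g1 g2 g3 z1 z2 z3 -> (gcdz g1 g2 %| a3)%Z.
Proof. by move/sol_gcd12; apply: dvdz_gcdz_trans; rewrite dvdz_mulr. Qed.

Lemma sol_gcdg13 a1 a2 a3 g1 g2 g3 z1 z2 z3 :
  conic_sol a1 a2 a3 g1 g2 g3 z1 z2 z3 -> (gcdz g1 g3 %| a2)%Z.
Proof. by move/sol_gcd13; apply: dvdz_gcdz_trans; rewrite dvdz_mulr. Qed.

Lemma sol_gcdg23 a1 a2 a3 g1 g2 g3 z1 z2 z3 :
  conic_sol a1 a2 a3 g1 g2 g3 z1 z2 z3 -> (gcdz g2 g3 %| a1)%Z.
Proof. by move/sol_gcd23; apply: dvdz_gcdz_trans; rewrite dvdz_mulr. Qed.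

Lemma dvdz_prod3 (a1 a2 a3 g1 g2 g3 X : int) :
  (gcdz g1 g2 %| a3)%Z -> (gcdz g1 g3 %| a2)%Z -> (gcdz g2 g3 %| a1)%Z ->
  (g1 %| X)%Z -> (g2 %| X)%Z -> (g3 %| X)%Z ->
  (g1 * g2 * g3 %| X * (a1 * a2 * a3))%Z.
Proof.
move=> h12 h13 h23 h1 h2 h3.
rewrite (_ : X * _ = X * a3 * (a2 * a1)); last by ring.
apply: dvdz_mulM_gcdz; [exact: dvdz_mulM_gcdz | exact: dvdz_mulr | ].
by rewrite gcdzC; apply: dvdz_gcdzMr; rewrite gcdzC.
Qed.

Definition polar (a1 a2 a3 g1 g2 g3 z1 z2 z3 y1 y2 y3 : int) :=
  a1 * g1 * (z1 * y1) + a2 * g2 * (z2 * y2) + a3 * g3 * (z3 * y3).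

(** Modulo [r] the first term drops out and the rest of the form vanishes at e, so it splits into
    the two lines x2 : x3 = e2 : s e3 with s = 1 or s = -1. Two points on the same line are
    orthogonal for the polar form. Multiplying by e2^2 and by e3^2 avoids division. *)
Lemma same_branch_dvd (a1 a2 a3 g1 g2 g3 z1 z2 z3 y1 y2 y3 e1 e2 e3 r K s : int) :
  isotropic a1 a2 a3 g1 g2 g3 e1 e2 e3 -> sqfree g1 -> prim3 e1 e2 e3 ->
  s * s = 1 -> (r %| g1)%Z ->
  (r %| K * (e2 * z3 - s * (e3 * z2)))%Z -> (r %| K * (e2 * y3 - s * (e3 * y2)))%Z ->
  (r %| K * K * polar a1 a2 a3 g1 g2 g3 z1 z2 z3 y1 y2 y3 * a1)%Z.
Proof.
move=> he sg pe ss rg rz ry.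
have h (X Y Z T U : int) : (r %| X * g1 + Y * (K * (e2 * z3 - s * (e3 * z2)))
   + Z * (K * (e2 * y3 - s * (e3 * y2)))
   + T * (a1 * g1 * (e1 * e1) + a2 * g2 * (e2 * e2) + a3 * g3 * (e3 * e3))
   + U * (s * s - 1))%Z.
  by rewrite he ss subrr !mulr0 !addr0 !rpredD // dvdz_mull.
apply: (isotropic_dvd_cancel he sg pe rg); rewrite /polar.
- have := h (K * K * a1 * (z1 * y1 * (e2 * e2) - e1 * e1 * (z2 * y2)))
     (a3 * g3 * K * (e2 * y3)) (a3 * g3 * K * s * (e3 * z2)) (K * K * (z2 * y2))
     (K * K * a3 * g3 * (e3 * e3 * z2 * y2)).
  by congr (is_true (r %| _)%Z); ring.
- have := h (K * K * a1 * (z1 * y1 * (e3 * e3) - e1 * e1 * (z3 * y3)))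
     (- (a2 * g2 * K * (e2 * y3))) (- (a2 * g2 * K * s * (e3 * z2))) (K * K * (z3 * y3))
     (- (K * K * a2 * g2 * (e3 * e3 * z2 * y2))).
  by congr (is_true (r %| _)%Z); ring.
Qed.

(** The gcd c of [g1] with e2 z3 - e3 z2 collects the primes of [g1] at which z lies on the line of
    e; modulo the cofactor d, coprime to c, it lies on the other line. Equal gcds mean the same
    choice of line at every prime, so [same_branch_dvd] applies modulo c with s = 1 and modulo d
    with s = -1. *)
Lemma same_class_dvd1 (a1 a2 a3 g1 g2 g3 z1 z2 z3 y1 y2 y3 e1 e2 e3 : int) :
  conic_sol a1 a2 a3 g1 g2 g3 z1 z2 z3 -> conic_sol a1 a2 a3 g1 g2 g3 y1 y2 y3 ->
  isotropic a1 a2 a3 g1 g2 g3 e1 e2 e3 -> prim3 e1 e2 e3 ->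
  gcdz g1 (e2 * z3 - e3 * z2) = gcdz g1 (e2 * y3 - e3 * y2) ->
  (g1 %| polar a1 a2 a3 g1 g2 g3 z1 z2 z3 y1 y2 y3 * (a1 * a2 * a3 * (a1 * a2 * a3)))%Z.
Proof.
move=> solz soly he pe hg.
have sg := sol_sq1 solz.
have [d ed] : exists d, g1 = d * gcdz g1 (e2 * z3 - e3 * z2).
  by apply/dvdzP; rewrite dvdz_gcdl.
set c := gcdz g1 _ in ed hg.
have cop : coprimez d c by apply: sqfree_coprime; rewrite -ed.
have dg : (d %| g1)%Z by apply/dvdzP; exists c; rewrite mulrC.
have cg : (c %| g1)%Z by apply/dvdzP; exists d.
have plus x1 x2 x3 : conic_sol a1 a2 a3 g1 g2 g3 x1 x2 x3 -> gcdz g1 (e2 * x3 - e3 * x2) = c ->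
    (d %| a2 * a3 * (e2 * x3 - (-1) * (e3 * x2)))%Z.
  move=> solx hc.
  have cdx : coprimez d (e2 * x3 - e3 * x2).
    have h : (gcdz d (e2 * x3 - e3 * x2) %| gcdz d c)%Z.
      rewrite dvdz_gcd dvdz_gcdl -hc dvdz_gcd dvdz_gcdr.
      by rewrite (dvdz_trans (dvdz_gcdl _ _) dg).
    move: h; rewrite (eqP cop) => /dvdz1_norm; rewrite ger0_norm // => h.
    by rewrite /coprimez h.
  rewrite (_ : a2 * a3 * _ = a2 * (e2 * x3 - (-1) * (e3 * x2)) * a3); last by ring.
  apply: (@dvdz_mul_gcdz _ _ g2); last first.
    by apply: dvdz_gcdz_trans (sol_gcdg12 solx) => //.
  rewrite -(Gauss_dvdzr _ cdx).
  have -> : (e2 * x3 - e3 * x2) * (a2 * (e2 * x3 - -1 * (e3 * x2)) * g2) =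
     a1 * (x1 * x1 * (e3 * e3) - e1 * e1 * (x3 * x3)) * g1
     + (a1 * g1 * (e1 * e1) + a2 * g2 * (e2 * e2) + a3 * g3 * (e3 * e3)) * (x3 * x3)
     - (a1 * g1 * (x1 * x1) + a2 * g2 * (x2 * x2) + a3 * g3 * (x3 * x3)) * (e3 * e3).
    by ring.
  by rewrite he (sol_eq solx) !mul0r addr0 subr0 dvdz_mull.
have pz := plus _ _ _ solz erefl.
have py := plus _ _ _ soly (esym hg).
have Hd := @same_branch_dvd a1 a2 a3 g1 g2 g3 z1 z2 z3 y1 y2 y3 e1 e2 e3 d (a2 * a3) (-1)
   he sg pe (mulrNN 1 1) dg pz py.
have Hc : (c %| 1 * 1 * polar a1 a2 a3 g1 g2 g3 z1 z2 z3 y1 y2 y3 * a1)%Z.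
  apply: (@same_branch_dvd a1 a2 a3 g1 g2 g3 z1 z2 z3 y1 y2 y3 e1 e2 e3 c 1 1 he sg pe (mul1r 1) cg); rewrite !mul1r ?dvdz_gcdr //.
  by rewrite hg dvdz_gcdr.
move: Hc Hd; set b := polar _ _ _ _ _ _ _ _ _ _ _ _ => Hc Hd.
rewrite ed Gauss_dvdz //; apply/andP; split.
  move: Hd => /(dvdz_mulr a1).
  by congr (is_true (d %| _)%Z); ring.
move: Hc => /(dvdz_mulr (a2 * a3 * (a1 * a2 * a3))).
by congr (is_true (c %| _)%Z); ring.
Qed.

Lemma bil_rot a1 a2 a3 g1 g2 g3 z1 z2 z3 y1 y2 y3 :
  polar a2 a3 a1 g2 g3 g1 z2 z3 z1 y2 y3 y1 = polar a1 a2 a3 g1 g2 g3 z1 z2 z3 y1 y2 y3.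
Proof. by rewrite /polar; ring. Qed.

Lemma same_class_dvd (a1 a2 a3 g1 g2 g3 z1 z2 z3 y1 y2 y3 e1 e2 e3 : int) :
  conic_sol a1 a2 a3 g1 g2 g3 z1 z2 z3 -> conic_sol a1 a2 a3 g1 g2 g3 y1 y2 y3 ->
  isotropic a1 a2 a3 g1 g2 g3 e1 e2 e3 -> prim3 e1 e2 e3 ->
  gcdz g1 (e2 * z3 - e3 * z2) = gcdz g1 (e2 * y3 - e3 * y2) ->
  gcdz g2 (e3 * z1 - e1 * z3) = gcdz g2 (e3 * y1 - e1 * y3) ->
  gcdz g3 (e1 * z2 - e2 * z1) = gcdz g3 (e1 * y2 - e2 * y1) ->
  (g1 * g2 * g3 %| polar a1 a2 a3 g1 g2 g3 z1 z2 z3 y1 y2 y3 * (a1 * a2 * a3) ^+ 3)%Z.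
Proof.
move=> sz sy he pe h1 h2 h3.
rewrite (_ : _ ^+ 3 = a1 * a2 * a3 * (a1 * a2 * a3) * (a1 * a2 * a3)); last by ring.
rewrite mulrA.
have hrot := same_class_dvd1 (sol_rot sz) (sol_rot sy) (isotropic_rot he) (prim3_rot pe) h2.
have hrot2 := same_class_dvd1 (sol_rot (sol_rot sz)) (sol_rot (sol_rot sy))
  (isotropic_rot (isotropic_rot he)) (prim3_rot (prim3_rot pe)) h3.
apply: dvdz_prod3 (sol_gcdg12 sz) (sol_gcdg13 sz) (sol_gcdg23 sz) _ _ _.
- exact: (same_class_dvd1 sz sy he pe h1).
- by move: hrot; rewrite bil_rot; congr (is_true (g2 %| _)%Z); ring.
- by move: hrot2; rewrite 2!bil_rot; congr (is_true (g3 %| _)%Z); ring.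
Qed.

(** Eliminating one coordinate between the conic and the line sum g_i w_i x_i = 0 leaves a quadratic
    equation whose outer coefficients are g_j times such numbers N_j. If u is the second
    intersection besides z, the product of the roots shows that the g_i z_i u_i are proportional to
    the N_i. *)
Definition dual_coef (a2 a3 g2 g3 w2 w3 : int) := a2 * g3 * (w3 * w3) + a3 * g2 * (w2 * w2).

(** The terms in z1 of the conic and of the line vanish modulo g1 z1, which makes g1 z1 divide the
    products of the coefficient with g2 z2^2 and with g3 z3^2; the gcd of these two factors divides
    [a1]. *)
Lemma dual_coef_dvd a1 a2 a3 g1 g2 g3 z1 z2 z3 w1 w2 w3 :
  conic_sol a1 a2 a3 g1 g2 g3 z1 z2 z3 ->
  g1 * z1 * w1 + g2 * z2 * w2 + g3 * z3 * w3 = 0 ->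
  (g1 * z1 %| dual_coef a2 a3 g2 g3 w2 w3 * a1)%Z.
Proof.
move=> solz hw; set N := dual_coef _ _ _ _ _ _.
have he := sol_eq solz; rewrite /isotropic in he.
have h2 : (g1 * z1 %| N * (g2 * (z2 * z2)))%Z.
  have -> : N * (g2 * (z2 * z2)) = g1 * z1 * (- (a1 * z1 * g3 * (w3 * w3)) +
     w1 * a3 * (g3 * z3 * w3 - g2 * z2 * w2)) +
     (a1 * g1 * (z1 * z1) + a2 * g2 * (z2 * z2) + a3 * g3 * (z3 * z3)) * (g3 * (w3 * w3))
     + (g1 * z1 * w1 + g2 * z2 * w2 + g3 * z3 * w3) * (a3 * (g2 * z2 * w2 - g3 * z3 * w3)).
    by rewrite /N /dual_coef; ring.
  by rewrite he hw !mul0r !addr0 dvdz_mulr.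
have h3 : (g1 * z1 %| N * (g3 * (z3 * z3)))%Z.
  have -> : N * (g3 * (z3 * z3)) = g1 * z1 * (- (a1 * z1 * g2 * (w2 * w2)) +
     w1 * a2 * (g2 * z2 * w2 - g3 * z3 * w3)) +
     (a1 * g1 * (z1 * z1) + a2 * g2 * (z2 * z2) + a3 * g3 * (z3 * z3)) * (g2 * (w2 * w2))
     + (g1 * z1 * w1 + g2 * z2 * w2 + g3 * z3 * w3) * (a2 * (g3 * z3 * w3 - g2 * z2 * w2)).
    by rewrite /N /dual_coef; ring.
  by rewrite he hw !mul0r !addr0 dvdz_mulr.
have [u [v e]] := Bezoutz (g2 * (z2 * z2)) (g3 * (z3 * z3)).
have /dvdzP[q ->] := sol_gcd23 solz.
rewrite -e (_ : _ * _ = q * u * (N * (g2 * (z2 * z2))) + q * v * (N * (g3 * (z3 * z3))));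
  last by ring.
by rewrite rpredD // dvdz_mull.
Qed.

(** Divisibility of the cross product by [g1] says that u and z lie on the same line at the primes
    of [g1], so that the second intersection belongs to the class of z, up to the a_i. *)
Lemma dual_cross_dvd a1 a2 a3 g1 g2 g3 z1 z2 z3 w1 w2 w3 K u2 u3 :
  conic_sol a1 a2 a3 g1 g2 g3 z1 z2 z3 ->
  g1 * z1 * w1 + g2 * z2 * w2 + g3 * z3 * w3 = 0 ->
  g2 * z2 * u2 = K * dual_coef a3 a1 g3 g1 w3 w1 ->
  g3 * z3 * u3 = K * dual_coef a1 a2 g1 g2 w1 w2 ->
  (g1 %| (u2 * z3 - u3 * z2) * (a2 * a3 * (a2 * a3)))%Z.
Proof.
move=> solz hw h2 h3.
rewrite (_ : _ * (_ * _ * _) = (u2 * z3 - u3 * z2) * (a3 * a2 * (a3 * a2))); last by ring.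
apply: (@dvdz_mul_gcdz _ _ (g2 * g3 * (z2 * z3))).
  have -> : (u2 * z3 - u3 * z2) * (g2 * g3 * (z2 * z3)) =
     g2 * z2 * u2 * (g3 * (z3 * z3)) - g3 * z3 * u3 * (g2 * (z2 * z2)) by ring.
  rewrite h2 h3 /dual_coef.
  have -> : K * (a3 * g1 * (w1 * w1) + a1 * g3 * (w3 * w3)) * (g3 * (z3 * z3)) -
    K * (a1 * g2 * (w2 * w2) + a2 * g1 * (w1 * w1)) * (g2 * (z2 * z2)) =
    K * (w1 * (w1 * (a3 * g3 * (z3 * z3) - a2 * g2 * (z2 * z2)) -
      a1 * z1 * (g3 * z3 * w3 - g2 * z2 * w2))) * g1
    + K * a1 * (g3 * z3 * w3 - g2 * z2 * w2) * (g1 * z1 * w1 + g2 * z2 * w2 + g3 * z3 * w3).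
    by ring.
  by rewrite hw mulr0 addr0 dvdz_mull.
have d12 := sol_gcd12 solz; have d13 := sol_gcd13 solz.
have aux g (z : int) : (z %| g * (z * z))%Z by rewrite mulrA dvdz_mull.
apply: dvdz_gcdzMr; apply: dvdz_gcdzMr;
  [apply: dvdz_gcdz_trans d12|apply: dvdz_gcdz_trans d13
  |apply: dvdz_gcdz_trans d12|apply: dvdz_gcdz_trans d13];
  by rewrite ?aux // dvdz_mulr.
Qed.

(* The line sum g_i w_i x_i = 0 through z meets the conic in a second point, whose
   coordinates are quadratic in w. One factor a1 a2 a3 clears the denominators, the other
   two put the point in the class of z. *)
Lemma second_point a1 a2 a3 g1 g2 g3 z1 z2 z3 w1 w2 w3 :
  a1 * a2 * a3 != 0 ->
  conic_sol a1 a2 a3 g1 g2 g3 z1 z2 z3 ->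
  g1 * z1 * w1 + g2 * z2 * w2 + g3 * z3 * w3 = 0 ->
  exists u1 u2 u3 : int, [/\ [/\ g1 * z1 * u1 = (a1 * a2 * a3) ^+ 3 * dual_coef a2 a3 g2 g3 w2 w3,
        g2 * z2 * u2 = (a1 * a2 * a3) ^+ 3 * dual_coef a3 a1 g3 g1 w3 w1 &
        g3 * z3 * u3 = (a1 * a2 * a3) ^+ 3 * dual_coef a1 a2 g1 g2 w1 w2],
    isotropic a1 a2 a3 g1 g2 g3 u1 u2 u3,
    (u1 = 0 -> u2 = 0 -> u3 = 0 -> [/\ w1 = 0, w2 = 0 & w3 = 0]) &
    [/\ (g1 %| u2 * z3 - u3 * z2)%Z, (g2 %| u3 * z1 - u1 * z3)%Z &
        (g3 %| u1 * z2 - u2 * z1)%Z]].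
Proof.
move=> A0 solz hw; set A := a1 * a2 * a3 in A0 *.
have hw2 : g2 * z2 * w2 + g3 * z3 * w3 + g1 * z1 * w1 = 0 by rewrite -[RHS]hw; ring.
have hw3 : g3 * z3 * w3 + g1 * z1 * w1 + g2 * z2 * w2 = 0 by rewrite -[RHS]hw; ring.
have s2 := sol_rot solz; have s3 := sol_rot s2.
have /dvdzP[v1 e1] := dual_coef_dvd solz hw.
have /dvdzP[v2 e2] := dual_coef_dvd s2 hw2.
have /dvdzP[v3 e3] := dual_coef_dvd s3 hw3.
set N1 := dual_coef a2 a3 g2 g3 w2 w3 in e1 *.
set N2 := dual_coef a3 a1 g3 g1 w3 w1 in e2 *.
set N3 := dual_coef a1 a2 g1 g2 w1 w2 in e3 *.
pose q1 := v1 * (a2 * a3); pose q2 := v2 * (a3 * a1); pose q3 := v3 * (a1 * a2).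
have f1 : g1 * z1 * q1 = A * N1.
  by rewrite /A (_ : _ * N1 = N1 * a1 * (a2 * a3)); [rewrite e1 /q1|]; ring.
have f2 : g2 * z2 * q2 = A * N2.
  by rewrite /A (_ : _ * N2 = N2 * a2 * (a3 * a1)); [rewrite e2 /q2|]; ring.
have f3 : g3 * z3 * q3 = A * N3.
  by rewrite /A (_ : _ * N3 = N3 * a3 * (a1 * a2)); [rewrite e3 /q3|]; ring.
have g10 := sqfree_neq0 (sol_sq1 solz); have g20 := sqfree_neq0 (sol_sq2 solz).
have g30 := sqfree_neq0 (sol_sq3 solz).
have z10 := lt0r_neq0 (sol_z1 solz); have z20 := lt0r_neq0 (sol_z2 solz).
have z30 := lt0r_neq0 (sol_z3 solz).
have he := sol_eq solz; rewrite /isotropic in he.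
have a10 : a1 != 0 by apply: contra_neq A0; rewrite /A => ->; rewrite !mul0r.
have a20 : a2 != 0 by apply: contra_neq A0; rewrite /A => ->; rewrite mulr0 mul0r.
have a30 : a3 != 0 by apply: contra_neq A0; rewrite /A => ->; rewrite mulr0.
exists (A * A * q1), (A * A * q2), (A * A * q3); split.
- split.
  + by rewrite (_ : _ * _ * _ = A * A * (g1 * z1 * q1)); [rewrite f1|]; ring.
  + by rewrite (_ : _ * _ * _ = A * A * (g2 * z2 * q2)); [rewrite f2|]; ring.
  + by rewrite (_ : _ * _ * _ = A * A * (g3 * z3 * q3)); [rewrite f3|]; ring.
(* Multiplied by (p1 p2 p3)^2, the equation becomes polynomial in t_i = a_i p_i and r_i = g_i z_i
   w_i. Both triples have sum 0, and after eliminating t3 and r3 it is an identity. *)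
- pose p1 := g1 * (z1 * z1); pose p2 := g2 * (z2 * z2); pose p3 := g3 * (z3 * z3).
  have P0 : p1 * p2 * p3 * (p1 * p2 * p3) != 0 by rewrite !mulf_neq0.
  apply: (mulIf P0); rewrite mul0r !mulrDl.
  pose t1 := a1 * p1; pose t2 := a2 * p2; pose t3 := a3 * p3.
  pose r1 := g1 * z1 * w1; pose r2 := g2 * z2 * w2; pose r3 := g3 * z3 * w3.
  have T1 : p2 * p3 * N1 = t2 * (r3 * r3) + t3 * (r2 * r2).
    by rewrite /t2 /t3 /p2 /p3 /r2 /r3 /N1 /dual_coef; ring.
  have T2 : p3 * p1 * N2 = t3 * (r1 * r1) + t1 * (r3 * r3).
    by rewrite /t1 /t3 /p1 /p3 /r1 /r3 /N2 /dual_coef; ring.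
  have T3 : p1 * p2 * N3 = t1 * (r2 * r2) + t2 * (r1 * r1).
    by rewrite /t1 /t2 /p1 /p2 /r1 /r2 /N3 /dual_coef; ring.
  have gen (a g z q N x y : int) : g * z * q = A * N ->
      a * g * (A * A * q * (A * A * q)) * (g * (z * z) * (x * y) * (g * (z * z) * (x * y))) =
      A ^+ 6 * (a * (g * (z * z)) * (x * y * N) ^+ 2).
    move=> h; have -> : a * g * (A * A * q * (A * A * q)) *
        (g * (z * z) * (x * y) * (g * (z * z) * (x * y))) =
        A ^+ 4 * a * (g * (z * z)) * (x * y) ^+ 2 * (g * z * q) ^+ 2 by ring.
    by rewrite h; ring.
  have := gen a1 _ _ _ _ p2 p3 f1; rewrite -/p1 T1 (_ : p1 * (p2 * p3) = p1 * p2 * p3); last by ring.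
  move=> ->.
  have := gen a2 _ _ _ _ p3 p1 f2; rewrite -/p2 T2 (_ : p2 * (p3 * p1) = p1 * p2 * p3); last by ring.
  move=> ->.
  have := gen a3 _ _ _ _ p1 p2 f3; rewrite -/p3 T3 (_ : p3 * (p1 * p2) = p1 * p2 * p3); last by ring.
  move=> ->; rewrite -/t1 -/t2 -/t3 -!mulrDr.
  have -> : t3 = - (t1 + t2).
    by apply/eqP; rewrite -addr_eq0 -he; apply/eqP; rewrite /t1 /t2 /t3 /p1 /p2 /p3; ring.
  have -> : r3 = - (r1 + r2).
    by apply/eqP; rewrite -addr_eq0 -hw; apply/eqP; rewrite /r1 /r2 /r3; ring.
  move: (A) (t1) (t2) (r1) (r2) => B s t x y; ring.
(* The squares w_i^2 are linear combinations of N1, N2, N3, so they vanish with them. *)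
- move=> u1 u2 u3.
  have AA : A * A != 0 by rewrite mulf_neq0.
  have k1 : q1 = 0 by apply: (mulfI AA); rewrite mulr0.
  have k2 : q2 = 0 by apply: (mulfI AA); rewrite mulr0.
  have k3 : q3 = 0 by apply: (mulfI AA); rewrite mulr0.
  have n1 : N1 = 0 by apply: (mulfI A0); rewrite mulr0 -f1 k1 mulr0.
  have n2 : N2 = 0 by apply: (mulfI A0); rewrite mulr0 -f2 k2 mulr0.
  have n3 : N3 = 0 by apply: (mulfI A0); rewrite mulr0 -f3 k3 mulr0.
  have two0 : 2 != 0 :> int by [].
  have fin (c w : int) : c != 0 -> 2 * c * (w * w) = 0 -> w = 0.
    move=> c0 /eqP; rewrite !mulf_eq0 (negPf c0) /= => h; apply/eqP.
    by move: h; rewrite orbb.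
  split.
  + apply: (@fin (a2 * a3 * g1)); first by rewrite !mulf_neq0.
    have -> : 2 * (a2 * a3 * g1) * (w1 * w1) = a2 * N2 + a3 * N3 - a1 * N1.
      by rewrite /N1 /N2 /N3 /dual_coef; ring.
    by rewrite n1 n2 n3 !mulr0 addr0 subr0.
  + apply: (@fin (a1 * a3 * g2)); first by rewrite !mulf_neq0.
    have -> : 2 * (a1 * a3 * g2) * (w2 * w2) = a1 * N1 + a3 * N3 - a2 * N2.
      by rewrite /N1 /N2 /N3 /dual_coef; ring.
    by rewrite n1 n2 n3 !mulr0 addr0 subr0.
  + apply: (@fin (a1 * a2 * g3)); first by rewrite !mulf_neq0.
    have -> : 2 * (a1 * a2 * g3) * (w3 * w3) = a1 * N1 + a2 * N2 - a3 * N3.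
      by rewrite /N1 /N2 /N3 /dual_coef; ring.
    by rewrite n1 n2 n3 !mulr0 addr0 subr0.
- split.
  + have := dvdz_mulr (a1 * a1) (dual_cross_dvd solz hw f2 f3).
    by congr (is_true (g1 %| _)%Z); rewrite /A; ring.
  + have := dvdz_mulr (a2 * a2) (dual_cross_dvd s2 hw2 f3 f1).
    by congr (is_true (g2 %| _)%Z); rewrite /A; ring.
  + have := dvdz_mulr (a3 * a3) (dual_cross_dvd s3 hw3 f1 f2).
    by congr (is_true (g3 %| _)%Z); rewrite /A; ring.
Qed.

(** * Counting by duplicate-free lists *)

(* Every duplicate-free list of elements satisfying P has length at most n; in particular
   finiteness needs no separate proof. *)
Definition cardle (R : realType) (T : eqType) (P : T -> Prop) (n : R) :=
  forall s : seq T, uniq s -> (forall x, x \in s -> P x) -> (size s)%:R <= n.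

Section Cardle3.
Variable R : realType.
Implicit Types (T U : eqType) (n m : R).

Lemma cardle_sub T (P Q : T -> Prop) n m :
  (forall x, P x -> Q x) -> n <= m -> cardle Q n -> cardle P m.
Proof.
move=> PQ nm hQ s us hs; apply: le_trans nm; apply: hQ => // x xs.
exact/PQ/hs.
Qed.

Lemma cardle_ge0 T (P : T -> Prop) n : cardle P n -> 0 <= n.
Proof. by move=> /(_ [::] isT); apply. Qed.

Lemma cardle_sum T U (P : T -> Prop) (f : T -> U) (l : seq U) (m : U -> R) :
  (forall x, P x -> f x \in l) ->
  (forall u, u \in l -> cardle (fun x => P x /\ f x = u) (m u)) ->
  cardle P (\sum_(u <- l) m u).
Proof.
elim: l P => [|u l IH] P hl hm s us hs.
  rewrite big_nil; case: s us hs => // x s _ /(_ x (mem_head _ _)) /hl.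
  by rewrite in_nil.
rewrite big_cons -(count_predC (fun x => f x == u) s) natrD -!size_filter.
apply: lerD.
  apply: (hm u (mem_head _ _)); first exact: filter_uniq.
  by move=> x; rewrite mem_filter => /andP[/eqP fx /hs].
apply: (IH (fun x => P x /\ f x != u)).
- by move=> x [/hl]; rewrite inE => /orP[/eqP ->|//]; rewrite eqxx.
- move=> v vl; apply: (cardle_sub (Q := fun x => P x /\ f x = v)) (hm v _); rewrite ?inE ?vl ?orbT //.
  by move=> x [[]].
- exact: filter_uniq.
- by move=> x; rewrite mem_filter => /andP[fx /hs].
Qed.

Lemma cardle_fiber T U (P : T -> Prop) (Q : U -> Prop) (f : T -> U) n m :
  (forall x, P x -> Q (f x)) -> 0 <= m -> cardle Q n ->
  (forall u, Q u -> cardle (fun x => P x /\ f x = u) m) -> cardle P (n * m).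
Proof.
move=> PQ m0 hQ hf s us hs.
pose l := undup (map f s).
have h1 : (size s)%:R <= \sum_(u <- l) m.
  apply: (@cardle_sum T U (fun x => P x /\ x \in s) f l (fun=> m)) => //.
  - by move=> x [_ xs]; rewrite mem_undup map_f.
  - move=> u; rewrite mem_undup => /mapP[x xs ->].
    apply: (cardle_sub (Q := fun y => P y /\ f y = f x)) (hf _ _) => //.
      by move=> y [[]].
    exact/PQ/hs.
  - by move=> x xs; split => //; exact: hs.
apply: le_trans h1 _; rewrite big_const_seq count_predT iter_addr addr0 -mulr_natl.
apply: ler_wpM2r => //; apply: hQ; first exact: undup_uniq.
by move=> u; rewrite mem_undup => /mapP[x xs ->]; exact/PQ/hs.
Qed.

Lemma cardle_inj T U (P : T -> Prop) (Q : U -> Prop) (f : T -> U) n :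
  (forall x, P x -> Q (f x)) -> (forall x y, P x -> P y -> f x = f y -> x = y) ->
  cardle Q n -> cardle P n.
Proof.
move=> PQ fi hQ s us hs; rewrite -(size_map f); apply: hQ.
  by rewrite map_inj_in_uniq // => x y /hs Px /hs Py; exact: fi.
by move=> u /mapP[x xs ->]; exact/PQ/hs.
Qed.

Lemma cardle_or T (P Q Q' : T -> Prop) n m :
  (forall x, P x -> Q x \/ Q' x) -> cardle Q n -> cardle Q' m -> cardle P (n + m).
Proof.
move=> PQ hQ hQ' s us hs.
rewrite -(count_predC (fun x => `[< Q x >]) s) natrD -!size_filter.
apply: lerD; [apply: hQ|apply: hQ']; try exact: filter_uniq;
  move=> x; rewrite mem_filter => /andP[].
  by move/asboolP.
by move=> /= /asboolPn nQ /hs /PQ[].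
Qed.

Lemma cardle_int_pos (N : R) : 0 <= N ->
  cardle (fun z : int => 0 < z /\ z%:~R <= N) N.
Proof.
move=> N0 s us hs.
have k0 : 0 <= Num.floor N by rewrite floor_ge0.
have : (size (map absz s) <= size (iota 1 `|Num.floor N|%N))%N.
  apply: uniq_leq_size.
    rewrite map_inj_in_uniq // => x y /hs[x0 _] /hs[y0 _] e.
    by rewrite -(gtz0_abs x0) -(gtz0_abs y0) e.
  move=> k /mapP[z /hs[z0 zN] ->]; rewrite mem_iota.
  have : z <= Num.floor N by rewrite floor_ge_int.
  move: (Num.floor N) k0 z0 => F; clear; lia.
rewrite size_map size_iota => h.
apply: le_trans (floor_le N); rewrite -(gez0_abs k0) -pmulrn ler_nat.
exact: h.
Qed.

Lemma cardle_int_neq0 (N : R) : 0 <= N ->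
  cardle (fun z : int => z != 0 /\ `|z|%:~R <= N) (2 * N).
Proof.
move=> N0; rewrite mulrDl mul1r.
apply: (@cardle_or _ _ (fun z : int => 0 < z /\ z%:~R <= N) (fun z : int => 0 < - z /\ (- z)%:~R <= N)).
- move=> z [z0]; case: (ltrgt0P z) z0 => // z0 _ hz; [left|right]; split => //; lia.
- exact: cardle_int_pos.
- apply: (@cardle_inj _ _ _ _ (fun z : int => - z)) (cardle_int_pos N0) => //.
  by move=> x y _ _ /oppr_inj.
Qed.

Lemma cardle_sep T (P : T -> Prop) (f : T -> R) (lo hi eta : R) :
  0 < eta -> lo <= hi -> (forall x, P x -> lo <= f x <= hi) ->
  (forall x y, P x -> P y -> x <> y -> eta <= `|f x - f y|) ->
  cardle P (1 + (hi - lo) / eta).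
Proof.
move=> e0 lh hf sep.
have N0 : 0 <= 1 + (hi - lo) / eta.
  by rewrite addr_ge0 // divr_ge0 ?subr_ge0 // ltW.
(* Each element goes to the cell of width [eta] containing its value, and a cell holds at most one;
   the shift by 1 makes the cell numbers positive, as [cardle_int_pos] requires. *)
apply: (@cardle_inj _ _ _ _ (fun x => Num.floor ((f x - lo) / eta) + 1)) (cardle_int_pos N0).
  move=> x /hf /andP[lx xh].
  have h0 : 0 <= (f x - lo) / eta by rewrite divr_ge0 ?subr_ge0 // ltW.
  have := h0; rewrite -floor_ge0 => h1; split; first by rewrite ltzD1.
  rewrite intrD addrC lerD2l; apply: le_trans (floor_le _) _.
  by rewrite ler_pM2r ?invr_gt0 // lerD2r.
move=> x y Px Py /addIr e.
have [//|xy] := pselect (x = y).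
have := sep x y Px Py xy.
have /andP[h1 h2] := floor_itv ((f x - lo) / eta).
have /andP[h3 h4] := floor_itv ((f y - lo) / eta).
move: h1 h2 h3 h4; rewrite e; move: (Num.floor _) => k; rewrite !intrD.
rewrite ler_pdivlMr // ltr_pdivrMr // ler_pdivlMr // ltr_pdivrMr //.
rewrite !mulrDl mulr1z mul1r => h1 h2 h3 h4.
by rewrite leNgt; have -> // : `|f x - f y| < eta; rewrite ltr_norml; apply/andP; split; lra.
Qed.

End Cardle3.

(** * Fixed z: a plane of coefficients *)

Section Plane4.
Variable R : realType.

Lemma cardle_prod (T U : eqType) (P : T -> Prop) (Q : U -> Prop) (n m : R) :
  cardle P n -> cardle Q m -> cardle (fun x : T * U => P x.1 /\ Q x.2) (n * m).
Proof.
move=> hP hQ; apply: (@cardle_fiber _ _ _ _ P (fun x => x.1)) => //.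
- by move=> x [].
- exact: cardle_ge0 hQ.
- move=> u _; apply: (@cardle_inj _ _ _ _ Q (fun x => x.2)) hQ.
    by move=> x [[]].
  by move=> [x1 x2] [y1 y2] /= [_ ->] [_ ->] ->.
Qed.

Lemma prim3_prop (x1 x2 x3 y1 y2 y3 : int) :
  prim3 x1 x2 x3 -> prim3 y1 y2 y3 -> 0 < x1 -> 0 < y1 ->
  x1 * y2 = x2 * y1 -> x1 * y3 = x3 * y1 -> [/\ x1 = y1, x2 = y2 & x3 = y3].
Proof.
move=> px py x0 y0 h2 h3.
have d1 : (x1 %| y1)%Z.
  apply: (dvdz_prim3 px); first exact: dvdz_mull; apply/dvdzP.
    by exists y2; rewrite mulrC -h2 mulrC.
  by exists y3; rewrite mulrC -h3 mulrC.
have d2 : (y1 %| x1)%Z.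
  apply: (dvdz_prim3 py); first exact: dvdz_mull; apply/dvdzP.
    by exists x2; rewrite h2.
  by exists x3; rewrite h3.
have e : x1 = y1.
  have [q eq] := dvdzP d1; have [r er] := dvdzP d2.
  have q0 : 0 < q by rewrite -(pmulr_lgt0 _ x0) -eq.
  have r0 : 0 < r by rewrite -(pmulr_lgt0 _ y0) -er.
  have : y1 <= x1 by rewrite er ler_peMl // ?ltW //.
  have : x1 <= y1 by rewrite eq ler_peMl // ?ltW //.
  by move=> *; apply/eqP; rewrite eq_le; apply/andP.
split => //.
  by apply/esym/(mulfI (lt0r_neq0 x0)); rewrite h2 -e mulrC.
by apply/esym/(mulfI (lt0r_neq0 x0)); rewrite h3 -e mulrC.
Qed.

Lemma cardle_opp3 (P : int * int * int -> Prop) (N : R) :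
  (forall g1 g2 g3, P (g1, g2, g3) -> P (- g1, - g2, - g3)) ->
  (forall g1 g2 g3, P (g1, g2, g3) -> g1 != 0) ->
  cardle (fun g => P g /\ 0 < g.1.1) N -> cardle P (2 * N).
Proof.
move=> hN h0 hP; rewrite mulrDl mul1r.
apply: (@cardle_or _ _ _ _ (fun g => P g /\ g.1.1 < 0) _ _ _ hP).
  move=> [[g1 g2] g3] Pg; have /= := h0 _ _ _ Pg.
  by case: (ltrgt0P g1) => // hg _; [left|right].
apply: (@cardle_inj _ _ _ _ _ (fun g => (- g.1.1, - g.1.2, - g.2))) hP.
  by move=> [[g1 g2] g3] /= [/hN Pg h]; rewrite oppr_gt0.
by move=> [[g1 g2] g3] [[f1 f2] f3] _ _ /= [/oppr_inj -> /oppr_inj -> /oppr_inj ->].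
Qed.

(** The cross product of two solutions g, f is parallel to (n1, n2, n3), so n3 divides c (g1 f2 - g2
    f1), and the slopes g2 / g1 differ by at least |n3| / (|c| H1^2). They lie in an interval of
    length 128 H2 / H1. The outer factor 2 is the sign of g. *)
Lemma plane_count (n1 n2 n3 c : int) (H1 H2 : R) :
  n3 != 0 -> c != 0 -> (gcdz n1 (gcdz n2 n3) %| c)%Z -> 0 < H1 -> 0 <= H2 ->
  cardle (fun g : int * int * int => [/\ n1 * g.1.1 + n2 * g.1.2 + n3 * g.2 = 0,
      prim3 g.1.1 g.1.2 g.2, H1 / 64 <= `|g.1.1|%:~R <= H1 & `|g.1.2|%:~R <= H2])
    (2 * (1 + 128 * `|c|%:~R * H1 * H2 / `|n3|%:~R)).
Proof.
move=> n30 c0 hc H10 H20.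
have n3R : 0 < `|n3|%:~R :> R by rewrite ltr0z normr_gt0.
have cR : 0 < `|c|%:~R :> R by rewrite ltr0z normr_gt0.
apply: cardle_opp3.
- move=> g1 g2 g3 /= [h1 h2 h3 h4]; rewrite !normrN; split => //.
    by rewrite !mulrN -!opprD h1 oppr0.
  by move=> d; rewrite !rpredN; exact: h2.
- move=> g1 g2 g3 /= [_ _ /andP[h _] _]; apply: contraTneq h => ->.
  by rewrite normr0 mulr0z -ltNge divr_gt0.
pose eta : R := `|n3|%:~R / `|c|%:~R / (H1 * H1).
have eta0 : 0 < eta by rewrite !divr_gt0 // mulr_gt0.
pose hi : R := 64 * H2 / H1.
have hi0 : 0 <= hi by rewrite divr_ge0 ?mulr_ge0 // ltW.
have -> : 1 + 128 * `|c|%:~R * H1 * H2 / `|n3|%:~R = 1 + (hi - - hi) / eta.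
  by rewrite /hi /eta; field; rewrite !gt_eqF.
apply: (@cardle_sep _ _ _ (fun g => g.1.2%:~R / g.1.1%:~R)) => //.
- by rewrite -subr_ge0 opprK addr_ge0.
- move=> [[g1 g2] g3] /= [[_ _ /andP[l1 u1] u2] g10].
  have g1R : 0 < g1%:~R :> R by rewrite ltr0z.
  rewrite gtr0_norm // in l1 u1.
  rewrite -ler_norml normrM normfV (gtr0_norm g1R) ler_pdivrMr // -intr_norm.
  apply: le_trans u2 _.
  have <- : hi * (H1 / 64) = H2 by rewrite /hi; field; rewrite gt_eqF.
  exact: ler_wpM2l.
- move=> [[g1 g2] g3] [[f1 f2] f3] /= [[eg pg /andP[_ ug] _] g0] [[ef pf /andP[_ uf] _] f0] gf.
  rewrite gtr0_norm // in ug; rewrite gtr0_norm // in uf.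
  have g1R : 0 < g1%:~R :> R by rewrite ltr0z.
  have f1R : 0 < f1%:~R :> R by rewrite ltr0z.
  pose X := g1 * f2 - g2 * f1.
  have e1 : n1 * X = n3 * (g2 * f3 - g3 * f2).
    have -> : n1 * X = n3 * (g2 * f3 - g3 * f2) + f2 * (n1 * g1 + n2 * g2 + n3 * g3)
       - g2 * (n1 * f1 + n2 * f2 + n3 * f3) by rewrite /X; ring.
    by rewrite eg ef !mulr0 addr0 subr0.
  have e2 : n2 * X = n3 * (g3 * f1 - g1 * f3).
    have -> : n2 * X = n3 * (g3 * f1 - g1 * f3) - f1 * (n1 * g1 + n2 * g2 + n3 * g3)
       + g1 * (n1 * f1 + n2 * f2 + n3 * f3) by rewrite /X; ring.
    by rewrite eg ef !mulr0 addr0 subr0.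
  have X0 : X != 0.
    apply/eqP => X0; apply: gf.
    have e2' : g3 * f1 - g1 * f3 = 0 by apply: (mulfI n30); rewrite -e2 X0 !mulr0.
    have [-> -> ->//] := prim3_prop pg pf g0 f0 (subr0_eq X0) (esym (subr0_eq e2')).
  have dX : (n3 %| X * c)%Z.
    have /dvdzP[q ->] := hc; have [u [v <-]] := Bezoutz n1 (gcdz n2 n3).
    have [s [t <-]] := Bezoutz n2 n3.
    have -> : X * (q * (u * n1 + v * (s * n2 + t * n3))) =
       q * u * (n1 * X) + q * v * s * (n2 * X) + q * v * t * X * n3 by ring.
    rewrite e1 e2; apply: rpredD; last exact: dvdz_mull.
    by apply: rpredD; apply/dvdz_mull/dvdz_mulr.
  have leX : `|n3| <= `|X| * `|c|.
    have [q eq] := dvdzP dX.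
    have q0 : q != 0.
      by apply: contra_neq (mulf_neq0 X0 c0) => q0; rewrite eq q0 mul0r.
    rewrite -normrM eq normrM ler_peMl //; move: q0; clear; lia.
  have -> : g2%:~R / g1%:~R - f2%:~R / f1%:~R = - X%:~R / (g1%:~R * f1%:~R) :> R.
    by rewrite /X intrB !intrM; field; rewrite !gt_eqF.
  rewrite normrM normrN normfV (gtr0_norm (mulr_gt0 g1R f1R)) ler_pdivlMr ?mulr_gt0 //.
  have h1 : eta * (g1%:~R * f1%:~R) <= eta * (H1 * H1).
    by apply: ler_wpM2l; [exact: ltW | apply: ler_pM => //; exact: ltW].
  apply: le_trans h1 _; rewrite /eta divfK ?gt_eqF ?mulr_gt0 //.
  by rewrite ler_pdivrMr // -intr_norm -intrM ler_int.
Qed.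

End Plane4.

(* Base 64 keeps the square, cube and sixth roots of the level boundaries integral. *)
Definition in_level (k : nat) (x : int) := 64 ^+ k <= `|x| < 64 ^+ k.+1.

(* Here p is the level of g3 z3^2, the largest of the three terms, and q bounds that of the
   smallest one. *)
Definition conic_box (a1 a2 a3 : int) (k1 k2 k3 p q : nat) (t : int * int * int * (int * int * int)) :=
  let: (g1, g2, g3, (z1, z2, z3)) := t in
  [/\ conic_sol a1 a2 a3 g1 g2 g3 z1 z2 z3, [/\ in_level k1 g1, in_level k2 g2 & in_level k3 g3],
      in_level p (g3 * (z3 * z3)), `|g1 * (z1 * z1)| < 64 ^+ q.+1 &
      `|g1 * (z1 * z1)| <= `|g2 * (z2 * z2)| <= `|g3 * (z3 * z3)|].

Lemma exp64 (S : comPzRingType) (k : nat) : 64 ^+ k = 8 ^+ k * 8 ^+ k :> S.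
Proof. by rewrite -exprMn; congr (_ ^+ _); ring. Qed.

Lemma in_level_sqrt (k m : nat) (g z : int) : in_level k g -> 0 <= z ->
  `|g * (z * z)| < 64 ^+ m -> z * 8 ^+ k < 8 ^+ m.
Proof.
move=> /andP[h1 _] z0 h2.
have k0 : 0 < 8 ^+ k :> int by rewrite exprn_gt0.
have m0 : 0 < 8 ^+ m :> int by rewrite exprn_gt0.
rewrite exp64 in h1; rewrite exp64 normrM (ger0_norm (mulr_ge0 z0 z0)) in h2.
rewrite ltNge; apply/negP => h.
have h3 : 8 ^+ k * 8 ^+ k * (z * z) <= `|g| * (z * z) by rewrite ler_wpM2r // mulr_ge0.
have h4 : 8 ^+ m * 8 ^+ m <= z * 8 ^+ k * (z * 8 ^+ k) by rewrite ler_pM // ltW.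
lia.
Qed.

Section PlaneBox4.
Variable R : realType.

Lemma in_level_sqrt_real (k m : nat) (g z : int) : in_level k g -> 0 <= z ->
  `|g * (z * z)| < 64 ^+ m -> z%:~R <= 8 ^+ m / 8 ^+ k :> R.
Proof.
move=> h1 h2 h3; rewrite ler_pdivlMr ?exprn_gt0 //.
have := in_level_sqrt h1 h2 h3; rewrite -(ltr_int R) intrM !rmorphXn /= => /ltW.
by [].
Qed.

Lemma gcd_coef_sqr (a1 a2 a3 z1 z2 z3 : int) : prim3 z1 z2 z3 ->
  (gcdz (a1 * (z1 * z1)) (gcdz (a2 * (z2 * z2)) (a3 * (z3 * z3))) %| a1 * a2 * a3)%Z.
Proof.
move=> pz; set c := gcdz _ _.
have c1 : (c %| a1 * (z1 * z1))%Z by rewrite dvdz_gcdl.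
have c2 : (c %| a2 * (z2 * z2))%Z by apply: dvdz_trans (dvdz_gcdr _ _) (dvdz_gcdl _ _).
have c3 : (c %| a3 * (z3 * z3))%Z by apply: dvdz_trans (dvdz_gcdr _ _) (dvdz_gcdr _ _).
apply: (dvdz_prim3 (prim3_sqr pz)).
- have := dvdz_mull (a2 * a3) c1; congr (is_true (_ %| _)%Z); ring.
- have := dvdz_mull (a1 * a3) c2; congr (is_true (_ %| _)%Z); ring.
- have := dvdz_mull (a1 * a2) c3; congr (is_true (_ %| _)%Z); ring.
Qed.

Lemma in_level_neq0 k x : in_level k x -> x != 0.
Proof.
move=> /andP[h _]; apply: contraTneq h => ->; rewrite normr0 -ltNge exprn_gt0 //.
Qed.

Lemma plane_box (a1 a2 a3 : int) (k1 k2 k3 p q : nat) : a1 * a2 * a3 != 0 ->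
  cardle (conic_box a1 a2 a3 k1 k2 k3 p q)
   (8 ^+ q.+1 / 8 ^+ k1 * (8 ^+ p.+1 / 8 ^+ k2) * (8 ^+ p.+1 / 8 ^+ k3) *
    (2 * (1 + 128 * `|a1 * a2 * a3|%:~R * 64 ^+ k1.+1 * 64 ^+ k2.+1 * 64 ^+ k3.+1 / 64 ^+ p))
    : R).
Proof.
move=> A0; set A := a1 * a2 * a3 in A0 *.
have e8 k m : 0 <= 8 ^+ m / 8 ^+ k :> R by rewrite divr_ge0 // exprn_ge0.
have pz (N : R) (N0 : 0 <= N) := cardle_int_pos N0.
(* The last condition keeps the lower bound on g3 z3^2 after g has been forgotten; it bounds the
   denominator a3 z3^2 of [plane_count] from below. *)
pose Q (z : int * int * int) := [/\ [/\ 0 < z.1.1, 0 < z.1.2 & 0 < z.2], prim3 z.1.1 z.1.2 z.2,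
   [/\ z.1.1%:~R <= 8 ^+ q.+1 / 8 ^+ k1 :> R, z.1.2%:~R <= 8 ^+ p.+1 / 8 ^+ k2 :> R
     & z.2%:~R <= 8 ^+ p.+1 / 8 ^+ k3 :> R] & 64 ^+ p <= 64 ^+ k3.+1 * (z.2 * z.2)].
have hQ : cardle Q (8 ^+ q.+1 / 8 ^+ k1 * (8 ^+ p.+1 / 8 ^+ k2) * (8 ^+ p.+1 / 8 ^+ k3) : R).
  have := cardle_prod (cardle_prod (pz _ (e8 k1 q.+1)) (pz _ (e8 k2 p.+1))) (pz _ (e8 k3 p.+1)).
  by apply: cardle_sub => // -[[z1 z2] z3] [[z10 z20 z30] _ [h1 h2 h3] _].
apply: (@cardle_fiber _ _ _ _ Q (fun t => t.2)) hQ _.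
- move=> [[[g1 g2] g3] [[z1 z2] z3]] [sl [l1 l2 l3] lp hq /andP[h12 h23]] /=.
  have z1' := sol_z1 sl; have z2' := sol_z2 sl; have z3' := sol_z3 sl.
  have /andP[lp1 lp2] := lp.
  split => //=; first exact: sol_primz sl.
    split; [exact: in_level_sqrt_real l1 (ltW _) _ | exact: in_level_sqrt_real l2 (ltW _) (le_lt_trans h23 _)
           | exact: in_level_sqrt_real l3 (ltW _) _] => //.
  apply: le_trans lp1 _; rewrite normrM (ger0_norm (mulr_ge0 (ltW z3') (ltW z3'))).
  by apply: ler_wpM2r; [rewrite mulr_ge0 // ltW | case/andP: l3 => _ /ltW].
- by rewrite mulr_ge0 // addr_ge0 // !mulr_ge0 ?invr_ge0 ?exprn_ge0 // ler0z.
move=> [[z1 z2] z3] [[/= z10 z20 z30] prz _ lz].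
have a0 : a3 != 0 by apply: contra_neq A0; rewrite /A => ->; rewrite mulr0.
have n30 : a3 * (z3 * z3) != 0 by rewrite !mulf_neq0 // gt_eqF.
have := @plane_count R _ _ _ A (64 ^+ k1.+1) (64 ^+ k2.+1) n30 A0 (gcd_coef_sqr a1 a2 a3 prz).
rewrite exprn_gt0 // exprn_ge0 // => /(_ isT isT) hpl.
have le1 : 2 * (1 + 128 * `|A|%:~R * 64 ^+ k1.+1 * 64 ^+ k2.+1 / `|a3 * (z3 * z3)|%:~R) <=
  2 * (1 + 128 * `|A|%:~R * 64 ^+ k1.+1 * 64 ^+ k2.+1 * 64 ^+ k3.+1 / 64 ^+ p) :> R.
  apply: ler_wpM2l => //; rewrite lerD2l -[leRHS]mulrA; apply: ler_wpM2l.
    by rewrite !mulr_ge0 ?exprn_ge0 // ler0z.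
  rewrite ler_pdivlMr ?exprn_gt0 // mulrC ler_pdivrMr ?ltr0z ?normr_gt0 //.
  apply: (@le_trans _ _ ((64 ^+ k3.+1 * (z3 * z3))%:~R)).
    by have := lz; rewrite -(ler_int R) rmorphXn.
  rewrite intrM rmorphXn /=; apply: ler_wpM2l; first by rewrite exprn_ge0.
  rewrite ler_int normrM (ger0_norm (mulr_ge0 (ltW z30) (ltW z30))).
  by apply: ler_peMl; [rewrite mulr_ge0 // ltW | move: a0; clear; lia].
apply: cardle_sub le1 _; last first.
  apply: (@cardle_inj _ _ _ (fun x : int * int * int * (int * int * int) =>
     conic_box a1 a2 a3 k1 k2 k3 p q x /\ x.2 = (z1, z2, z3)) _ (fun x => x.1)) hpl.
    move=> [[[g1 g2] g3] z] [] + /= => /[swap] -> [sl [l1 l2 l3] _ _ _] /=; split.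
    - have := sol_eq sl; rewrite /isotropic => <-; ring.
    - exact: sol_primg sl.
    - case/andP: l1 => l u.
      have -> : 64 ^+ k1.+1 / 64 = 64 ^+ k1 :> R by rewrite exprS; field.
      move: l u; rewrite -(ler_int R) -(ltr_int R) !rmorphXn /= => -> /ltW ->.
      by [].
    - by case/andP: l2 => _; rewrite -(ltr_int R) rmorphXn /= => /ltW.
  by move=> [g z] [g' z'] [_ /= ->] [_ /= ->] ->.
by [].
Qed.

End PlaneBox4.

(** * Small points in every class *)

(** On the box of nonnegative triples the linear form stays within 3 V of 0, hence takes at most 6 V
    + 1 values; the relation is the difference of two triples with the same value. *)
Lemma pigeonhole3 (N1 N2 N3 V : nat) (c1 c2 c3 : int) :
  `|c1| * N1%:Z <= V%:Z -> `|c2| * N2%:Z <= V%:Z -> `|c3| * N3%:Z <= V%:Z ->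
  ((6 * V).+1 < N1.+1 * N2.+1 * N3.+1)%N ->
  exists w1 w2 w3 : int, [/\ [/\ `|w1| <= N1%:Z, `|w2| <= N2%:Z & `|w3| <= N3%:Z],
    ~ [/\ w1 = 0, w2 = 0 & w3 = 0] & c1 * w1 + c2 * w2 + c3 * w3 = 0].
Proof.
move=> h1 h2 h3 hV.
pose F (x : 'I_N1.+1 * 'I_N2.+1 * 'I_N3.+1) : int :=
  c1 * (x.1.1 : nat)%:Z + c2 * (x.1.2 : nat)%:Z + c3 * (x.2 : nat)%:Z.
have bd (c : int) (N : nat) (x : 'I_N.+1) : `|c| * N%:Z <= V%:Z -> `|c * (x : nat)%:Z| <= V%:Z.
  move=> h; apply: le_trans h; rewrite normrM ler_wpM2l //.
  by have := ltn_ord x; lia.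
have hF x : 0 <= F x + 3 * V%:Z <= 6 * V%:Z.
  have := bd _ _ x.1.1 h1; have := bd _ _ x.1.2 h2; have := bd _ _ x.2 h3.
  rewrite /F; move: (c1 * _) (c2 * _) (c3 * _) => s t r; clear; lia.
pose f (x : 'I_N1.+1 * 'I_N2.+1 * 'I_N3.+1) : 'I_(6 * V).+1 := inord (absz (F x + 3 * V%:Z)).
have : ~~ injectiveb f.
  apply/injectiveP => /leq_card; rewrite !card_prod !card_ord leqNgt.
  by rewrite hV.
case/injectivePn => x [y xy exy].
have FE : F x = F y.
  have /(congr1 val) := exy; rewrite /f /= !inordK.
  - have := hF x; have := hF y; lia.
  - have := hF y; lia.
  - have := hF x; lia.
exists ((x.1.1 : nat)%:Z - (y.1.1 : nat)%:Z), ((x.1.2 : nat)%:Z - (y.1.2 : nat)%:Z),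
  ((x.2 : nat)%:Z - (y.2 : nat)%:Z); split.
- have := ltn_ord x.1.1; have := ltn_ord y.1.1; have := ltn_ord x.1.2; have := ltn_ord y.1.2.
  by have := ltn_ord x.2; have := ltn_ord y.2; split; lia.
- move=> [e1 e2 e3]; case/eqP: xy; case: x y {exy FE} e1 e2 e3 => [[x1 x2] x3] [[y1 y2] y3] /= e1 e2 e3.
  by congr (_, _, _); apply/val_inj => /=; lia.
- by move: FE; rewrite /F => /eqP; rewrite -subr_eq0 => /eqP <-; ring.
Qed.

Lemma absz_le_mul (K a1 a2 a3 : int) : a1 * a2 * a3 != 0 -> K = a1 * a2 * a3 ->
  [/\ 1 <= `|K|, `|a1| <= `|K|, `|a2| <= `|K| & `|a3| <= `|K|].
Proof.
move=> A0 ->; rewrite !normrM.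
move: A0; rewrite !mulf_eq0 !negb_or => /andP[/andP[h1 h2] h3].
have g1 : 1 <= `|a1| by lia.
have g2 : 1 <= `|a2| by lia.
have g3 : 1 <= `|a3| by lia.
have g12 : 1 <= `|a1| * `|a2| by rewrite mulr_ege1.
split.
- by rewrite mulr_ege1.
- by rewrite -mulrA ler_peMr // mulr_ege1.
- by rewrite mulrAC ler_peMl // mulr_ege1.
- by rewrite ler_peMl.
Qed.

(** The equation bounds the largest term by the other two. Hence the two larger terms have the same
    order, and a single level p serves for both. *)
Lemma sol_middle (a1 a2 a3 g1 g2 g3 z1 z2 z3 : int) : a1 * a2 * a3 != 0 ->
  conic_sol a1 a2 a3 g1 g2 g3 z1 z2 z3 -> `|g1 * (z1 * z1)| <= `|g2 * (z2 * z2)| ->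
  `|g3 * (z3 * z3)| <= 2 * `|a1 * a2 * a3| * `|g2 * (z2 * z2)|.
Proof.
move=> A0 sl h12; have [k1 b1 b2 b3] := absz_le_mul A0 erefl.
have a30 : 1 <= `|a3| by move: A0; rewrite !mulf_eq0 !negb_or => /andP[_]; lia.
have h := sol_eq sl.
set p1 := g1 * (z1 * z1) in h12 *; set p2 := g2 * (z2 * z2) in h12 *; set p3 := g3 * (z3 * z3).
have e : a3 * p3 = - (a1 * p1 + a2 * p2).
  by apply/eqP; rewrite -addr_eq0 -h; apply/eqP; rewrite /p1 /p2 /p3; ring.
clearbody p1 p2 p3.
have l1 : `|p3| <= `|a3 * p3| by rewrite normrM ler_peMl.
apply: le_trans l1 _; rewrite e normrN; apply: le_trans (ler_normD _ _) _; rewrite !normrM.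
have : `|a1| * `|p1| <= `|a1 * a2 * a3| * `|p2| by apply: ler_pM.
have : `|a2| * `|p2| <= `|a1 * a2 * a3| * `|p2| by apply: ler_wpM2r.
rewrite -!normrM; lia.
Qed.

Lemma dual_coef_le (K W a2 a3 g2 g3 w2 w3 : int) : `|a2| <= K -> `|a3| <= K ->
  `|g2| * (w2 * w2) <= W -> `|g3| * (w3 * w3) <= W ->
  `|dual_coef a2 a3 g2 g3 w2 w3| <= 2 * K * W.
Proof.
move=> h2 h3 l2 l3; rewrite /dual_coef; apply: le_trans (ler_normD _ _) _.
rewrite !normrM -!mulrA.
have -> : `|w3| * `|w3| = w3 * w3 by rewrite -normrM ger0_norm // -expr2 sqr_ge0.
have -> : `|w2| * `|w2| = w2 * w2 by rewrite -normrM ger0_norm // -expr2 sqr_ge0.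
have sq (w : int) : 0 <= w * w by rewrite -expr2 sqr_ge0.
have : `|a2| * (`|g3| * (w3 * w3)) <= K * W by apply: ler_pM => //; rewrite mulr_ge0.
have : `|a3| * (`|g2| * (w2 * w2)) <= K * W by apply: ler_pM => //; rewrite mulr_ge0.
lia.
Qed.

Lemma Posz_exp8 (k : nat) : (8 ^ k)%N%:Z = 8 ^+ k.
Proof. by rewrite -natz natrX. Qed.

(** |g| u^2 = (g z u)^2 / (|g| z^2), where the numerator is at most (2 |A|^4 W)^2 and the
    denominator at least P / (2 |A|). *)
Lemma scaled_size (A g z u D W P : int) :
  0 < P -> 1 <= `|A| -> 0 <= W ->
  g * z * u = A ^+ 3 * D -> `|D| <= 2 * `|A| * W -> P <= 2 * `|A| * `|g * (z * z)| ->
  P * (`|g| * (u * u)) <= 8 * `|A| ^+ 9 * (W * W).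
Proof.
move=> P0 A1 W0 e hD hP.
have sq (w : int) : 0 <= w * w by rewrite -expr2 sqr_ge0.
have u0 : 0 <= `|g| * (u * u) by rewrite mulr_ge0.
apply: le_trans (ler_wpM2r u0 hP) _.
have -> : 2 * `|A| * `|g * (z * z)| * (`|g| * (u * u)) = 2 * `|A| * (`|g * z * u| * `|g * z * u|).
  rewrite !normrM -(ger0_norm (sq u)) !normrM; ring.
rewrite e normrM.
have -> : 8 * `|A| ^+ 9 * (W * W) = 2 * `|A| * ((`|A ^+ 3| * (2 * `|A| * W)) * (`|A ^+ 3| * (2 * `|A| * W))).
  rewrite normrX; ring.
by apply: ler_wpM2l; [rewrite mulr_ge0 | apply: ler_pM; rewrite ?mulr_ge0 ?ler_wpM2l].
Qed.

Lemma small_point (a1 a2 a3 g1 g2 g3 z1 z2 z3 : int) (k1 k2 k3 p q : nat) :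
  a1 * a2 * a3 != 0 -> conic_box a1 a2 a3 k1 k2 k3 p q (g1, g2, g3, (z1, z2, z3)) ->
  exists u1 u2 u3 : int, [/\ isotropic a1 a2 a3 g1 g2 g3 u1 u2 u3,
    ~ [/\ u1 = 0, u2 = 0 & u3 = 0],
    [/\ (g1 %| u2 * z3 - u3 * z2)%Z, (g2 %| u3 * z1 - u1 * z3)%Z &
        (g3 %| u1 * z2 - u2 * z1)%Z] &
    let K := 16 * `|a1 * a2 * a3| ^+ 10 * 64 ^+ (k1 + k2 + k3 + 6) in
    [/\ `|g1| * (u1 * u1) <= K, `|g2| * (u2 * u2) <= K & `|g3| * (u3 * u3) <= K]].
Proof.
move=> A0 [sl [l1 l2 l3] lp hq /andP[h12 h23]].
set s := (k1 + k2 + k3)%N.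
pose o := ((p + s + 6)./2)%N.
pose W := (8 ^ o)%N.
pose N k := (W %/ 8 ^ k.+1)%N.
pose V := (8 ^ p.+1 * W)%N.
have z10 := sol_z1 sl; have z20 := sol_z2 sl; have z30 := sol_z3 sl.
have /andP[lp1 lp2] := lp.
have N1 k : (N k * 8 ^ k.+1 <= W)%N by exact: leq_divM.
have N2 k : (W <= (N k).+1 * 8 ^ k.+1)%N.
  by rewrite ltnW // /N ltn_ceil // expn_gt0.
have NZ k g : in_level k g -> `|g| * ((N k)%:Z * (N k)%:Z) <= W%:Z * W%:Z.
  move=> /andP[_ hg]; have := N1 k => hN.
  have : ((N k)%:Z * 8 ^+ k.+1) * ((N k)%:Z * 8 ^+ k.+1) <= W%:Z * W%:Z.
    have e : (N k)%:Z * 8 ^+ k.+1 <= W%:Z by rewrite -(natrX _ 8) natz -PoszM lez_nat.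
    by apply: ler_pM => //; rewrite mulr_ge0 ?exprn_ge0.
  rewrite exp64 in hg.
  have : `|g| * ((N k)%:Z * (N k)%:Z) <= 8 ^+ k.+1 * 8 ^+ k.+1 * ((N k)%:Z * (N k)%:Z).
    by apply: ler_wpM2r; [rewrite mulr_ge0 | exact: ltW].
  move: (8 ^+ k.+1) (`|g|) (N k)%:Z (W%:Z) => e g' n w; clear; lia.
have cV k g z : in_level k g -> 0 < z -> `|g * (z * z)| < 64 ^+ p.+1 ->
    `|g * z| * (N k)%:Z <= V%:Z.
  move=> lg z0 hz; have h := NZ k g lg.
  rewrite exp64 normrM (ger0_norm (mulr_ge0 (ltW z0) (ltW z0))) in hz.
  rewrite normrM (gtr0_norm z0) /V PoszM Posz_exp8.
  set e : int := 8 ^+ p.+1 in hz *.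
  have e0 : 0 <= e by rewrite exprn_ge0.
  rewrite leNgt; apply/negP => hlt.
  have h2 : e * W%:Z * (e * W%:Z) < `|g| * z * (N k)%:Z * (`|g| * z * (N k)%:Z).
    by apply: ltr_pM => //; rewrite mulr_ge0.
  have h3 : `|g| * (z * z) * (`|g| * ((N k)%:Z * (N k)%:Z)) <= e * e * (W%:Z * W%:Z).
    apply: ler_pM => //; rewrite ?mulr_ge0 // ?ltW //.
  move: h2 h3; move: (`|g|) z e (N k)%:Z (W%:Z) {lg z0 hz h e0 hlt} => *; lia.
have pV : ((6 * V).+1 < (N k1).+1 * (N k2).+1 * (N k3).+1)%N.
  rewrite ltnNge; apply/negP => hle.
  have hW : (W * W * W <= (6 * V).+1 * 8 ^ (s + 3))%N.
    apply: (@leq_trans (((N k1).+1 * 8 ^ k1.+1) * ((N k2).+1 * 8 ^ k2.+1) * ((N k3).+1 * 8 ^ k3.+1))%N).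
      by rewrite !leq_mul.
    have -> : ((N k1).+1 * 8 ^ k1.+1 * ((N k2).+1 * 8 ^ k2.+1) * ((N k3).+1 * 8 ^ k3.+1) =
      (N k1).+1 * (N k2).+1 * (N k3).+1 * 8 ^ (s + 3))%N.
      rewrite /s !expnS !expnD; move: (8 ^ k1)%N (8 ^ k2)%N (8 ^ k3)%N (N k1).+1 (N k2).+1 (N k3).+1 => *.
      rewrite (_ : 8 ^ 3 = 8 * 8 * 8)%N //; ring.
    by rewrite leq_mul.
  have W0 : (0 < W)%N by rewrite expn_gt0.
  have E0 : (0 < 8 ^ p.+1)%N by rewrite expn_gt0.
  have V0 : (0 < V)%N by rewrite muln_gt0 E0.
  have h7 : (W * W * W <= 7 * V * 8 ^ (s + 3))%N.
    by apply: leq_trans hW _; rewrite leq_mul //; move: V0; clear; lia.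
  have h8 : (W * W <= 7 * 8 ^ (p + s + 4))%N.
    rewrite -(leq_pmul2r W0); apply: leq_trans h7 _; rewrite /V.
    have -> : (8 ^ (p + s + 4) = 8 ^ p.+1 * 8 ^ (s + 3))%N by rewrite -expnD; congr (_ ^ _)%N; lia.
    by rewrite leq_eqVlt; apply/orP; left; apply/eqP; ring.
  have h9 : (8 ^ (p + s + 5) <= W * W)%N.
    rewrite /W -expnD leq_exp2l // /o; have := odd_double_half (p + s + 6).
    by case: odd; lia.
  have := leq_trans h9 h8; rewrite addnS expnS leq_pmul2r ?expn_gt0 //.
have [w1 [w2 [w3 [[b1 b2 b3] w0 hw]]]] :=
  pigeonhole3 (cV _ _ _ l1 z10 (le_lt_trans (le_trans h12 h23) lp2))
   (cV _ _ _ l2 z20 (le_lt_trans h23 lp2)) (cV _ _ _ l3 z30 lp2) pV.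
have [u1 [u2 [u3 [[e1 e2 e3] hu u0 hd]]]] := second_point A0 sl hw.
exists u1, u2, u3; split => //; first by case=> x y z; exact/w0/u0.
have [K1 a1K a2K a3K] := absz_le_mul A0 erefl.
set A := a1 * a2 * a3 in A0 e1 e2 e3 K1 a1K a2K a3K *.
move=> K.
have gw k g w : in_level k g -> `|w| <= (N k)%:Z -> `|g| * (w * w) <= W%:Z * W%:Z.
  move=> lg hw'; apply: le_trans (NZ k g lg); apply: ler_wpM2l => //.
  rewrite -(ger0_norm (_ : 0 <= w * w)); last by rewrite -expr2 sqr_ge0.
  by rewrite normrM; apply: ler_pM.
have P0 : 0 < 64 ^+ p :> int by rewrite exprn_gt0.
have W2 : (W%:Z * W%:Z) * (W%:Z * W%:Z) <= 64 ^+ (p + (s + 6)).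
  rewrite -!PoszM exp64 -(natrX _ 8) natz -PoszM lez_nat /W -!expnD leq_exp2l //.
  rewrite /o; have := odd_double_half (p + s + 6); move: (odd _) => b; lia.
have WW0 : 0 <= W%:Z * W%:Z by rewrite mulr_ge0.
have mid : 64 ^+ p <= 2 * `|A| * `|g2 * (z2 * z2)| by apply: le_trans lp1 (sol_middle A0 sl h12).
have top : 64 ^+ p <= 2 * `|A| * `|g3 * (z3 * z3)|.
  by apply: le_trans lp1 _; rewrite ler_peMl //; move: K1; clear; lia.
have S2 := scaled_size P0 K1 WW0 e2 (dual_coef_le a3K a1K (gw _ _ _ l3 b3) (gw _ _ _ l1 b1)) mid.
have S3 := scaled_size P0 K1 WW0 e3 (dual_coef_le a1K a2K (gw _ _ _ l1 b1) (gw _ _ _ l2 b2)) top.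
have A9 : 0 <= 8 * `|A| ^+ 9 by rewrite mulr_ge0 // exprn_ge0.
have fin (X : int) : 64 ^+ p * X <= 8 * `|A| ^+ 9 * (W%:Z * W%:Z * (W%:Z * W%:Z)) ->
   X <= 8 * `|A| ^+ 9 * 64 ^+ (s + 6).
  move=> h; rewrite -(ler_pM2l P0); apply: le_trans h _.
  by apply: le_trans (ler_wpM2l A9 W2) _; rewrite exprD mulrCA.
have T2 := fin _ S2; have T3 := fin _ S3.
have M0 : 0 <= 64 ^+ (s + 6) :> int by rewrite exprn_ge0.
have KE : K = 2 * `|A| * (8 * `|A| ^+ 9 * 64 ^+ (s + 6)) by rewrite /K -/s; ring.
have KB : 8 * `|A| ^+ 9 * 64 ^+ (s + 6) <= K.
  by rewrite KE ler_peMl ?mulr_ge0 //; move: K1; clear; lia.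
(* The first term of z may be much smaller than 64^p, so [u1] is bounded through the equation of the
   conic instead; this costs the factor 2 |A| in [K]. *)
split; [|exact: le_trans T2 KB|exact: le_trans T3 KB].
have a10 : 1 <= `|a1|.
  by move: A0; rewrite /A !mulf_eq0 !negb_or => /andP[/andP[+ _] _]; clear; lia.
have sq (w : int) : 0 <= w * w by rewrite -expr2 sqr_ge0.
have g0 g (u : int) : 0 <= `|g| * (u * u) by rewrite mulr_ge0.
apply: (@le_trans _ _ (`|a1| * (`|g1| * (u1 * u1)))); first by rewrite ler_peMl.
have -> : `|a1| * (`|g1| * (u1 * u1)) = `|a2 * g2 * (u2 * u2) + a3 * g3 * (u3 * u3)|.
  rewrite -{1}(ger0_norm (sq u1)) -!normrM -[RHS]normrN; congr `| _ |.
  by apply/eqP; rewrite -subr_eq0 opprK -hu; apply/eqP; ring.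
apply: le_trans (ler_normD _ _) _.
rewrite !(normrM _ (_ * _)) !(ger0_norm (sq _)) !(normrM _ g2) !(normrM _ g3) -!mulrA.
have : `|a2| * (`|g2| * (u2 * u2)) <= `|A| * (8 * `|A| ^+ 9 * 64 ^+ (s + 6)) by apply: ler_pM.
have : `|a3| * (`|g3| * (u3 * u3)) <= `|A| * (8 * `|A| ^+ 9 * 64 ^+ (s + 6)) by apply: ler_pM.
rewrite KE -[2 * _ * _]mulrA; move: (`|A| * (8 * `|A| ^+ 9 * 64 ^+ (s + 6))) (`|a2| * _) (`|a3| * _); clear; lia.
Qed.

(** * Spacing of the points of one class *)

Section Conic6.
Variable R : realType.
Implicit Types c x y : R.

(** For points of the conic, twice the polar form is -(c1 (x1 - y1)^2 + c2 (x2 - y2)^2). Subtracting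
    the two equations gives c2 (x2 - y2) (x2 + y2) = -c1 (x1 - y1) (x1 + y1), and the hypotheses
    with [L] compare the sums, so the second square is at most L times the first in absolute
    value. *)
Lemma conic_chord c1 c2 c3 x1 x2 y1 y2 L :
  c2 != 0 -> 0 < x1 -> 0 < x2 -> 0 < y1 -> 0 < y2 -> 0 <= L ->
  c1 * x1 ^+ 2 + c2 * x2 ^+ 2 + c3 = 0 -> c1 * y1 ^+ 2 + c2 * y2 ^+ 2 + c3 = 0 ->
  `|c1| * x1 ^+ 2 <= L * (`|c2| * x2 ^+ 2) -> `|c1| * y1 ^+ 2 <= L * (`|c2| * y2 ^+ 2) ->
  2 * `|c1 * (x1 * y1) + c2 * (x2 * y2) + c3| <= (1 + L) * (`|c1| * (x1 - y1) ^+ 2).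
Proof.
move=> c20 x10 x20 y10 y20 L0 hx hy lx ly.
have n1 : 0 <= `|c1| := normr_ge0 _.
have n2 : 0 < `|c2| by rewrite normr_gt0.
have cross : `|c1| * (x1 * y1) <= L * (`|c2| * (x2 * y2)).
  rewrite -(@ler_pXn2r _ 2) // ?nnegrE ?mulr_ge0 // ?(ltW n2) ?(ltW x10) ?(ltW x20) ?(ltW y10) ?(ltW y20) //.
  have -> : (`|c1| * (x1 * y1)) ^+ 2 = (`|c1| * x1 ^+ 2) * (`|c1| * y1 ^+ 2) by ring.
  have -> : (L * (`|c2| * (x2 * y2))) ^+ 2 = L * (`|c2| * x2 ^+ 2) * (L * (`|c2| * y2 ^+ 2)) by ring.
  by apply: ler_pM => //; rewrite mulr_ge0 // sqr_ge0.
have sums : `|c1| * (x1 + y1) ^+ 2 <= L * (`|c2| * (x2 + y2) ^+ 2) by lra.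
have e : c2 * (x2 - y2) * (x2 + y2) = - (c1 * (x1 - y1) * (x1 + y1)).
  by apply/eqP; rewrite -subr_eq0 opprK; apply/eqP; rewrite -[RHS](subr0 0) -{1}hx -hy; ring.
have D2 : `|c2| * (x2 - y2) ^+ 2 <= L * (`|c1| * (x1 - y1) ^+ 2).
  have S0 : 0 < `|c2| * (x2 + y2) ^+ 2 by rewrite mulr_gt0 // exprn_gt0 // addr_gt0.
  rewrite -(ler_pM2r S0).
  have -> : `|c2| * (x2 - y2) ^+ 2 * (`|c2| * (x2 + y2) ^+ 2) =
     `|c1| * (x1 - y1) ^+ 2 * (`|c1| * (x1 + y1) ^+ 2).
    have sqn (u : R) : `|u| * `|u| = u * u by rewrite -expr2 real_normK ?num_real // expr2.
    have -> : `|c2| * (x2 - y2) ^+ 2 * (`|c2| * (x2 + y2) ^+ 2) =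
       (`|c2| * `|c2|) * ((x2 - y2) * (x2 + y2)) ^+ 2 by ring.
    have -> : `|c1| * (x1 - y1) ^+ 2 * (`|c1| * (x1 + y1) ^+ 2) =
       (`|c1| * `|c1|) * ((x1 - y1) * (x1 + y1)) ^+ 2 by ring.
    rewrite !sqn (_ : c2 * c2 * _ = (c2 * (x2 - y2) * (x2 + y2)) ^+ 2); last by ring.
    by rewrite e; ring.
  rewrite (_ : L * _ * _ = `|c1| * (x1 - y1) ^+ 2 * (L * (`|c2| * (x2 + y2) ^+ 2))); last by ring.
  by apply: ler_wpM2l => //; rewrite mulr_ge0 ?sqr_ge0.
have -> : 2 * `|c1 * (x1 * y1) + c2 * (x2 * y2) + c3| =
   `|c1 * (x1 - y1) ^+ 2 + c2 * (x2 - y2) ^+ 2|.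
  rewrite -[X in X * _](ger0_norm (ler0n R 2)) -normrM -[RHS]normrN; congr `| _ |.
  apply/eqP; rewrite -subr_eq0 opprK; apply/eqP.
  by rewrite -[RHS](addr0 0) -{1}hx -hy; ring.
apply: le_trans (ler_normD _ _) _; rewrite (normrM c1) (normrM c2) !(ger0_norm (sqr_ge0 _)); lra.
Qed.

(** A vanishing polar form puts y on the tangent at x, and the tangent of a nondegenerate conic
    meets it only at x. *)
Lemma conic_polar0 c1 c2 c3 x1 x2 y1 y2 :
  c1 != 0 -> c2 != 0 -> c3 != 0 ->
  c1 * x1 ^+ 2 + c2 * x2 ^+ 2 + c3 = 0 -> c1 * y1 ^+ 2 + c2 * y2 ^+ 2 + c3 = 0 ->
  c1 * (x1 * y1) + c2 * (x2 * y2) + c3 = 0 -> x1 = y1 /\ x2 = y2.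
Proof.
move=> c10 c20 c30 hx hy hb.
pose D1 := x1 - y1; pose D2 := x2 - y2; pose S1 := x1 + y1; pose S2 := x2 + y2.
have q : c1 * D1 ^+ 2 + c2 * D2 ^+ 2 = 0.
  have -> : c1 * D1 ^+ 2 + c2 * D2 ^+ 2 = (c1 * x1 ^+ 2 + c2 * x2 ^+ 2 + c3) +
   (c1 * y1 ^+ 2 + c2 * y2 ^+ 2 + c3) - 2 * (c1 * (x1 * y1) + c2 * (x2 * y2) + c3).
    by rewrite /D1 /D2; ring.
  by rewrite hx hy hb mulr0 subr0 addr0.
have s : c1 * S1 ^+ 2 + c2 * S2 ^+ 2 = - 4 * c3.
  have -> : c1 * S1 ^+ 2 + c2 * S2 ^+ 2 = (c1 * x1 ^+ 2 + c2 * x2 ^+ 2 + c3) +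
   (c1 * y1 ^+ 2 + c2 * y2 ^+ 2 + c3) + 2 * (c1 * (x1 * y1) + c2 * (x2 * y2) + c3) - 4 * c3.
    by rewrite /S1 /S2; ring.
  by rewrite hx hy hb; ring.
have m : c1 * D1 * S1 + c2 * D2 * S2 = 0.
  have -> : c1 * D1 * S1 + c2 * D2 * S2 = (c1 * x1 ^+ 2 + c2 * x2 ^+ 2 + c3) -
   (c1 * y1 ^+ 2 + c2 * y2 ^+ 2 + c3) by rewrite /D1 /D2 /S1 /S2; ring.
  by rewrite hx hy subr0.
suff [d1 d2] : D1 = 0 /\ D2 = 0 by split; apply: subr0_eq.
have : c1 * D1 * (S1 * D2 - D1 * S2) = 0.
  have -> : c1 * D1 * (S1 * D2 - D1 * S2) = D2 * (c1 * D1 * S1 + c2 * D2 * S2)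
    - S2 * (c1 * D1 ^+ 2 + c2 * D2 ^+ 2) by ring.
  by rewrite m q !mulr0 subr0.
move/eqP; rewrite !mulf_eq0 (negPf c10) /= => /orP[/eqP d1|/eqP d].
  split => //; move: q; rewrite d1 expr0n mulr0 add0r => /eqP.
  by rewrite mulf_eq0 (negPf c20) /= sqrf_eq0 => /eqP.
have d2 : D2 = 0.
  have : - 4 * c3 * D2 ^+ 2 = 0.
    rewrite -s.
    have -> : (c1 * S1 ^+ 2 + c2 * S2 ^+ 2) * D2 ^+ 2 =
      c1 * (S1 * D2 - D1 * S2) * (S1 * D2 + D1 * S2) + S2 ^+ 2 * (c1 * D1 ^+ 2 + c2 * D2 ^+ 2) by ring.
    by rewrite d q; ring.
  move/eqP; rewrite mulf_eq0 sqrf_eq0 mulf_eq0 (negPf c30) orbF oppr_eq0 => /orP[|/eqP//].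
  by rewrite pnatr_eq0.
split => //; move: q; rewrite d2 expr0n mulr0 addr0 => /eqP.
by rewrite mulf_eq0 (negPf c10) /= sqrf_eq0 => /eqP.
Qed.

End Conic6.

Lemma weighted_sqr_le (A a1 a2 g1 g2 x1 x2 : int) : `|a1| <= `|A| -> 1 <= `|a2| ->
  `|g1 * (x1 * x1)| <= `|g2 * (x2 * x2)| ->
  `|a1 * g1| * x1 ^+ 2 <= `|A| * `|a2 * g2| * x2 ^+ 2.
Proof.
move=> hA h2; have e (g x : int) : `|g * (x * x)| = `|g| * x ^+ 2.
  by rewrite normrM -expr2 (ger0_norm (sqr_ge0 _)).
rewrite !e (normrM a1) (normrM a2) => h.
have g0 (g x : int) : 0 <= `|g| * x ^+ 2 by rewrite mulr_ge0 // sqr_ge0.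
have : `|a1| * (`|g1| * x1 ^+ 2) <= `|A| * (`|a2| * (`|g2| * x2 ^+ 2)).
  by apply: ler_pM => //; apply: le_trans h _; rewrite ler_peMl.
by rewrite !mulrA.
Qed.

Section ClassFiber6.
Variable R : realType.

(** Distinct points of one class have a nonzero polar form, which by divisibility is at least 64^s /
    |A|^3. Through [conic_chord] this becomes a gap [eta] between the ratios z1 / z3, which range
    over [0, hi]. The first coordinate is used because q makes this range short. *)
Lemma class_fiber (a1 a2 a3 g1 g2 g3 : int) (k1 k2 k3 p q : nat)
    (P : int * int * int -> Prop) : a1 * a2 * a3 != 0 ->
  (forall z, P z -> conic_box a1 a2 a3 k1 k2 k3 p q (g1, g2, g3, z)) ->
  (forall z y, P z -> P y -> (g1 * g2 * g3 %|
     polar a1 a2 a3 g1 g2 g3 z.1.1 z.1.2 z.2 y.1.1 y.1.2 y.2 * (a1 * a2 * a3) ^+ 3)%Z) ->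
  cardle P (1 + `|a1 * a2 * a3|%:~R ^+ 3 * 8 ^+ (q + 4) / 8 ^+ (k1 + k2 + k3) : R).
Proof.
move=> A0 hbox hdvd; set A := a1 * a2 * a3 in A0 hdvd *.
set s := (k1 + k2 + k3)%N.
have e8 k : 0 < 8 ^+ k :> R by rewrite exprn_gt0.
have e8n k : 8 ^+ k != 0 :> R by rewrite gt_eqF.
have [A1 a1A a2A a3A] := absz_le_mul A0 erefl; rewrite -/A in A1 a1A a2A a3A.
have AR : 1 <= `|A|%:~R :> R by rewrite ler1z.
have AR0 : 0 < `|A|%:~R :> R by rewrite (lt_le_trans ltr01).
set B : R := `|A|%:~R in AR AR0 *.
pose eta : R := 8 ^+ s * 8 ^+ k3 / (B ^+ 3 * 8 ^+ k1.+1 * 8 ^+ p.+1).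
pose hi : R := 8 ^+ q.+1 * 8 ^+ k3.+1 / (8 ^+ k1 * 8 ^+ p).
have eta0 : 0 < eta by rewrite divr_gt0 // ?mulr_gt0 ?exprn_gt0.
have hi0 : 0 <= hi by rewrite divr_ge0 // ?mulr_ge0 ?exprn_ge0.
have -> : 1 + B ^+ 3 * 8 ^+ (q + 4) / 8 ^+ s = 1 + (hi - 0) / eta.
  rewrite /hi /eta !exprS exprD subr0; field; by rewrite ?e8n ?gt_eqF //.
have a10 : a1 != 0 by apply: contra_neq A0; rewrite /A => ->; rewrite !mul0r.
have a20 : a2 != 0 by apply: contra_neq A0; rewrite /A => ->; rewrite mulr0 mul0r.
have a30 : a3 != 0 by apply: contra_neq A0; rewrite /A => ->; rewrite mulr0.
apply: (@cardle_sep _ _ _ (fun z => z.1.1%:~R / z.2%:~R)) => //.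
- move=> [[z1 z2] z3] /hbox [sl [l1 l2 l3] /andP[lp1 lp2] hq _] /=.
  have z10 := sol_z1 sl; have z30 := sol_z3 sl.
  have z1R : 0 < z1%:~R :> R by rewrite ltr0z.
  have z3R : 0 < z3%:~R :> R by rewrite ltr0z.
  apply/andP; split; first by rewrite divr_ge0 // ltW.
  rewrite ler_pdivrMr //.
  have b1 := in_level_sqrt_real R l1 (ltW z10) hq.
  have b3 : 8 ^+ p <= 8 ^+ k3.+1 * z3%:~R :> R.
    rewrite -(@ler_pXn2r _ 2) // ?nnegrE ?mulr_ge0 ?(ltW (e8 _)) ?(ltW z3R) //.
    rewrite expr2 -exp64 exprMn !expr2 -exp64.
    have : 64 ^+ p <= 64 ^+ k3.+1 * (z3 * z3).
      apply: le_trans lp1 _; rewrite normrM (ger0_norm (mulr_ge0 (ltW z30) (ltW z30))).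
      by apply: ler_wpM2r; [rewrite mulr_ge0 // ltW | case/andP: l3 => _ /ltW].
    by rewrite -(ler_int R) !intrM !rmorphXn /=.
  apply: le_trans b1 _; rewrite ler_pdivrMr //.
  have -> : hi * z3%:~R * 8 ^+ k1 = 8 ^+ q.+1 * (8 ^+ k3.+1 * z3%:~R) / 8 ^+ p.
    by rewrite /hi; field; rewrite !e8n.
  by rewrite ler_pdivlMr // ler_wpM2l // ltW.
- move=> [[z1 z2] z3] [[y1 y2] y3] Pz Py zy /=.
  have [slz [l1 l2 l3] /andP[lz1 lz2] hqz /andP[hz12 hz23]] := hbox _ Pz.
  have [sly _ /andP[ly1 ly2] hqy /andP[hy12 hy23]] := hbox _ Py.
  have z10 := sol_z1 slz; have z20 := sol_z2 slz; have z30 := sol_z3 slz.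
  have y10 := sol_z1 sly; have y20 := sol_z2 sly; have y30 := sol_z3 sly.
  have z1R : 0 < z1%:~R :> R by rewrite ltr0z.
  have z2R : 0 < z2%:~R :> R by rewrite ltr0z.
  have z3R : 0 < z3%:~R :> R by rewrite ltr0z.
  have y1R : 0 < y1%:~R :> R by rewrite ltr0z.
  have y2R : 0 < y2%:~R :> R by rewrite ltr0z.
  have y3R : 0 < y3%:~R :> R by rewrite ltr0z.
  pose c1 : R := (a1 * g1)%:~R; pose c2 : R := (a2 * g2)%:~R; pose c3 : R := (a3 * g3)%:~R.
  have c10 : c1 != 0 by rewrite intr_eq0 mulf_neq0 // (in_level_neq0 l1).
  have c20 : c2 != 0 by rewrite intr_eq0 mulf_neq0 // (in_level_neq0 l2).
  have c30 : c3 != 0 by rewrite intr_eq0 mulf_neq0 // (in_level_neq0 l3).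
  pose X1 : R := z1%:~R / z3%:~R; pose X2 : R := z2%:~R / z3%:~R.
  pose Y1 : R := y1%:~R / y3%:~R; pose Y2 : R := y2%:~R / y3%:~R.
  have onconic (x1 x2 x3 : int) : 0 < x3%:~R :> R -> isotropic a1 a2 a3 g1 g2 g3 x1 x2 x3 ->
      c1 * (x1%:~R / x3%:~R) ^+ 2 + c2 * (x2%:~R / x3%:~R) ^+ 2 + c3 = 0 :> R.
    move=> x30 h.
    have -> : c1 * (x1%:~R / x3%:~R) ^+ 2 + c2 * (x2%:~R / x3%:~R) ^+ 2 + c3 =
      (a1 * g1 * (x1 * x1) + a2 * g2 * (x2 * x2) + a3 * g3 * (x3 * x3))%:~R / x3%:~R ^+ 2 :> R.
      by rewrite !(intrD, intrM) /c1 /c2 /c3 !intrM; field; rewrite gt_eqF.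
    by rewrite h mul0r.
  have EX : c1 * X1 ^+ 2 + c2 * X2 ^+ 2 + c3 = 0 := onconic _ _ _ z3R (sol_eq slz).
  have EY : c1 * Y1 ^+ 2 + c2 * Y2 ^+ 2 + c3 = 0 := onconic _ _ _ y3R (sol_eq sly).
  pose b : int := polar a1 a2 a3 g1 g2 g3 z1 z2 z3 y1 y2 y3.
  have Eb : c1 * (X1 * Y1) + c2 * (X2 * Y2) + c3 = b%:~R / (z3%:~R * y3%:~R).
    by rewrite /b /polar !(intrD, intrM) /c1 /c2 /c3 /X1 /X2 /Y1 /Y2 !intrM; field; rewrite !gt_eqF.
  have lam (x1 x2 x3 : int) : 0 < x3%:~R :> R -> `|g1 * (x1 * x1)| <= `|g2 * (x2 * x2)| ->
      `|c1| * (x1%:~R / x3%:~R) ^+ 2 <= B * (`|c2| * (x2%:~R / x3%:~R) ^+ 2).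
    move=> x30 h.
    have -> : `|c1| * (x1%:~R / x3%:~R) ^+ 2 = `|c1| * x1%:~R ^+ 2 * (x3%:~R^-1 ^+ 2).
      by rewrite exprMn mulrA.
    have -> : B * (`|c2| * (x2%:~R / x3%:~R) ^+ 2) = B * `|c2| * x2%:~R ^+ 2 * (x3%:~R^-1 ^+ 2).
      by rewrite exprMn !mulrA.
    apply: ler_wpM2r; first by rewrite sqr_ge0.
    rewrite /c1 /c2 /B -!intr_norm -!rmorphXn -!intrM ler_int.
    by apply: weighted_sqr_le => //; move: a20; clear; lia.
  have b0 : b != 0.
    apply/eqP => b0; apply: zy.
    have h0 : c1 * (X1 * Y1) + c2 * (X2 * Y2) + c3 = 0 by rewrite Eb b0 mul0r.
    have [h1 h2] := conic_polar0 c10 c20 c30 EX EY h0.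
    have crossE (u v w x : int) : 0 < v%:~R :> R -> 0 < x%:~R :> R ->
        u%:~R / v%:~R = w%:~R / x%:~R :> R -> v * w = u * x.
      move=> v0 x0 /eqP; rewrite (eqr_div _ _ (lt0r_neq0 v0) (lt0r_neq0 x0)) => /eqP h; apply/eqP.
      by rewrite -(eqr_int R) !intrM h mulrC.
    have pz : prim3 z3 z1 z2 by apply: prim3_rot; apply: prim3_rot; exact: sol_primz slz.
    have py : prim3 y3 y1 y2 by apply: prim3_rot; apply: prim3_rot; exact: sol_primz sly.
    have [-> -> ->//] := prim3_prop pz py z30 y30 (crossE _ _ _ _ z3R y3R h1) (crossE _ _ _ _ z3R y3R h2).
  have L := conic_chord c20 (divr_gt0 z1R z3R) (divr_gt0 z2R z3R) (divr_gt0 y1R y3R)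
     (divr_gt0 y2R y3R) (ltW AR0) EX EY (lam _ _ _ z3R hz12) (lam _ _ _ y3R hy12).
  rewrite -/X1 -/Y1 Eb in L.
  have bge : 64 ^+ s <= `|b| * `|A| ^+ 3.
    have h64 : 64 ^+ s <= `|g1 * g2 * g3|.
      rewrite /s !exprD !normrM; case/andP: l1 => l1 _; case/andP: l2 => l2 _; case/andP: l3 => l3 _.
      by rewrite !ler_pM // ?mulr_ge0 ?exprn_ge0.
    apply: le_trans h64 _; rewrite -normrX -normrM.
    have [r er] := dvdzP (hdvd _ _ Pz Py); rewrite /= -/b in er.
    rewrite er (normrM r) ler_peMl //.
    have : r != 0 by apply: contra_neq (mulf_neq0 b0 (expf_neq0 3 A0)) => r0; rewrite er r0 mul0r.
    by clear; lia.
  have bgeR : 64 ^+ s <= `|b%:~R| * B ^+ 3 :> R.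
    by move: bge; rewrite -(ler_int R) intrM !rmorphXn /= intr_norm.
  have zle := in_level_sqrt_real R l3 (ltW z30) lz2.
  have yle := in_level_sqrt_real R l3 (ltW y30) ly2.
  have c1le : `|c1| <= B * 64 ^+ k1.+1.
    rewrite /c1 -intr_norm normrM intrM /B; apply: ler_pM; rewrite ?ler0z ?ler_int //.
    by case/andP: l1 => _ /ltW; rewrite -(ler_int R) rmorphXn.
  rewrite -(@ler_pXn2r _ 2) // ?nnegrE ?(ltW eta0) //.
  rewrite real_normK ?num_real // -/X1 -/Y1.
  set D := (X1 - Y1) ^+ 2 in L *.
  have D0 : 0 <= D by rewrite sqr_ge0.
  set T : R := z3%:~R * y3%:~R in L.
  have T0 : 0 < T by rewrite mulr_gt0.
  have Tle : T <= (8 ^+ p.+1 / 8 ^+ k3) * (8 ^+ p.+1 / 8 ^+ k3).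
    by apply: ler_pM => //; exact: ltW.
  have L2 : 2 * `|b%:~R| <= (1 + B) * (`|c1| * D) * T.
    rewrite -ler_pdivrMr // -[leLHS]mulrA.
    by move: L; rewrite normrM normfV (gtr0_norm T0).
  have L3 : 2 * 64 ^+ s <= (1 + B) * (B * 64 ^+ k1.+1 * D) * T * B ^+ 3.
    apply: (@le_trans _ _ (2 * `|b%:~R| * B ^+ 3)).
      by rewrite -mulrA ler_wpM2l.
    apply: ler_wpM2r; first by rewrite exprn_ge0 // ltW.
    apply: le_trans L2 _; apply: ler_wpM2r; first exact: ltW.
    by apply: ler_wpM2l; [rewrite addr_ge0 // ltW | rewrite ler_wpM2r].
  (* One more factor [B] than the estimate needs makes the resulting lower bound for [D] exactly the
     square of [eta]. *)
  have L4 : 64 ^+ s <= B ^+ 6 * 64 ^+ k1.+1 * D * T.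
    have M0 : 0 <= B ^+ 4 * 64 ^+ k1.+1 * D * T.
      exact: (mulr_ge0 (mulr_ge0 (mulr_ge0 (exprn_ge0 4 (ltW AR0)) (exprn_ge0 _ (ler0n _ 64))) D0) (ltW T0)).
    have h : 2 * 64 ^+ s <= 2 * B * (B ^+ 4 * 64 ^+ k1.+1 * D * T).
      apply: le_trans L3 _.
      have -> : (1 + B) * (B * 64 ^+ k1.+1 * D) * T * B ^+ 3 = (1 + B) * (B ^+ 4 * 64 ^+ k1.+1 * D * T) by ring.
      by apply: ler_wpM2r => //; lra.
    have h2 : B * (B ^+ 4 * 64 ^+ k1.+1 * D * T) <= B * (B * (B ^+ 4 * 64 ^+ k1.+1 * D * T)).
      by rewrite ler_wpM2l ?(ltW AR0) // ler_peMl.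
    have -> : B ^+ 6 * 64 ^+ k1.+1 * D * T = B * (B * (B ^+ 4 * 64 ^+ k1.+1 * D * T)) by ring.
    move: (B ^+ 4 * 64 ^+ k1.+1 * D * T) h h2 => M h h2; apply: le_trans h2; move: h; rewrite -mulrA ler_pM2l //.
  have L5 : 64 ^+ s <= B ^+ 6 * 64 ^+ k1.+1 * D * ((8 ^+ p.+1 / 8 ^+ k3) * (8 ^+ p.+1 / 8 ^+ k3)).
    apply: le_trans L4 _; apply: ler_wpM2l => //.
    exact: (mulr_ge0 (mulr_ge0 (exprn_ge0 6 (ltW AR0)) (exprn_ge0 _ (ler0n _ 64))) D0).
  have -> : eta ^+ 2 = 64 ^+ s * (8 ^+ k3 * 8 ^+ k3) / (B ^+ 6 * 64 ^+ k1.+1 * (8 ^+ p.+1 * 8 ^+ p.+1)).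
    by rewrite /eta !exp64; field; rewrite !e8n gt_eqF.
  rewrite ler_pdivrMr ?mulr_gt0 ?exprn_gt0 // -ler_pdivlMr ?mulr_gt0 //.
  apply: le_trans L5 _; rewrite le_eqVlt; apply/orP; left; apply/eqP.
  by field; rewrite e8n.
Qed.

End ClassFiber6.

(** * Labels of classes *)

(** What remains of [conic_sol] once z is forgotten: labels are counted without reference to a point
    of their class. *)
Record coef_cond (a1 a2 a3 g1 g2 g3 : int) : Prop := CoefCond {
  gc_sq1 : sqfree g1; gc_sq2 : sqfree g2; gc_sq3 : sqfree g3;
  gc_prim : prim3 g1 g2 g3;
  gc_12 : (gcdz g1 g2 %| a3)%Z; gc_13 : (gcdz g1 g3 %| a2)%Z; gc_23 : (gcdz g2 g3 %| a1)%Z }.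

(** The bound of [small_point] times |A|^2, because d1 d2 d3 divides only A times the common factor
    removed from the small point. *)
Definition label_size (a1 a2 a3 : int) (k1 k2 k3 : nat) : int :=
  16 * `|a1 * a2 * a3| ^+ 12 * 64 ^+ (k1 + k2 + k3 + 6).

Notation V3 := (int * int * int)%type.

(* (g, e, d) labels a class: e is a primitive small point, and g_i / d_i is the largest divisor
   of g_i modulo which e is proportional to the points z of the class (see label_of). The
   d_i are needed because the small point of a class may only be a multiple of a primitive
   point, and that point lies in another class. *)
Definition label (a1 a2 a3 : int) (k1 k2 k3 : nat) (t : V3 * V3 * V3) : Prop :=
  let: (g1, g2, g3, (e1, e2, e3), (d1, d2, d3)) := t in
  [/\ coef_cond a1 a2 a3 g1 g2 g3, [/\ in_level k1 g1, in_level k2 g2 & in_level k3 g3],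
     isotropic a1 a2 a3 g1 g2 g3 e1 e2 e3 /\ prim3 e1 e2 e3,
     [/\ 0 < d1, 0 < d2 & 0 < d3] /\ [/\ (d1 %| g1)%Z, (d2 %| g2)%Z & (d3 %| g3)%Z] &
     [/\ d1 * d2 * d3 * (d1 * d2 * d3) * (`|g1| * (e1 * e1)) <= label_size a1 a2 a3 k1 k2 k3,
         d1 * d2 * d3 * (d1 * d2 * d3) * (`|g2| * (e2 * e2)) <= label_size a1 a2 a3 k1 k2 k3 &
         d1 * d2 * d3 * (d1 * d2 * d3) * (`|g3| * (e3 * e3)) <= label_size a1 a2 a3 k1 k2 k3]].

Lemma sol_gcond a1 a2 a3 g1 g2 g3 z1 z2 z3 :
  conic_sol a1 a2 a3 g1 g2 g3 z1 z2 z3 -> coef_cond a1 a2 a3 g1 g2 g3.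
Proof.
move=> h; have [s1 s2 s3 _ _ _ _ _] := h; split => //.
- exact: sol_primg h.
- exact: sol_gcdg12 h.
- exact: sol_gcdg13 h.
- exact: sol_gcdg23 h.
Qed.

Lemma label_exists a1 a2 a3 k1 k2 k3 p q g1 g2 g3 z1 z2 z3 : a1 * a2 * a3 != 0 ->
  conic_box a1 a2 a3 k1 k2 k3 p q (g1, g2, g3, (z1, z2, z3)) ->
  exists e1 e2 e3 d1 d2 d3 : int,
    label a1 a2 a3 k1 k2 k3 (g1, g2, g3, (e1, e2, e3), (d1, d2, d3)) /\
    [/\ gcdz g1 (e2 * z3 - e3 * z2) * d1 = `|g1|, gcdz g2 (e3 * z1 - e1 * z3) * d2 = `|g2| &
        gcdz g3 (e1 * z2 - e2 * z1) * d3 = `|g3|].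
Proof.
move=> A0 hb; have [u1 [u2 [u3 [hu u0 [c1 c2 c3] /= [b1 b2 b3]]]]] := small_point A0 hb.
case: hb => sl levs _ _ _.
have gc := sol_gcond sl.
pose c := gcdz u1 (gcdz u2 u3).
have cu1 : (c %| u1)%Z by rewrite dvdz_gcdl.
have cu2 : (c %| u2)%Z by exact: dvdz_trans (dvdz_gcdr _ _) (dvdz_gcdl _ _).
have cu3 : (c %| u3)%Z by exact: dvdz_trans (dvdz_gcdr _ _) (dvdz_gcdr _ _).
have c0 : c != 0.
  apply/eqP => c0; apply: u0; move: cu1 cu2 cu3; rewrite c0 !dvd0z.
  by move=> /eqP -> /eqP -> /eqP ->.
have cpos : 0 < c by rewrite lt_neqAle eq_sym c0 /=.
have [e1 E1] := dvdzP cu1; have [e2 E2] := dvdzP cu2; have [e3 E3] := dvdzP cu3.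
have pe : prim3 e1 e2 e3.
  move=> d d1 d2 d3.
  have h1 : (d * c %| u1)%Z by rewrite E1 dvdz_mul.
  have h2 : (d * c %| u2)%Z by rewrite E2 dvdz_mul.
  have h3 : (d * c %| u3)%Z by rewrite E3 dvdz_mul.
  have : (d * c %| gcdz u1 (gcdz u2 u3))%Z by rewrite !dvdz_gcd h1 h2 h3.
  by rewrite -/c -[X in (_ %| X)%Z]mul1r dvdz_mul2r.
have he : isotropic a1 a2 a3 g1 g2 g3 e1 e2 e3.
  apply: (mulIf (mulf_neq0 c0 c0)); rewrite mul0r -[RHS]hu E1 E2 E3; ring.
(* As g divides c x, the cofactor of gcd(g, x) in g divides c: what is lost of the class condition
   on dividing the small point by its content c is a divisor of c. *)
have mk (g x : int) : sqfree g -> (g %| c * x)%Z ->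
    exists d, [/\ 0 < d, (d %| g)%Z, (d %| c)%Z & gcdz g x * d = `|g|].
  move=> sg gx; have g0 := sqfree_neq0 sg.
  have /dvdzP[d ed] := dvdz_gcdl g x.
  have G0 : 0 < gcdz g x.
    by rewrite lt_neqAle; apply/andP; split => //; rewrite eq_sym; apply: contra_neq g0 => h; rewrite ed h mulr0.
  have nd y : (`|d| %| y)%Z = (d %| y)%Z by rewrite -abszE !dvdzE absz_nat.
  exists `|d|; split.
  - by rewrite normr_gt0; apply: contra_neq g0 => h; rewrite ed h mul0r.
  - by rewrite nd; apply/dvdzP; exists (gcdz g x); rewrite mulrC.
  - rewrite nd.
    rewrite -(dvdz_mul2r (lt0r_neq0 G0)) -ed.
    have [u [v <-]] := Bezoutz g x.
    rewrite (_ : c * _ = c * u * g + v * (c * x)); last by ring.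
    by rewrite rpredD // dvdz_mull.
  - by rewrite [in RHS]ed normrM mulrC (gtr0_norm G0).
have [d1 [d10 d1g d1c hd1]] : exists d, [/\ 0 < d, (d %| g1)%Z, (d %| c)%Z & gcdz g1 (e2 * z3 - e3 * z2) * d = `|g1|].
  by apply: mk; [exact: gc_sq1 gc | rewrite (_ : _ * _ = u2 * z3 - u3 * z2) // E2 E3; ring].
have [d2 [d20 d2g d2c hd2]] : exists d, [/\ 0 < d, (d %| g2)%Z, (d %| c)%Z & gcdz g2 (e3 * z1 - e1 * z3) * d = `|g2|].
  by apply: mk; [exact: gc_sq2 gc | rewrite (_ : _ * _ = u3 * z1 - u1 * z3) // E1 E3; ring].
have [d3 [d30 d3g d3c hd3]] : exists d, [/\ 0 < d, (d %| g3)%Z, (d %| c)%Z & gcdz g3 (e1 * z2 - e2 * z1) * d = `|g3|].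
  by apply: mk; [exact: gc_sq3 gc | rewrite (_ : _ * _ = u1 * z2 - u2 * z1) // E1 E2; ring].
exists e1, e2, e3, d1, d2, d3; split => //; split => //.
(* The d_i are coprime up to the a_i, so their product is at most c |A|; the factor c^2 gained by
   passing from u to e therefore pays for D^2. *)
have dD : (d1 * d2 * d3 %| c * (a1 * a2 * a3))%Z.
  apply: dvdz_prod3 => //.
  - exact: dvdz_gcdz_trans (gc_12 gc).
  - exact: dvdz_gcdz_trans (gc_13 gc).
  - exact: dvdz_gcdz_trans (gc_23 gc).
set D := d1 * d2 * d3 in dD *.
have D0 : 0 < D by rewrite !mulr_gt0.
have leD : D <= c * `|a1 * a2 * a3|.
  have := dvdn_leq _ dD; rewrite absz_gt0 mulf_neq0 // => /(_ isT).
  by rewrite -lez_nat !abszE (normrM c) (gtr0_norm D0) (gtr0_norm cpos).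
have fin g u e : u = e * c -> `|g| * (u * u) <= 16 * `|a1 * a2 * a3| ^+ 10 * 64 ^+ (k1 + k2 + k3 + 6) ->
    D * D * (`|g| * (e * e)) <= label_size a1 a2 a3 k1 k2 k3.
  move=> E hg; set A := a1 * a2 * a3 in leD hg *.
  have ge0 : 0 <= `|g| * (e * e) by rewrite mulr_ge0 // -expr2 sqr_ge0.
  have h1 : D * D <= c * `|A| * (c * `|A|) by apply: ler_pM => //; exact: ltW.
  apply: le_trans (ler_wpM2r ge0 h1) _.
  have -> : c * `|A| * (c * `|A|) * (`|g| * (e * e)) = `|A| ^+ 2 * (`|g| * (u * u)) by rewrite E; ring.
  have -> : label_size a1 a2 a3 k1 k2 k3 = `|A| ^+ 2 * (16 * `|A| ^+ 10 * 64 ^+ (k1 + k2 + k3 + 6)).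
    by rewrite /label_size -/A; ring.
  by rewrite ler_wpM2l // sqr_ge0.
by split; [apply: fin E1 b1|apply: fin E2 b2|apply: fin E3 b3].
Qed.

Lemma label_rot a1 a2 a3 k1 k2 k3 g1 g2 g3 e1 e2 e3 d1 d2 d3 :
  label a1 a2 a3 k1 k2 k3 (g1, g2, g3, (e1, e2, e3), (d1, d2, d3)) ->
  label a2 a3 a1 k2 k3 k1 (g2, g3, g1, (e2, e3, e1), (d2, d3, d1)).
Proof.
move=> [[s1 s2 s3 pg h12 h13 h23] [l1 l2 l3] [he pe] [[d10 d20 d30] [h1 h2 h3]] [b1 b2 b3]].
have eD : d2 * d3 * d1 = d1 * d2 * d3 by ring.
have eB : label_size a2 a3 a1 k2 k3 k1 = label_size a1 a2 a3 k1 k2 k3.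
  rewrite /label_size; congr (_ * `| _ | ^+ _ * _ ^+ _); [ring | lia].
split => //; last by rewrite eD eB.
  by split => //; [exact: prim3_rot | rewrite gcdzC | rewrite gcdzC].
by split; [exact: isotropic_rot | exact: prim3_rot].
Qed.

(** A common divisor r of [c] and [d1] divides [g1], which shares only factors of the a_i with [d2]
    and [d3]. Since r is squarefree, it divides A e2 and A e3, and [isotropic_dvd] applies with K =
    A. *)
Lemma label_gcd1 (a1 a2 a3 g1 g2 g3 e1 e2 e3 d1 d2 d3 c : int) :
  coef_cond a1 a2 a3 g1 g2 g3 -> isotropic a1 a2 a3 g1 g2 g3 e1 e2 e3 -> prim3 e1 e2 e3 ->
  (d1 %| g1)%Z -> (d2 %| g2)%Z -> (d3 %| g3)%Z ->
  (c %| a1 * a2 * a3 * (d2 * (e2 * e2)))%Z -> (c %| a1 * a2 * a3 * (d3 * (e3 * e3)))%Z ->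
  (gcdz c d1 %| (a1 * a2 * a3) ^+ 3)%Z.
Proof.
move=> gc he pe h1 h2 h3 c2 c3; set A := a1 * a2 * a3 in c2 c3 *; set r := gcdz c d1.
have rg : (r %| g1)%Z by exact: dvdz_trans (dvdz_gcdr _ _) h1.
have sr := sqfree_dvd rg (gc_sq1 gc).
have aux d a e g : (c %| A * (d * (e * e)))%Z -> (d %| g)%Z -> (gcdz g1 g %| a)%Z -> (a %| A)%Z -> (r %| A * e)%Z.
  move=> cd dg ga aA; apply: sqfree_dvd_sqr => //.
  rewrite (_ : _ * _ * _ = A * (e * e) * A); last by ring.
  apply: (@dvdz_mul_gcdz _ _ d).
    by have := dvdz_trans (dvdz_gcdl c d1) cd; congr (is_true (_ %| _)%Z); ring.
  exact: dvdz_trans (dvdz_gcdz_trans rg dg ga) aA.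
have r2 : (r %| A * e2)%Z by apply: (aux _ _ _ _ c2 h2 (gc_12 gc)); rewrite /A dvdz_mull.
have r3 : (r %| A * e3)%Z by apply: (aux _ _ _ _ c3 h3 (gc_13 gc)); rewrite /A mulrAC dvdz_mull.
have := isotropic_dvd he (gc_sq1 gc) pe rg r2 r3.
move/(dvdz_mulr (a2 * a3)); rewrite (_ : _ * _ = A ^+ 3) //; rewrite /A; ring.
Qed.

(** Supplies the constant that [plane_count] needs for the plane containing the quotients g_i / d_i.
    The gcd divides A d1 d2 d3 because the e_i^2 have no common factor, and its gcd with each d_i
    divides A^3. *)
Lemma label_gcd (a1 a2 a3 g1 g2 g3 e1 e2 e3 d1 d2 d3 : int) :
  coef_cond a1 a2 a3 g1 g2 g3 -> isotropic a1 a2 a3 g1 g2 g3 e1 e2 e3 -> prim3 e1 e2 e3 ->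
  (d1 %| g1)%Z -> (d2 %| g2)%Z -> (d3 %| g3)%Z ->
  (gcdz (a1 * d1 * (e1 * e1)) (gcdz (a2 * d2 * (e2 * e2)) (a3 * d3 * (e3 * e3)))
    %| (a1 * a2 * a3) ^+ 10)%Z.
Proof.
move=> gc he pe h1 h2 h3; set c := gcdz _ _; set A := a1 * a2 * a3.
have c1 : (c %| A * (d1 * (e1 * e1)))%Z.
  have := dvdz_mull (a2 * a3) (dvdz_gcdl _ _ : (c %| a1 * d1 * (e1 * e1))%Z).
  by congr (is_true (_ %| _)%Z); rewrite /A; ring.
have c2 : (c %| A * (d2 * (e2 * e2)))%Z.
  have := dvdz_mull (a1 * a3) (dvdz_trans (dvdz_gcdr _ _) (dvdz_gcdl _ _) : (c %| a2 * d2 * (e2 * e2))%Z).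
  by congr (is_true (_ %| _)%Z); rewrite /A; ring.
have c3 : (c %| A * (d3 * (e3 * e3)))%Z.
  have := dvdz_mull (a1 * a2) (dvdz_trans (dvdz_gcdr _ _) (dvdz_gcdr _ _) : (c %| a3 * d3 * (e3 * e3))%Z).
  by congr (is_true (_ %| _)%Z); rewrite /A; ring.
have E2 : a2 * a3 * a1 = A by rewrite /A; ring.
have E3 : a3 * a1 * a2 = A by rewrite /A; ring.
have gc2 : coef_cond a2 a3 a1 g2 g3 g1.
  by case: gc => *; split => //; [exact: prim3_rot | rewrite gcdzC | rewrite gcdzC].
have gc3 : coef_cond a3 a1 a2 g3 g1 g2.
  by case: gc2 => *; split => //; [exact: prim3_rot | rewrite gcdzC | rewrite gcdzC].
have r1 := label_gcd1 gc he pe h1 h2 h3 c2 c3.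
have r2 : (gcdz c d2 %| A ^+ 3)%Z.
  rewrite -E2 in c3 c1 *.
  exact: label_gcd1 gc2 (isotropic_rot he) (prim3_rot pe) h2 h3 h1 c3 c1.
have r3 : (gcdz c d3 %| A ^+ 3)%Z.
  rewrite -E3 in c2 c1 *.
  exact: label_gcd1 gc3 (isotropic_rot (isotropic_rot he)) (prim3_rot (prim3_rot pe)) h3 h1 h2 c1 c2.
have cD : (c %| A * (d1 * d2 * d3))%Z.
  apply: (dvdz_prim3 (prim3_sqr pe)).
  - by have := dvdz_mulr (d2 * d3) c1; congr (is_true (_ %| _)%Z); ring.
  - by have := dvdz_mulr (d1 * d3) c2; congr (is_true (_ %| _)%Z); ring.
  - by have := dvdz_mulr (d1 * d2) c3; congr (is_true (_ %| _)%Z); ring.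
rewrite (_ : A ^+ 10 = A * (A ^+ 3 * A ^+ 3 * A ^+ 3)); last by ring.
by apply: (dvdz_mul_gcdz cD); apply: dvdz_gcdzMr => //; apply: dvdz_gcdzMr.
Qed.

(** * Bounds for the number of labels *)

Ltac nonneg := repeat first [assumption | exact: ler01 | exact: ler0n | exact: normr_ge0
  | apply: ltW; assumption | apply: exprn_ge0 | apply: divr_ge0 | apply: mulr_ge0
  | apply: addr_ge0].

Section Sums8.
Variable R : realType.

Lemma sum_inv_sqr (N : nat) : \sum_(i <- iota 1 N) (i%:R ^+ 2)^-1 <= 2 :> R.
Proof.
case: N => [|N]; first by rewrite big_nil.
(* The stronger bound 2 - 1 / N turns the induction into a telescoping sum. *)
suff h : \sum_(i <- iota 1 N.+1) (i%:R ^+ 2)^-1 <= 2 - N.+1%:R^-1 :> R.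
  by apply: le_trans h _; rewrite gerBl invr_ge0.
elim: N => [|N IH]; first by rewrite big_seq1 expr1n invr1; lra.
rewrite -(addn1 N.+1) iotaD big_cat big_seq1 /= add1n.
apply: le_trans (lerD IH (lexx _)) _.
have n0 : 0 < N.+1%:R :> R by rewrite ltr0n.
rewrite addn1 -[N.+2%:R]natr1; move: (N.+1%:R : R) n0 => n n0.
have n1 : 0 < n + 1 by rewrite addr_gt0.
have : (n + 1) ^- 2 <= n^-1 - (n + 1)^-1.
  have -> : n^-1 - (n + 1)^-1 = (n * (n + 1))^-1 by field; rewrite !gt_eqF.
  rewrite lef_pV2 ?posrE; [|exact: exprn_gt0|exact: mulr_gt0].
  by rewrite expr2 ler_pM2r // lerDl ler01.
lra.
Qed.

Lemma harmonic_pow2 (n : nat) : \sum_(i <- iota 1 (2 ^ n)) (i%:R)^-1 <= 1 + n%:R :> R.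
Proof.
elim: n => [|n IH]; first by rewrite expn0 big_seq1 invr1 addr0.
rewrite expnS mul2n -addnn iotaD big_cat /= -natr1 addrA; apply: lerD => //.
have n0 : 0 < (2 ^ n)%:R :> R by rewrite ltr0n expn_gt0.
rewrite big_seq; apply: (@le_trans _ _ (\sum_(i <- iota (1 + 2 ^ n) (2 ^ n) | i \in iota (1 + 2 ^ n) (2 ^ n)) ((2 ^ n)%:R)^-1)).
  apply: ler_sum => i; rewrite mem_iota => /andP[h _].
  rewrite lef_pV2 ?posrE // ?ltr0n ?ler_nat; first by apply: leq_trans h; rewrite leq_addl.
  by apply: leq_trans h.
rewrite -big_seq big_const_seq count_predT size_iota iter_addr addr0.
by rewrite -(mulr_natl (_^-1)) mulfV // gt_eqF.
Qed.

End Sums8.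

Section LabCount8.
Variable R : realType.
Variables (a1 a2 a3 : int).
Hypothesis A0 : a1 * a2 * a3 != 0.
Let A := a1 * a2 * a3.
Let B : R := `|A|%:~R.

(** The square root of [label_size] at b = |a1 a2 a3|, without the factor 64^(k1 + k2 + k3). *)
Definition label_radius (b : R) : R := 4 * b ^+ 6 * 8 ^+ 6.
Definition label_const (b : R) : R := 16 * label_radius b * (label_radius b ^+ 2 + 128 * 64 ^+ 2 * b ^+ 10).

(** The coordinate with the largest 8^k_i |e_i| is put third, where its square is the denominator in
    the count of g; the other positions are reached by rotation. *)
Definition label_max k1 k2 k3 (t : V3 * V3 * V3) : Prop :=
  label a1 a2 a3 k1 k2 k3 t /\
  let: (e1, e2, e3) := t.1.2 in
  [/\ e1 != 0, e2 != 0, e3 != 0, 8 ^+ k1 * `|e1| <= 8 ^+ k3 * `|e3| &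
      8 ^+ k2 * `|e2| <= 8 ^+ k3 * `|e3|].

Lemma in_level_real k (g : int) : in_level k g -> 64 ^+ k <= (`|g|%:~R : R) <= 64 ^+ k.+1.
Proof.
by move=> /andP[h1 /ltW h2]; rewrite -(ler_int R) rmorphXn /= in h1; rewrite -(ler_int R) rmorphXn /= in h2; rewrite h1 h2.
Qed.

(** For fixed e and d the quotients g_i / d_i form primitive solutions of the linear equation with
    coefficients a_i d_i e_i^2, so [plane_count] applies with c = A^10. Any one label with these
    data provides the hypotheses of [label_gcd]; without one there is nothing to count. *)
Lemma label_count_fixed_point k1 k2 k3 d1 d2 d3 e1 e2 e3 : e3 != 0 -> 0 < d1 -> 0 < d2 -> 0 < d3 ->
  cardle (fun g : V3 => label a1 a2 a3 k1 k2 k3 (g, (e1, e2, e3), (d1, d2, d3)))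
   (2 * (1 + 128 * B ^+ 10 * 64 ^+ k1.+1 * 64 ^+ k2.+1 /
      ((d1 * d2 * d3)%:~R * `|e3|%:~R ^+ 2))).
Proof.
move=> e30 d10 d20 d30; set D : R := (d1 * d2 * d3)%:~R.
have D0 : 0 < D by rewrite ltr0z !mulr_gt0.
have B0 : 0 <= B by rewrite ler0z.
have x0 : 0 < `|e3|%:~R :> R by rewrite ltr0z normr_gt0.
have a30 : a3 != 0 by apply: contra_neq A0 => ->; rewrite mulr0.
have n30 : a3 * d3 * (e3 * e3) != 0 by rewrite !mulf_neq0 // gt_eqF.
have [[[[h1 h2] h3] hg]|nex] := pselect (exists g, label a1 a2 a3 k1 k2 k3 (g, (e1, e2, e3), (d1, d2, d3))); last first.
  move=> [|g s] us hs; last by case: nex; exists g; apply: hs; rewrite mem_head.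
  by rewrite mulr_ge0 // addr_ge0 // divr_ge0 ?mulr_ge0 ?exprn_ge0 // ltW // mulr_gt0 ?exprn_gt0.
case: hg => gc _ [he pe] [_ [dh1 dh2 dh3]] _.
have cg := label_gcd gc he pe dh1 dh2 dh3.
have d1R : 0 < d1%:~R :> R by rewrite ltr0z.
have d2R : 0 < d2%:~R :> R by rewrite ltr0z.
have d3R : 0 < d3%:~R :> R by rewrite ltr0z.
have := @plane_count R _ _ _ (A ^+ 10) (64 ^+ k1.+1 / d1%:~R) (64 ^+ k2.+1 / d2%:~R) n30
  (expf_neq0 10 A0) cg.
rewrite divr_gt0 ?exprn_gt0 // divr_ge0 ?exprn_ge0 ?(ltW d2R) // => /(_ isT isT) hpl.
have le1 : 2 * (1 + 128 * `|A ^+ 10|%:~R * (64 ^+ k1.+1 / d1%:~R) * (64 ^+ k2.+1 / d2%:~R) /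
     `|a3 * d3 * (e3 * e3)|%:~R) <=
   2 * (1 + 128 * B ^+ 10 * 64 ^+ k1.+1 * 64 ^+ k2.+1 / (D * `|e3|%:~R ^+ 2)).
  apply: ler_wpM2l => //; rewrite lerD2l.
  have -> : `|A ^+ 10|%:~R = B ^+ 10 :> R by rewrite normrX rmorphXn.
  have -> : `|a3 * d3 * (e3 * e3)|%:~R = `|a3|%:~R * (d3%:~R * `|e3|%:~R ^+ 2) :> R.
    by rewrite !normrM (gtr0_norm d30) !intrM; ring.
  have a3R : 1 <= `|a3|%:~R :> R by rewrite ler1z; move: a30; clear; lia.
  have a3R0 : 0 < `|a3|%:~R :> R by rewrite (lt_le_trans ltr01).
  have -> : 128 * B ^+ 10 * (64 ^+ k1.+1 / d1%:~R) * (64 ^+ k2.+1 / d2%:~R) /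
     (`|a3|%:~R * (d3%:~R * `|e3|%:~R ^+ 2)) =
    128 * B ^+ 10 * 64 ^+ k1.+1 * 64 ^+ k2.+1 / (D * `|e3|%:~R ^+ 2) * `|a3|%:~R^-1.
    by rewrite /D !intrM; field; rewrite !gt_eqF.
  apply: ler_piMr; last by rewrite invf_le1.
  by rewrite divr_ge0 ?mulr_ge0 ?exprn_ge0 ?(ltW D0) ?(ltW x0).
apply: (cardle_sub (Q := _)) le1 _; last first.
  apply: (@cardle_inj _ _ _ (fun g : V3 => label a1 a2 a3 k1 k2 k3 (g, (e1, e2, e3), (d1, d2, d3)))
     _ (fun g : V3 => ((g.1.1 %/ d1)%Z, (g.1.2 %/ d2)%Z, (g.2 %/ d3)%Z))) hpl.
    move=> [[g1 g2] g3] [gc' [l1 l2 l3] [he' _] [_ [dg1 dg2 dg3]] _] /=.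
    have /dvdzP[q1 E1] := dg1; have /dvdzP[q2 E2] := dg2; have /dvdzP[q3 E3] := dg3.
    rewrite E1 E2 E3 !mulzK ?gt_eqF //; split.
    - by rewrite -[RHS]he' E1 E2 E3; ring.
    - move=> d dq1 dq2 dq3; apply: (gc_prim gc'); rewrite ?E1 ?E2 ?E3; exact: dvdz_mulr.
    - have := in_level_real l1; rewrite E1 normrM intrM (gtr0_norm d10) => /andP[u1 u2].
      rewrite ler_pdivlMr // u2 andbT ler_pdivrMr // ler_pdivrMr //.
      by move: u1; rewrite exprS; lra.
    - have := in_level_real l2; rewrite E2 normrM intrM (gtr0_norm d20) => /andP[u1 u2].
      by rewrite ler_pdivlMr.
  move=> [[g1 g2] g3] [[f1 f2] f3] [_ _ _ [_ [dg1 dg2 dg3]] _] [_ _ _ [_ [df1 df2 df3]] _] /=.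
  move=> [E1 E2 E3]; rewrite -(divzK dg1) -(divzK dg2) -(divzK dg3) E1 E2 E3.
  by rewrite !divzK.
by [].
Qed.

(** The size condition gives |e3| <= U 8^(k1+k2) / D, and e3 in turn bounds [e1] and [e2]. What
    matters is the decay in D = d1 d2 d3: its inverse square makes the sum over the divisors
    converge, so they cost no logarithm. *)
Lemma label_count_fixed_divisors k1 k2 k3 d1 d2 d3 : 0 < d1 -> 0 < d2 -> 0 < d3 ->
  cardle (fun t : V3 * V3 => label_max k1 k2 k3 (t, (d1, d2, d3)))
   (label_const B * 64 ^+ (k1 + k2 + k3) / (d1 * d2 * d3)%:~R ^+ 2).
Proof.
move=> d10 d20 d30; have [D eD] : exists x : R, x = (d1 * d2 * d3)%:~R by eexists.
rewrite -eD.
have D1 : 1 <= D.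
  rewrite eD ler1z; have : 0 < d1 * d2 * d3 by rewrite !mulr_gt0.
  by clear; lia.
have D0 : 0 < D by exact: lt_le_trans D1.
have B0 : 0 <= B by rewrite ler0z.
have [x1 ex1] : exists x : R, x = 8 ^+ k1 by eexists.
have [x2 ex2] : exists x : R, x = 8 ^+ k2 by eexists.
have [x3 ex3] : exists x : R, x = 8 ^+ k3 by eexists.
have x10 : 0 < x1 by rewrite ex1 exprn_gt0.
have x20 : 0 < x2 by rewrite ex2 exprn_gt0.
have x30 : 0 < x3 by rewrite ex3 exprn_gt0.
have [U eU] : exists x : R, x = label_radius B by eexists.
have U0 : 0 <= U by rewrite eU /label_radius; nonneg.
pose E := U * (x1 * x2) / D.
have E0 : 0 <= E by rewrite divr_ge0 ?mulr_ge0 // ltW.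
(* [m] bounds the number of labels for a given [e3]; it is evaluated at the largest value |e3| =
   E. *)
pose m := 8 * (x3 ^+ 2 / (x1 * x2)) * (E ^+ 2 + 128 * B ^+ 10 * (64 * x1 ^+ 2) * (64 * x2 ^+ 2) / D).
have m0 : 0 <= m.
  by rewrite /m; nonneg.
have le1 : 2 * E * m <= label_const B * 64 ^+ (k1 + k2 + k3) / D ^+ 2.
  have -> : label_const B * 64 ^+ (k1 + k2 + k3) / D ^+ 2 =
    16 * U * (x1 * x2 * x3) ^+ 2 / D ^+ 2 * (U ^+ 2 + 128 * 64 ^+ 2 * B ^+ 10).
    by rewrite /label_const -eU !exprD !exp64 -ex1 -ex2 -ex3; ring.
  have -> : 2 * E * m = 16 * U * (x1 * x2 * x3) ^+ 2 / D ^+ 2 * (U ^+ 2 / D + 128 * 64 ^+ 2 * B ^+ 10).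
    by rewrite /m /E; field; rewrite !gt_eqF.
  apply: ler_wpM2l; first by nonneg.
  by rewrite lerD2r ler_pdivrMr // ler_peMr // sqr_ge0.
apply: cardle_sub le1 _; last first.
  apply: (@cardle_fiber _ _ _ (fun t : V3 * V3 => label_max k1 k2 k3 (t, (d1, d2, d3)))
     (fun e : int => e != 0 /\ `|e|%:~R <= E) (fun t => t.2.2) (2 * E) m) => //.
  - move=> [[[g1 g2] g3] [[e1 e2] e3]] [[_ [l1 l2 l3] _ _ [_ _ b3]] [_ _ e30 _ _]] /=; split => //.
    rewrite /E ler_pdivlMr //.
    rewrite -(@ler_pXn2r _ 2) // ?nnegrE ?mulr_ge0 ?ler0z ?(ltW D0) ?(ltW x10) ?(ltW x20) //.
    rewrite -(ler_pM2r (exprn_gt0 2 x30)).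
    have -> : (U * (x1 * x2)) ^+ 2 * x3 ^+ 2 = (label_size a1 a2 a3 k1 k2 k3)%:~R.
      rewrite /label_size -/A !intrM !rmorphXn /= -/B eU /label_radius !exprD !exp64 -ex1 -ex2 -ex3; ring.
    have -> : (`|e3|%:~R * D) ^+ 2 * x3 ^+ 2 = D * D * (64 ^+ k3 * (e3 * e3)%:~R).
      have -> : (e3 * e3)%:~R = `|e3|%:~R ^+ 2 :> R.
        by rewrite -rmorphXn real_normK ?num_real.
      by rewrite exp64 -ex3; ring.
    move: b3; rewrite -(ler_int R) [X in X <= _]intrM; apply: le_trans.
    rewrite eD -[X in X * (64 ^+ _ * _)]intrM; apply: ler_wpM2l; first by rewrite ler0z -expr2 sqr_ge0.
    rewrite [leRHS]intrM; apply: ler_wpM2r; first by rewrite ler0z -expr2 sqr_ge0.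
    by have /andP[] := in_level_real l3.
  - exact: cardle_int_neq0.
  move=> e3 [e30 e3E].
  have y0 : 0 < `|e3|%:~R :> R by rewrite ltr0z normr_gt0.
  have [y ey] : exists x : R, x = `|e3|%:~R by eexists.
  rewrite -ey in e3E y0.
  have q0 k : 0 <= x3 * y / 8 ^+ k by nonneg.
  have le2 : (2 * (x3 * y / x1)) * (2 * (x3 * y / x2)) *
     (2 * (1 + 128 * B ^+ 10 * 64 ^+ k1.+1 * 64 ^+ k2.+1 / (D * y ^+ 2))) <= m.
    have -> : (2 * (x3 * y / x1)) * (2 * (x3 * y / x2)) *
      (2 * (1 + 128 * B ^+ 10 * 64 ^+ k1.+1 * 64 ^+ k2.+1 / (D * y ^+ 2))) =
      8 * (x3 ^+ 2 / (x1 * x2)) * (y ^+ 2 + 128 * B ^+ 10 * (64 * x1 ^+ 2) * (64 * x2 ^+ 2) / D).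
      by rewrite !exprS !exp64 -ex1 -ex2; field; rewrite !gt_eqF.
    apply: ler_wpM2l; first by nonneg.
    by rewrite lerD2r ler_pXn2r // nnegrE // ltW.
  apply: cardle_sub le2 _; last first.
    apply: (@cardle_fiber _ _ _ (fun x : V3 * V3 => label_max k1 k2 k3 (x, (d1, d2, d3)) /\ x.2.2 = e3)
       (fun e : int * int => (e.1 != 0 /\ `|e.1|%:~R <= x3 * y / x1) /\
                             (e.2 != 0 /\ `|e.2|%:~R <= x3 * y / x2)) (fun t => t.2.1)).
    - move=> [[[g1 g2] g3] [[e1 e2] e3']] [[_ [e10 e20 _ b1 b2]] /= ee].
      rewrite ee in b1 b2; rewrite !ler_pdivlMr // ex1 ex2 ex3 ey.
      by split; split => //; [move: b1|move: b2]; rewrite -(ler_int R) !intrM !rmorphXn /= => h; rewrite [leLHS]mulrC.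
    - by nonneg.
    - by rewrite ex1 ex2; exact: cardle_prod (cardle_int_neq0 (q0 k1)) (cardle_int_neq0 (q0 k2)).
    - move=> [e1 e2] _; have := @label_count_fixed_point k1 k2 k3 d1 d2 d3 e1 e2 e3 e30 d10 d20 d30.
      rewrite -eD -ey => LE.
      apply: (@cardle_inj _ _ _ _ _ (fun x : V3 * V3 => x.1)) LE.
        by move=> [g [[e1' e2'] e3']] [] [] + /= => /[swap] -> /[swap] [] [-> ->] [] //.
      move=> [g [[e1' e2'] e3']] [f [[f1 f2] f3]] [[_ /= ->] [-> ->]] [[_ /= ->] [-> ->]] /= ->.
      by [].
  by [].
by [].
Qed.
End LabCount8.

Section Class9.
Variable R : realType.

Lemma cardle_sum_sqr (T : eqType) (P : T -> Prop) (f : T -> int) (N : nat) (K : R) :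
  0 <= K -> (forall x, P x -> 0 < f x <= N%:Z) ->
  (forall d, 0 < d -> cardle (fun x => P x /\ f x = d) (K / d%:~R ^+ 2)) ->
  cardle P (2 * K).
Proof.
move=> K0 hf hd.
have h : cardle P (\sum_(d <- map Posz (iota 1 N)) (K / d%:~R ^+ 2)).
  apply: (@cardle_sum R _ _ _ f).
    move=> x /hf /andP[h1 h2]; apply/mapP; exists (absz (f x)); last by rewrite gtz0_abs.
    by rewrite mem_iota; move: h1 h2; clear; lia.
  move=> d /mapP[n]; rewrite mem_iota => /andP[n0 _] ->; apply: hd.
  by rewrite ltz_nat.
apply: cardle_sub h => //; rewrite big_map -mulr_sumr mulrC.
by apply: ler_wpM2r => //; exact: sum_inv_sqr.
Qed.

Lemma dvdz_in_level k (d g : int) : 0 < d -> (d %| g)%Z -> in_level k g -> d <= (64 ^ k.+1)%N%:Z.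
Proof.
move=> d0 dg lg; have g0 := in_level_neq0 lg; case/andP: lg => _ h.
have : (`|d| <= `|g|)%N by rewrite dvdn_leq // absz_gt0.
rewrite -lez_nat !abszE (gtr0_norm d0) => h2; apply: le_trans h2 _.
by apply: le_trans (ltW h) _; rewrite -natz natrX.
Qed.

Lemma label_max_count (a1 a2 a3 : int) (k1 k2 k3 : nat) : a1 * a2 * a3 != 0 ->
  cardle (label_max a1 a2 a3 k1 k2 k3)
    (8 * (label_const (`|a1 * a2 * a3|%:~R : R) * 64 ^+ (k1 + k2 + k3))).
Proof.
move=> A0; set K := label_const _ * _.
have B0 : 0 <= `|a1 * a2 * a3|%:~R :> R by rewrite ler0z.
have K0 : 0 <= K by rewrite /K /label_const /label_radius; nonneg.
have -> : 8 * K = 2 * (2 * (2 * K)) by ring.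
have iv (d : int) : 0 <= d%:~R ^+ 2 :> R by rewrite sqr_ge0.
apply: (@cardle_sum_sqr _ _ (fun t => t.2.1.1) (64 ^ k1.+1)%N); first by nonneg.
  move=> [[[[g1 g2] g3] [[e1 e2] e3]] [[d1 d2] d3]] [[_ [l1 l2 l3] _ [[h1 h2 h3] [q1 q2 q3]] _] _] /=.
  by rewrite h1 (dvdz_in_level h1 q1 l1).
move=> d1 d10; have i1 := iv d1; rewrite -!(mulrA 2).
apply: (@cardle_sum_sqr _ _ (fun t => t.2.1.2) (64 ^ k2.+1)%N); first by nonneg.
  move=> [[[[g1 g2] g3] [[e1 e2] e3]] [[d1' d2] d3]] [[[_ [l1 l2 l3] _ [[h1 h2 h3] [q1 q2 q3]] _] _] _] /=.
  by rewrite h2 (dvdz_in_level h2 q2 l2).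
move=> d2 d20; have i2 := iv d2; rewrite -!(mulrA 2).
apply: (@cardle_sum_sqr _ _ (fun t => t.2.2) (64 ^ k3.+1)%N); first by nonneg.
  move=> [[[[g1 g2] g3] [[e1 e2] e3]] [[d1' d2'] d3]] [[[[_ [l1 l2 l3] _ [[h1 h2 h3] [q1 q2 q3]] _] _] _] _] /=.
  by rewrite h3 (dvdz_in_level h3 q3 l3).
move=> d3 d30.
have -> : K / d1%:~R ^+ 2 / d2%:~R ^+ 2 / d3%:~R ^+ 2 = K / (d1 * d2 * d3)%:~R ^+ 2.
  by rewrite !intrM; field; rewrite !intr_eq0 !gt_eqF.
have LF := @label_count_fixed_divisors R a1 a2 a3 A0 k1 k2 k3 d1 d2 d3 d10 d20 d30.
apply: (@cardle_inj _ _ _ _ _ (fun t : V3 * V3 * V3 => t.1)) LF.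
  by move=> [t [[d1' d2'] d3']] [[[h /= e1] e2] e3]; rewrite -e1 -e2 -e3.
by move=> [t [[? ?] ?]] [t' [[? ?] ?]] [[[_ /= ->] ->] ->] [[[_ /= ->] ->] ->] ->.
Qed.

Definition rot3 (x : V3) : V3 := (x.1.2, x.2, x.1.1).
Definition rotl (t : V3 * V3 * V3) := (rot3 t.1.1, rot3 t.1.2, rot3 t.2).

Lemma rotl_inj : injective rotl.
Proof.
move=> [[[[g1 g2] g3] [[e1 e2] e3]] [[d1 d2] d3]] [[[[? ?] ?] [[? ?] ?]] [[? ?] ?]].
by case=> -> -> -> -> -> -> -> -> ->.
Qed.

Lemma label_rotl a1 a2 a3 k1 k2 k3 t : label a1 a2 a3 k1 k2 k3 t -> label a2 a3 a1 k2 k3 k1 (rotl t).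
Proof.
by move: t => [[[[g1 g2] g3] [[e1 e2] e3]] [[d1 d2] d3]]; exact: label_rot.
Qed.

Definition nowhere_zero (t : V3 * V3 * V3) :=
  let: (e1, e2, e3) := t.1.2 in [/\ e1 != 0, e2 != 0 & e3 != 0].

Lemma label_nonzero_count (a1 a2 a3 : int) (k1 k2 k3 : nat) : a1 * a2 * a3 != 0 ->
  cardle (fun t => label a1 a2 a3 k1 k2 k3 t /\ nowhere_zero t)
    (24 * (label_const (`|a1 * a2 * a3|%:~R : R) * 64 ^+ (k1 + k2 + k3))).
Proof.
move=> A0.
have e2 : a2 * a3 * a1 = a1 * a2 * a3 by ring.
have e3 : a3 * a1 * a2 = a1 * a2 * a3 by ring.
have f2 : (k2 + k3 + k1 = k1 + k2 + k3)%N by lia.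
have f3 : (k3 + k1 + k2 = k1 + k2 + k3)%N by lia.
have A2 : a2 * a3 * a1 != 0 by rewrite e2.
have A3 : a3 * a1 * a2 != 0 by rewrite e3.
have h1 := @label_max_count a1 a2 a3 k1 k2 k3 A0.
have h2 := @label_max_count a2 a3 a1 k2 k3 k1 A2; rewrite e2 f2 in h2.
have h3 := @label_max_count a3 a1 a2 k3 k1 k2 A3; rewrite e3 f3 in h3.
set K := 8 * _ in h1 h2 h3.
have -> : 24 * (label_const (`|a1 * a2 * a3|%:~R : R) * 64 ^+ (k1 + k2 + k3)) = K + (K + K) by rewrite /K; ring.
have h2' : cardle (fun t => label_max a2 a3 a1 k2 k3 k1 (rotl t)) K.
  by apply: (@cardle_inj _ _ _ _ _ rotl) h2 => // x y _ _; exact: rotl_inj.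
have h3' : cardle (fun t => label_max a3 a1 a2 k3 k1 k2 (rotl (rotl t))) K.
  apply: (@cardle_inj _ _ _ _ _ (fun t => rotl (rotl t))) h3 => // x y _ _.
  by move/rotl_inj/rotl_inj.
apply: (cardle_or (Q' := fun t => label_max a2 a3 a1 k2 k3 k1 (rotl t) \/ label_max a3 a1 a2 k3 k1 k2 (rotl (rotl t))) _ h1).
  move=> t [hl hf]; have hl2 := label_rotl hl; have hl3 := label_rotl hl2.
  rewrite /label_max; move: hl hl2 hl3 hf; move: t => [[[[g1 g2] g3] [[u1 u2] u3]] [[d1 d2] d3]] hl hl2 hl3 /= [h10 h20 h30].
  set x1 := 8 ^+ k1 * `|u1|; set x2 := 8 ^+ k2 * `|u2|; set x3 := 8 ^+ k3 * `|u3|.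
  have [x13|x13] := leP x1 x3.
    have [x23|x23] := leP x2 x3; first by left; split.
    by right; right; split => //; split => //; [exact: ltW | exact: le_trans x13 (ltW x23)].
  have [x21|x21] := leP x2 x1; first by right; left; split => //; split => //; exact: ltW.
  by right; right; split => //; split => //; [exact: le_trans (ltW x13) (ltW x21) | exact: ltW].
by apply: (cardle_or _ h2' h3').
Qed.

(** Since 64^(k+1) = 2^(6 k + 6), the harmonic sum over the divisor is at most 6 k + 7. This is the
    logarithm lost on labels with a zero coordinate. *)
Lemma cardle_divisor_pairs (k : nat) :
  cardle (fun x : int * int => [/\ 0 < x.2, (x.2 %| x.1)%Z & in_level k x.1])
    (2 * 64 ^+ k.+1 * (6 * k%:R + 7) : R).
Proof.
set H : R := 64 ^+ k.+1.
have H0 : 0 <= H by rewrite exprn_ge0.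
have e : (64 ^ k.+1 = 2 ^ (6 * k.+1))%N by rewrite expnM.
have h : cardle (fun x : int * int => [/\ 0 < x.2, (x.2 %| x.1)%Z & in_level k x.1])
   (\sum_(d <- map Posz (iota 1 (2 ^ (6 * k.+1)))) (2 * (H / d%:~R))).
  apply: (@cardle_sum R _ _ _ (fun x => x.2)).
    move=> [g d] /= [d0 dg lg]; apply/mapP; exists (absz d); last by rewrite gtz0_abs.
    by have := dvdz_in_level d0 dg lg; rewrite mem_iota e; move: d0; clear; lia.
  move=> d /mapP[n]; rewrite mem_iota => /andP[n0 _] ed.
  have d0 : 0 < d by rewrite ed ltz_nat.
  have dR : 0 < d%:~R :> R by rewrite ltr0z.
  have q0 : 0 <= H / d%:~R by rewrite divr_ge0 // ltW.
  apply: (@cardle_inj _ _ _ _ _ (fun x : int * int => (x.1 %/ d)%Z)) (cardle_int_neq0 q0).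
    move=> [g d'] /= [[_ dg lg] edd]; rewrite edd in dg; have /dvdzP[q eq] := dg.
    rewrite eq (mulzK _ (lt0r_neq0 d0)); split.
      by apply: contra_neq (in_level_neq0 lg) => q00; rewrite eq q00 mul0r.
    rewrite ler_pdivlMr // -[X in _ * X](gtr0_norm dR) -intr_norm -intrM -normrM -eq.
    by have /andP[] := in_level_real R lg.
  move=> [g d1] [g' d2] [[/= _ dg _] ed1] [[/= _ dg' _] ed2] E.
  by rewrite ed1 in dg *; rewrite ed2 in dg' *; rewrite -(divzK dg) E divzK.
apply: cardle_sub h => //; rewrite big_map -mulr_sumr -mulr_sumr mulrA.
have := harmonic_pow2 R (6 * k.+1) => hh.
apply: ler_wpM2l; first by nonneg.
by apply: le_trans hh _; rewrite mulnS natrD natrM; lra.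
Qed.

(** Counts six nonzero integers of size at most b, namely g2, g3, e2, e3, d2, d3, and a pair (g1,
    d1) with d1 dividing g1. *)
Definition zero_label_bound (b : R) (k : nat) : R := (2 * b) ^+ 6 * (2 * 64 ^+ k.+1 * (6 * k%:R + 7)).

(* When e1 = 0 the class count exceeds the expected size by a logarithm, but g2 and g3 are
   bounded, so few boxes are concerned. *)
Lemma label_zero_coord_bounds (a1 a2 a3 : int) k1 k2 k3 g1 g2 g3 e2 e3 d1 d2 d3 : a1 * a2 * a3 != 0 ->
  label a1 a2 a3 k1 k2 k3 (g1, g2, g3, (0, e2, e3), (d1, d2, d3)) ->
  [/\ e2 != 0, e3 != 0, `|e2| <= `|a1 * a2 * a3| ^+ 6 /\ `|e3| <= `|a1 * a2 * a3| ^+ 6,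
   `|g2| <= `|a1 * a2 * a3| ^+ 6 & `|g3| <= `|a1 * a2 * a3| ^+ 6].
Proof.
move=> A0 [gc [l1 l2 l3] [he pe] _ _].
have [K1 a1K a2K a3K] := absz_le_mul A0 erefl.
set K := `|a1 * a2 * a3| in K1 a1K a2K a3K *.
have he0 : a2 * g2 * (e2 * e2) + a3 * g3 * (e3 * e3) = 0 by rewrite -[RHS]he; ring.
have a10 : a1 != 0 by apply: contra_neq A0 => ->; rewrite !mul0r.
have a20 : a2 != 0 by apply: contra_neq A0 => ->; rewrite mulr0 mul0r.
have a30 : a3 != 0 by apply: contra_neq A0 => ->; rewrite mulr0.
have g20 := in_level_neq0 l2; have g30 := in_level_neq0 l3.
have ne (a g e a' g' e' : int) : a' != 0 -> g' != 0 -> a * g * (e * e) + a' * g' * (e' * e') = 0 -> e = 0 -> e' = 0.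
  move=> a0 g0 + e0; rewrite e0 !mulr0 add0r => /eqP.
  by rewrite !mulf_eq0 (negPf a0) (negPf g0) /= orbb => /eqP.
have he0' : a3 * g3 * (e3 * e3) + a2 * g2 * (e2 * e2) = 0 by rewrite addrC.
have not00 : ~ (e2 = 0 /\ e3 = 0).
  by move=> [z2 z3]; have := pe 2; rewrite z2 z3 dvdz0 => /(_ isT isT isT).
have e20 : e2 != 0 by apply/eqP => z; apply: not00; split => //; exact: ne a30 g30 he0 z.
have e30 : e3 != 0 by apply/eqP => z; apply: not00; split => //; exact: ne a20 g20 he0' z.
have cop : coprimez e2 e3.
  rewrite /coprimez; have := pe (gcdz e2 e3); rewrite dvdz0 dvdz_gcdl dvdz_gcdr => /(_ isT isT isT) /dvdz1_norm.
  by rewrite ger0_norm // => ->.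
have K0 : 0 <= K by rewrite normr_ge0.
have dle (x y : int) : (x %| y)%Z -> y != 0 -> `|x| <= `|y|.
  by move=> xy y0; rewrite -!abszE lez_nat dvdn_leq // absz_gt0.
have Kmono (m n : nat) : (m <= n)%N -> K ^+ m <= K ^+ n by move=> mn; rewrite ler_weXn2l.
(* Being coprime to [e3], [e2] divides a3 g3; and its gcd with [g3] divides [a3] by [isotropic_dvd],
   as [e2] and the zero coordinate are both multiples of that gcd. *)
have de2 : (e2 %| a3 * a3)%Z.
  apply: (@dvdz_mul_gcdz _ _ g3).
    have : (e2 %| (e3 * e3) * (a3 * g3))%Z.
      rewrite (_ : _ * _ = - (a2 * g2 * e2) * e2) ?dvdz_mull //.
      by apply/eqP; rewrite -subr_eq0 -he0; apply/eqP; ring.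
    by rewrite Gauss_dvdzr // coprimezMr cop.
  have := @isotropic_dvd a3 a1 a2 g3 g1 g2 e3 0 e2 (gcdz e2 g3) 1
    (isotropic_rot (isotropic_rot he)) (gc_sq3 gc) (prim3_rot (prim3_rot pe)).
  by rewrite dvdz_gcdr mulr0 dvdz0 !mul1r dvdz_gcdl; apply.
have de3 : (e3 %| a2 * a2)%Z.
  apply: (@dvdz_mul_gcdz _ _ g2).
    have : (e3 %| (e2 * e2) * (a2 * g2))%Z.
      rewrite (_ : _ * _ = - (a3 * g3 * e3) * e3) ?dvdz_mull //.
      by apply/eqP; rewrite -subr_eq0 -he0; apply/eqP; ring.
    by rewrite Gauss_dvdzr // coprimezMr coprimez_sym cop.
  have := @isotropic_dvd a2 a3 a1 g2 g3 g1 e2 e3 0 (gcdz e3 g2) 1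
    (isotropic_rot he) (gc_sq2 gc) (prim3_rot pe).
  by rewrite dvdz_gcdr mulr0 dvdz0 !mul1r dvdz_gcdl; apply.
have be2 : `|e2| <= K ^+ 2.
  apply: le_trans (dle _ _ de2 (mulf_neq0 a30 a30)) _.
  by rewrite normrM expr2 ler_pM.
have be3 : `|e3| <= K ^+ 2.
  apply: le_trans (dle _ _ de3 (mulf_neq0 a20 a20)) _.
  by rewrite normrM expr2 ler_pM.
have bnd (x y e : int) : `|x| <= K -> `|y| <= K -> `|e| <= K ^+ 2 -> `|x * (e * e) * y| <= K ^+ 6.
  move=> hx hy h; rewrite !normrM (_ : K ^+ 6 = K * (K ^+ 2 * K ^+ 2) * K); last by ring.
  by rewrite !ler_pM // ?mulr_ge0.
split => //.
- by split; apply: le_trans (Kmono 2%N 6%N isT).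
- have : (g2 %| a3 * (e3 * e3) * a1)%Z.
    apply: (dvdz_mul_gcdz _ (gc_23 gc)).
    rewrite (_ : _ * _ = - (a2 * (e2 * e2)) * g2) ?dvdz_mull //.
    by apply/eqP; rewrite -subr_eq0 -he0; apply/eqP; ring.
  move/dle; rewrite !mulf_neq0 // => /(_ isT) h; apply: le_trans h _.
  exact: bnd.
- have : (g3 %| a2 * (e2 * e2) * a1)%Z.
    apply: (@dvdz_mul_gcdz _ _ g2); last by rewrite gcdzC; exact: gc_23 gc.
    rewrite (_ : _ * _ = - (a3 * (e3 * e3)) * g3) ?dvdz_mull //.
    by apply/eqP; rewrite -subr_eq0 -he0; apply/eqP; ring.
  move/dle; rewrite !mulf_neq0 // => /(_ isT) h; apply: le_trans h _.
  exact: bnd.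
Qed.

Lemma in_level_small k (x : int) (M : nat) : in_level k x -> `|x| <= M%:Z -> (k <= M)%N.
Proof.
move=> /andP[h _] hM; have := le_trans h hM; rewrite -(natrX _ 64) natz lez_nat.
by apply: leq_trans; apply/ltnW/ltn_expl.
Qed.

Definition abs6 (a1 a2 a3 : int) : nat := (absz (a1 * a2 * a3)%R ^ 6)%N.

Lemma label_zero_coord_count (a1 a2 a3 : int) (k1 k2 k3 : nat) : a1 * a2 * a3 != 0 ->
  cardle (fun t => label a1 a2 a3 k1 k2 k3 t /\ t.1.2.1.1 = 0)
    (if (k2 <= abs6 a1 a2 a3)%N && (k3 <= abs6 a1 a2 a3)%N
     then zero_label_bound (`|a1 * a2 * a3|%:~R ^+ 6) k1 else 0).
Proof.
move=> A0; set M := abs6 a1 a2 a3.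
have MZ : `|a1 * a2 * a3| ^+ 6 = M%:Z by rewrite /M /abs6 -[RHS]natz natrX natz abszE.
case: ifP => [_|/negP nk]; last first.
  move=> [|[[[[g1 g2] g3] [[e1 e2] e3]] [[d1 d2] d3]] s] // us /(_ _ (mem_head _ _)) [hl /= e10].
  case: nk; rewrite e10 in hl; have [_ _ _ h2 h3] := label_zero_coord_bounds A0 hl.
  case: hl => _ [l1 l2 l3] _ _ _; rewrite MZ in h2 h3.
  by rewrite (in_level_small l2 h2) (in_level_small l3 h3).
set b : R := _ ^+ 6.
have b0 : 0 <= b by rewrite exprn_ge0 // ler0z.
have iz := cardle_int_neq0 b0.
have pz := @cardle_divisor_pairs k1.
have e6 : zero_label_bound b k1 = 2 * b * (2 * b) * (2 * b * (2 * b)) * (2 * b * (2 * b)) * (2 * 64 ^+ k1.+1 * (6 * k1%:R + 7)).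
  by rewrite /zero_label_bound; ring.
rewrite e6.
apply: (@cardle_inj _ _ _ _ _ (fun t : V3 * V3 * V3 =>
   ((t.1.1.1.2, t.1.1.2), (t.1.2.1.2, t.1.2.2), (t.2.1.2, t.2.2), (t.1.1.1.1, t.2.1.1))))
   (cardle_prod (cardle_prod (cardle_prod (cardle_prod iz iz) (cardle_prod iz iz)) (cardle_prod iz iz)) pz).
  move=> [[[[g1 g2] g3] [[e1 e2] e3]] [[d1 d2] d3]] [hl /= e10]; rewrite e10 in hl.
  have [e20 e30 [be2 be3] bg2 bg3] := label_zero_coord_bounds A0 hl.
  case: hl => _ [l1 l2 l3] _ [[d10 d20 d30] [q1 q2 q3]] _.
  have toR (x : int) : `|x| <= `|a1 * a2 * a3| ^+ 6 -> `|x|%:~R <= b.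
    by rewrite -(ler_int R) rmorphXn.
  have dle (x y : int) : (x %| y)%Z -> y != 0 -> `|x| <= `|y|.
    by move=> xy y0; rewrite -!abszE lez_nat dvdn_leq // absz_gt0.
  have g20 := in_level_neq0 l2; have g30 := in_level_neq0 l3.
  by do !split => //; rewrite ?gt_eqF //; apply: toR => //;
     [exact: le_trans (dle _ _ q2 g20) bg2 | exact: le_trans (dle _ _ q3 g30) bg3].
move=> [[[[g1 g2] g3] [[e1 e2] e3]] [[d1 d2] d3]] [[[[f1 f2] f3] [[h1 h2] h3]] [[c1 c2] c3]].
by move=> [_ /= ->] [_ /= ->] [-> -> -> -> -> -> -> ->].
Qed.

End Class9.

(** * The two counts combined *)

Section ClassBox10.
Variable R : realType.

Definition zero_label_term (a1 a2 a3 : int) (k1 k2 k3 : nat) : R :=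
  if (k2 <= abs6 a1 a2 a3)%N && (k3 <= abs6 a1 a2 a3)%N
  then zero_label_bound (`|a1 * a2 * a3|%:~R ^+ 6) k1 else 0.

Definition label_total (a1 a2 a3 : int) (k1 k2 k3 : nat) : R :=
  24 * (label_const (`|a1 * a2 * a3|%:~R : R) * 64 ^+ (k1 + k2 + k3)) +
  (zero_label_term a1 a2 a3 k1 k2 k3 + (zero_label_term a2 a3 a1 k2 k3 k1 + zero_label_term a3 a1 a2 k3 k1 k2)).

Lemma label_count (a1 a2 a3 : int) (k1 k2 k3 : nat) : a1 * a2 * a3 != 0 ->
  cardle (label a1 a2 a3 k1 k2 k3) (label_total a1 a2 a3 k1 k2 k3).
Proof.
move=> A0.
have A2 : a2 * a3 * a1 != 0 by rewrite (_ : _ * _ = a1 * a2 * a3) //; ring.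
have A3 : a3 * a1 * a2 != 0 by rewrite (_ : _ * _ = a1 * a2 * a3) //; ring.
have h0 := @label_nonzero_count R a1 a2 a3 k1 k2 k3 A0.
have h1 := @label_zero_coord_count R a1 a2 a3 k1 k2 k3 A0.
have h2 := @label_zero_coord_count R a2 a3 a1 k2 k3 k1 A2.
have h3 := @label_zero_coord_count R a3 a1 a2 k3 k1 k2 A3.
have h2' : cardle (fun t => label a2 a3 a1 k2 k3 k1 (rotl t) /\ (rotl t).1.2.1.1 = 0) (zero_label_term a2 a3 a1 k2 k3 k1).
  by apply: (@cardle_inj _ _ _ _ _ rotl) h2 => // x y _ _; exact: rotl_inj.
have h3' : cardle (fun t => label a3 a1 a2 k3 k1 k2 (rotl (rotl t)) /\ (rotl (rotl t)).1.2.1.1 = 0)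
    (zero_label_term a3 a1 a2 k3 k1 k2).
  apply: (@cardle_inj _ _ _ _ _ (fun t => rotl (rotl t))) h3 => // x y _ _.
  by move/rotl_inj/rotl_inj.
apply: (cardle_or _ h0 (cardle_or _ h1 (cardle_or _ h2' h3'))).
- move=> t hl.
  have hl2 := label_rotl hl; have hl3 := label_rotl hl2.
  have : nowhere_zero t \/ [\/ t.1.2.1.1 = 0, (rotl t).1.2.1.1 = 0 | (rotl (rotl t)).1.2.1.1 = 0].
    clear; move: t => [[[[g1 g2] g3] [[e1 e2] e3]] [[d1 d2] d3]]; rewrite /nowhere_zero /=.
    have [->|h1] := eqVneq e1 0; first by right; apply: Or31.
    have [->|h2] := eqVneq e2 0; first by right; apply: Or32.
    have [->|h3] := eqVneq e3 0; first by right; apply: Or33.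
    by left.
  case=> [hf|hz]; first by left.
  right; instantiate (1 := fun t => (label a1 a2 a3 k1 k2 k3 t /\ t.1.2.1.1 = 0) \/
    ((label a2 a3 a1 k2 k3 k1 (rotl t) /\ (rotl t).1.2.1.1 = 0) \/
     (label a3 a1 a2 k3 k1 k2 (rotl (rotl t)) /\ (rotl (rotl t)).1.2.1.1 = 0))).
  by case: hz => h; [left|right; left|right; right].
- move=> t [h|h]; [by left|right].
  instantiate (1 := fun t => (label a2 a3 a1 k2 k3 k1 (rotl t) /\ (rotl t).1.2.1.1 = 0) \/
     (label a3 a1 a2 k3 k1 k2 (rotl (rotl t)) /\ (rotl (rotl t)).1.2.1.1 = 0)).
  exact: h.
- by [].
Qed.

Definition label_of (l : V3 * V3 * V3) (z : V3) : Prop :=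
  let: (g1, g2, g3, (e1, e2, e3), (d1, d2, d3)) := l in
  let: (z1, z2, z3) := z in
  [/\ gcdz g1 (e2 * z3 - e3 * z2) * d1 = `|g1|, gcdz g2 (e3 * z1 - e1 * z3) * d2 = `|g2| &
        gcdz g3 (e1 * z2 - e2 * z1) * d3 = `|g3|].

(** Every point is assigned one of its labels by choice, with a dummy value outside the box. Since
    the d_i are nonzero, points with the same label have the same three gcds with e, hence lie in
    one class, and [class_fiber] bounds their number. *)
Lemma class_box (a1 a2 a3 : int) (k1 k2 k3 p q : nat) : a1 * a2 * a3 != 0 ->
  cardle (conic_box a1 a2 a3 k1 k2 k3 p q)
    (label_total a1 a2 a3 k1 k2 k3 *
     (1 + `|a1 * a2 * a3|%:~R ^+ 3 * 8 ^+ (q + 4) / 8 ^+ (k1 + k2 + k3))).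
Proof.
move=> A0.
have ex (t : V3 * V3) : exists l : V3 * V3 * V3, conic_box a1 a2 a3 k1 k2 k3 p q t ->
    [/\ label a1 a2 a3 k1 k2 k3 l, l.1.1 = t.1 & label_of l t.2].
  have [hb|nb] := pselect (conic_box a1 a2 a3 k1 k2 k3 p q t); last by exists ((0,0,0),(0,0,0),(0,0,0)).
  move: t hb => [[[g1 g2] g3] [[z1 z2] z3]] hb.
  have [e1 [e2 [e3 [d1 [d2 [d3 [hl hr]]]]]]] := label_exists A0 hb.
  by exists ((g1, g2, g3), (e1, e2, e3), (d1, d2, d3)).
have [f hf] := choice ex.
have B0 : 0 <= `|a1 * a2 * a3|%:~R :> R by rewrite ler0z.
apply: (@cardle_fiber _ _ _ _ (label a1 a2 a3 k1 k2 k3) f) (@label_count a1 a2 a3 k1 k2 k3 A0) _.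
- by move=> t /hf [].
- by nonneg.
move=> [[[[g1 g2] g3] [[e1 e2] e3]] [[d1 d2] d3]] hl.
pose l : V3 * V3 * V3 := ((g1, g2, g3), (e1, e2, e3), (d1, d2, d3)).
have cf := @class_fiber R a1 a2 a3 g1 g2 g3 k1 k2 k3 p q
  (fun z => conic_box a1 a2 a3 k1 k2 k3 p q (g1, g2, g3, z) /\ label_of l z) A0.
apply: (@cardle_inj _ _ _ _ _ (fun t : V3 * V3 => t.2)) (cf _ _).
- move=> [g z] [hb hl']; have [_ /=] := hf _ hb; rewrite hl' /= => eg hr.
  by split => //; move: hb; rewrite -eg.
- move=> [g z] [g' z'] [hb hl1] [hb' hl1'] /= ez.
  have [_ /= eg _] := hf _ hb; have [_ /= eg' _] := hf _ hb'.
  by rewrite -eg -eg' hl1 hl1' ez.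
- by move=> z [].
move=> [[z1 z2] z3] [[y1 y2] y3] [[slz _ _ _ _] [r1 r2 r3]] [[sly _ _ _ _] [s1 s2 s3]] /=.
case: hl => _ _ [he pe] [[d10 d20 d30] _] _.
apply: (same_class_dvd slz sly he pe).
- by apply: (mulIf (lt0r_neq0 d10)); rewrite r1 s1.
- by apply: (mulIf (lt0r_neq0 d20)); rewrite r2 s2.
- by apply: (mulIf (lt0r_neq0 d30)); rewrite r3 s3.
Qed.

(** The number of ways for a label of the box to have a zero coordinate: such a label forces the
    other two levels to be at most M. *)
Definition small_pairs (M k1 k2 k3 : nat) : nat :=
  (((k2 <= M) && (k3 <= M)) + ((k3 <= M) && (k1 <= M)) + ((k1 <= M) && (k2 <= M)))%N.

Lemma label_total_le (a1 a2 a3 : int) : exists2 C : R, 0 < C &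
  forall k1 k2 k3 L : nat, (k1 < L)%N -> (k2 < L)%N -> (k3 < L)%N ->
  label_total a1 a2 a3 k1 k2 k3 <= C * 64 ^+ (k1 + k2 + k3) * (1 + (L * small_pairs (abs6 a1 a2 a3) k1 k2 k3)%:R).
Proof.
set b : R := `|a1 * a2 * a3|%:~R.
have b0 : 0 <= b by rewrite ler0z.
(* 896 = 128 * 7: the factor 128 is 2 * 64, and 6 j + 7 <= 7 L for every level j < L. *)
pose Z : R := (2 * b ^+ 6) ^+ 6 * 896.
have Z0 : 0 <= Z by rewrite /Z; nonneg.
have C0 : 0 <= label_const b by rewrite /label_const /label_radius; nonneg.
exists (24 * label_const b + Z + 1); first by rewrite ltr_wpDl //; nonneg.
move=> k1 k2 k3 L h1 h2 h3; set M := abs6 a1 a2 a3.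
have zt (c1 c2 c3 : int) (j1 j2 j3 : nat) : (j1 < L)%N -> (j1 <= k1 + k2 + k3)%N ->
    c1 * c2 * c3 = a1 * a2 * a3 ->
    zero_label_term c1 c2 c3 j1 j2 j3 <= Z * 64 ^+ (k1 + k2 + k3) * (L * ((j2 <= M)%N && (j3 <= M)%N))%:R.
  move=> jL js e; rewrite /zero_label_term /abs6 e -/(abs6 a1 a2 a3) -/M -/b.
  case: ifP => _; last by rewrite muln0 mulr0.
  rewrite muln1 /zero_label_bound [64 ^+ j1.+1]exprS.
  have -> : (2 * b ^+ 6) ^+ 6 * (2 * (64 * 64 ^+ j1) * (6 * j1%:R + 7)) =
     (2 * b ^+ 6) ^+ 6 * 128 * (64 ^+ j1 * (6 * j1%:R + 7)) by ring.
  have -> : Z * 64 ^+ (k1 + k2 + k3) * L%:R = (2 * b ^+ 6) ^+ 6 * 128 * (64 ^+ (k1 + k2 + k3) * (7 * L%:R)).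
    by rewrite /Z; ring.
  apply: ler_wpM2l; first by nonneg.
  apply: ler_pM; [by nonneg|by nonneg| |].
    by rewrite ler_weXn2l // ler1n.
  by move: jL; rewrite -(ler_nat R) -natr1; move: (j1%:R : R) (ler0n R j1) (L%:R : R) => *; lra.
have e2 : a2 * a3 * a1 = a1 * a2 * a3 by ring.
have e3 : a3 * a1 * a2 = a1 * a2 * a3 by ring.
rewrite /label_total -/b.
have t1 := zt a1 a2 a3 k1 k2 k3 h1 ltac:(lia) erefl.
have t2 := zt a2 a3 a1 k2 k3 k1 h2 ltac:(lia) e2.
have t3 := zt a3 a1 a2 k3 k1 k2 h3 ltac:(lia) e3.
apply: le_trans (lerD (lexx _) (lerD t1 (lerD t2 t3))) _.
set S : R := 64 ^+ (k1 + k2 + k3).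
have S0 : 0 <= S by rewrite exprn_ge0.
have -> : Z * S * (L * ((k2 <= M)%N && (k3 <= M)%N))%:R + (Z * S * (L * ((k3 <= M)%N && (k1 <= M)%N))%:R +
  Z * S * (L * ((k1 <= M)%N && (k2 <= M)%N))%:R) = Z * S * (L * small_pairs M k1 k2 k3)%:R.
  by rewrite /small_pairs !mulnDr !natrD; ring.
set e : R := (L * small_pairs M k1 k2 k3)%:R.
have eps0 : 0 <= e by rewrite ler0n.
have -> : (24 * label_const b + Z + 1) * S * (1 + e) = (24 * (label_const b * S) + Z * S * e) +
  ((24 * label_const b + 1) * S * e + (Z + 1) * S) by ring.
by rewrite lerDl; nonneg.
Qed.

(* The plane count is efficient when 2^(q + 2 p) <= 8^(k1 + k2 + k3), the class count otherwise. *)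
Lemma box_count (a1 a2 a3 : int) : a1 * a2 * a3 != 0 -> exists2 C : R, 0 < C &
  forall k1 k2 k3 p q L : nat, (k1 < L)%N -> (k2 < L)%N -> (k3 < L)%N -> (q <= p)%N ->
  cardle (conic_box a1 a2 a3 k1 k2 k3 p q)
   (C * (1 + (L * small_pairs (abs6 a1 a2 a3) k1 k2 k3)%:R) * (8 ^+ (k1 + k2 + k3) * 4 ^+ p * 2 ^+ q)).
Proof.
move=> A0; have [C C0 hC] := label_total_le a1 a2 a3.
set b : R := `|a1 * a2 * a3|%:~R.
have b0 : 0 <= b by rewrite ler0z.
pose c1 : R := 1024 * (1 + 128 * b * 64 ^+ 3).
pose c2 : R := C * (1 + b ^+ 3 * 8 ^+ 4).
have c10 : 0 <= c1 by rewrite /c1; nonneg.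
have c20 : 0 <= c2 by rewrite /c2; nonneg.
exists (c1 + c2 + 1); first by rewrite ltr_wpDl // addr_ge0.
move=> k1 k2 k3 p q L h1 h2 h3 qp.
have plane := @plane_box R a1 a2 a3 k1 k2 k3 p q A0.
have cls := @class_box a1 a2 a3 k1 k2 k3 p q A0.
have hN := hC k1 k2 k3 L h1 h2 h3.
set e : R := (L * _)%:R in hN *.
have eps0 : 0 <= e by rewrite ler0n.
have [X eX] : exists x : R, x = 8 ^+ (k1 + k2 + k3) by eexists.
have [P eP] : exists x : R, x = 2 ^+ p by eexists.
have [Q eQ] : exists x : R, x = 2 ^+ q by eexists.
have X0 : 0 < X by rewrite eX exprn_gt0.
have P0 : 0 < P by rewrite eP exprn_gt0.
have Q0 : 0 < Q by rewrite eQ exprn_gt0.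
have p8 n (y : R) : y = 2 ^+ n -> 8 ^+ n = y ^+ 3.
  by move=> ->; rewrite -exprM mulnC exprM; congr (_ ^+ _); ring.
have p4 : 4 ^+ p = P ^+ 2 by rewrite eP -exprM mulnC exprM; congr (_ ^+ _); ring.
have p64 : 64 ^+ p = P ^+ 6 by rewrite eP -exprM mulnC exprM; congr (_ ^+ _); ring.
have QP : Q <= P by rewrite eQ eP ler_weXn2l // ler1n.
rewrite -eX p4 -eQ.
have T0 : 0 <= X * P ^+ 2 * Q by nonneg.
have [le|gt] := leP (Q * P ^+ 2) X.
  apply: cardle_sub plane => //; rewrite -/b.
  have -> : 8 ^+ q.+1 / 8 ^+ k1 * (8 ^+ p.+1 / 8 ^+ k2) * (8 ^+ p.+1 / 8 ^+ k3) *
    (2 * (1 + 128 * b * 64 ^+ k1.+1 * 64 ^+ k2.+1 * 64 ^+ k3.+1 / 64 ^+ p)) =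
    1024 * (Q ^+ 3 * P ^+ 6 / X + 128 * b * 64 ^+ 3 * (Q ^+ 3 * X)).
    have k8 (k : nat) : 8 ^+ k != 0 :> R by rewrite gt_eqF // exprn_gt0.
    have -> : X = 8 ^+ k1 * 8 ^+ k2 * 8 ^+ k3 by rewrite eX !exprD.
    rewrite p64 !exprS !exp64 (p8 _ _ eP) (p8 _ _ eQ).
    by field; rewrite !k8 gt_eqF.
  have l1 : Q ^+ 3 * P ^+ 6 / X <= X * P ^+ 2 * Q.
    rewrite ler_pdivrMr //.
    have -> : Q ^+ 3 * P ^+ 6 = (Q * P ^+ 2) * ((Q * P ^+ 2) * (Q * P ^+ 2)) by ring.
    have -> : X * P ^+ 2 * Q * X = (Q * P ^+ 2) * (X * X) by ring.
    by apply: ler_wpM2l; [nonneg | apply: ler_pM => //; nonneg].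
  have l2 : Q ^+ 3 * X <= X * P ^+ 2 * Q.
    have -> : Q ^+ 3 * X = X * Q * (Q * Q) by ring.
    have -> : X * P ^+ 2 * Q = X * Q * (P * P) by ring.
    by apply: ler_wpM2l; [nonneg | apply: ler_pM => //; nonneg].
  apply: (@le_trans _ _ (c1 * (X * P ^+ 2 * Q))).
    have -> : c1 * (X * P ^+ 2 * Q) = 1024 * (X * P ^+ 2 * Q + 128 * b * 64 ^+ 3 * (X * P ^+ 2 * Q)).
      by rewrite /c1; ring.
    apply: ler_wpM2l; first exact: ler0n.
    by apply: lerD; [exact: l1 | apply: ler_wpM2l; [nonneg | exact: l2]].
  apply: ler_wpM2r => //.
  have -> : (c1 + c2 + 1) * (1 + e) = c1 + (c2 + 1 + (c1 + c2 + 1) * e) by ring.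
  by rewrite lerDl; nonneg.
apply: cardle_sub cls => //; rewrite -/b -eX.
have M0 : 0 <= 1 + b ^+ 3 * 8 ^+ (q + 4) / X by nonneg.
apply: le_trans (ler_wpM2r M0 hN) _.
have -> : 64 ^+ (k1 + k2 + k3) = X * X :> R by rewrite exp64 -eX.
have -> : C * (X * X) * (1 + e) * (1 + b ^+ 3 * 8 ^+ (q + 4) / X) =
   C * (1 + e) * (X * X + b ^+ 3 * 8 ^+ 4 * (Q ^+ 3 * X)).
  by rewrite exprD (p8 _ _ eQ); field; rewrite gt_eqF.
have l1 : X * X <= X * P ^+ 2 * Q.
  by rewrite -mulrA; apply: ler_wpM2l; [nonneg | rewrite mulrC ltW].
have l2 : Q ^+ 3 * X <= X * P ^+ 2 * Q.
  have -> : Q ^+ 3 * X = X * Q * (Q * Q) by ring.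
  have -> : X * P ^+ 2 * Q = X * Q * (P * P) by ring.
  by apply: ler_wpM2l; [nonneg | apply: ler_pM => //; nonneg].
apply: (@le_trans _ _ (C * (1 + e) * ((1 + b ^+ 3 * 8 ^+ 4) * (X * P ^+ 2 * Q)))).
  apply: ler_wpM2l; first by nonneg.
  by rewrite mulrDl mul1r; apply: lerD; [exact: l1 | apply: ler_wpM2l; [nonneg | exact: l2]].
have -> : C * (1 + e) * ((1 + b ^+ 3 * 8 ^+ 4) * (X * P ^+ 2 * Q)) = c2 * (1 + e) * (X * P ^+ 2 * Q).
  by rewrite /c2; ring.
apply: ler_wpM2r => //; apply: ler_wpM2r; first by nonneg.
by rewrite -addrA addrCA lerDl addr_ge0.
Qed.

End ClassBox10.

(** * From curve points to conics *)

Definition sorted_point (f1 f2 f3 : int) (t : nat * int * int) : Prop :=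
  let: (n, x, y) := t in
  [/\ (0 < n)%N, y != 0, y * y = (x - f1 * n%:Z) * (x - f2 * n%:Z) * (x - f3 * n%:Z) &
      `|x - f1 * n%:Z| <= `|x - f2 * n%:Z| <= `|x - f3 * n%:Z|].

(* By the primitivity in conic_sol, k is the gcd of the three x - f_i n. *)
Definition conic_dec (f1 f2 f3 : int) (t : nat * int * int) (c : V3 * V3 * (int * int)) : Prop :=
  let: (n, x, y) := t in
  let: (g1, g2, g3, (z1, z2, z3), (k, m)) := c in
  [/\ conic_sol (f2 - f3) (f3 - f1) (f1 - f2) g1 g2 g3 z1 z2 z3, 0 < k, 0 < m,
     m * m = k * (g1 * g2 * g3) &
     [/\ x - f1 * n%:Z = k * (g1 * (z1 * z1)), x - f2 * n%:Z = k * (g2 * (z2 * z2)) &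
         x - f3 * n%:Z = k * (g3 * (z3 * z3))]].

Lemma dvdz_sqr (a b : int) : (a * a %| b * b)%Z -> (a %| b)%Z.
Proof. by rewrite !dvdzE !abszM !mulnn dvdn_pexp2r. Qed.

(** By the equation y^2 is k g1 g2 g3 times the square of w = k z1 z2 z3, so w divides y, and m is
    |y / w|. *)
Lemma conic_dec_exists (f1 f2 f3 : int) t : sorted_point f1 f2 f3 t -> exists c, conic_dec f1 f2 f3 t c.
Proof.
move: t => [[n x] y] [n0 y0 E _].
set X1 := x - f1 * n%:Z in E *; set X2 := x - f2 * n%:Z in E *; set X3 := x - f3 * n%:Z in E *.
have X0 : X1 * X2 * X3 != 0 by rewrite -E mulf_neq0.
have X10 : X1 != 0 by apply: contra_neq X0 => ->; rewrite !mul0r.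
have X20 : X2 != 0 by apply: contra_neq X0 => ->; rewrite mulr0 mul0r.
have X30 : X3 != 0 by apply: contra_neq X0 => ->; rewrite mulr0.
pose k := gcdz X1 (gcdz X2 X3).
have k1 : (k %| X1)%Z by rewrite dvdz_gcdl.
have k2 : (k %| X2)%Z by exact: dvdz_trans (dvdz_gcdr _ _) (dvdz_gcdl _ _).
have k3 : (k %| X3)%Z by exact: dvdz_trans (dvdz_gcdr _ _) (dvdz_gcdr _ _).
have k0 : k != 0 by apply: contra_neq X10 => k0; move: k1; rewrite k0 dvd0z => /eqP.
have kp : 0 < k by rewrite lt_neqAle eq_sym k0.
have [p1 E1] := dvdzP k1; have [p2 E2] := dvdzP k2; have [p3 E3] := dvdzP k3.
have pp : prim3 p1 p2 p3.
  move=> d d1 d2 d3.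
  have h1 : (d * k %| X1)%Z by rewrite E1 dvdz_mul.
  have h2 : (d * k %| X2)%Z by rewrite E2 dvdz_mul.
  have h3 : (d * k %| X3)%Z by rewrite E3 dvdz_mul.
  have : (d * k %| gcdz X1 (gcdz X2 X3))%Z by rewrite !dvdz_gcd h1 h2 h3.
  by rewrite -/k -[X in (_ %| X)%Z]mul1r dvdz_mul2r.
have p10 : p1 != 0 by apply: contra_neq X10 => h; rewrite E1 h mul0r.
have p20 : p2 != 0 by apply: contra_neq X20 => h; rewrite E2 h mul0r.
have p30 : p3 != 0 by apply: contra_neq X30 => h; rewrite E3 h mul0r.
have [g1 [z1 [e1 z10 s1]]] := sqfree_decomposition p10.
have [g2 [z2 [e2 z20 s2]]] := sqfree_decomposition p20.
have [g3 [z3 [e3 z30 s3]]] := sqfree_decomposition p30.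
pose w := k * (z1 * z2 * z3).
have w0 : w != 0 by rewrite !mulf_neq0 // gt_eqF.
have Ew : y * y = k * (g1 * g2 * g3) * (w * w).
  by rewrite E E1 E2 E3 e1 e2 e3 /w; ring.
have /dvdzP[m em] : (w %| y)%Z by apply: dvdz_sqr; rewrite Ew dvdz_mull.
have m0 : m != 0 by apply: contra_neq y0 => h; rewrite em h mul0r.
exists ((g1, g2, g3), (z1, z2, z3), (k, `|m|)); split => //.
- split => //; last by rewrite -e1 -e2 -e3.
  apply: (mulIf k0); rewrite mul0r.
  have -> : ((f2 - f3) * g1 * (z1 * z1) + (f3 - f1) * g2 * (z2 * z2) + (f1 - f2) * g3 * (z3 * z3)) * k =
    (f2 - f3) * (g1 * (z1 * z1) * k) + (f3 - f1) * (g2 * (z2 * z2) * k) + (f1 - f2) * (g3 * (z3 * z3) * k).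
    by ring.
  by rewrite -e1 -e2 -e3 -E1 -E2 -E3 /X1 /X2 /X3; ring.
- by rewrite normr_gt0.
- rewrite -normrM ger0_norm -?expr2 ?sqr_ge0 // expr2.
  apply: (mulIf (mulf_neq0 w0 w0)); rewrite -Ew em; ring.
- by split; [rewrite -e1 [RHS]mulrC|rewrite -e2 [RHS]mulrC|rewrite -e3 [RHS]mulrC].
Qed.

Lemma conic_dec_dvd (f1 f2 f3 : int) t g1 g2 g3 z k m :
  conic_dec f1 f2 f3 t ((g1, g2, g3), z, (k, m)) ->
  (g1 * g2 * g3 %| m * ((f2 - f3) * (f3 - f1) * (f1 - f2)))%Z.
Proof.
move: t z => [[n x] y] [[z1 z2] z3] [sl k0 m0 E _].
have gd g : sqfree g -> (g %| g1 * g2 * g3)%Z -> (g %| m)%Z.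
  by move=> sg h; apply: sqfree_dvd_sqr => //; rewrite E dvdz_mull.
apply: dvdz_prod3 (sol_gcdg12 sl) (sol_gcdg13 sl) (sol_gcdg23 sl) _ _ _.
- by apply: gd; [exact: sol_sq1 sl | rewrite -mulrA dvdz_mulr].
- by apply: gd; [exact: sol_sq2 sl | rewrite mulrAC dvdz_mull].
- by apply: gd; [exact: sol_sq3 sl | rewrite dvdz_mull].
Qed.

Section Fiber11.
Variable R : realType.

Lemma cardle_bool : cardle (fun b : bool => True) (2 : R).
Proof.
move=> s us _; rewrite (ler_nat R _ 2); apply: (@uniq_leq_size _ s [:: true; false]) => //.
by case.
Qed.

(** With G = g1 g2 g3, [conic_dec_dvd] allows to write m |A| = s G, and m^2 = k G becomes s^2 G =
    |A|^2 k, whence s <= N. The integer s determines m and then k, n and x; the factor 2 is the sign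
    of y. *)
Lemma conic_dec_fiber (f1 f2 f3 : int) (g z : V3) (N : R)
    (P : nat * int * int -> Prop) (c : nat * int * int -> V3 * V3 * (int * int)) :
  f1 != f2 -> f2 != f3 -> f1 != f3 -> 0 <= N ->
  (forall t, P t -> sorted_point f1 f2 f3 t /\ conic_dec f1 f2 f3 t (c t)) ->
  (forall t, P t -> (`|(f2 - f3) * (f3 - f1) * (f1 - f2)| ^+ 2)%:~R * (c t).2.1%:~R
      <= N ^+ 2 * (g.1.1 * g.1.2 * g.2)%:~R) ->
  cardle (fun t => P t /\ (c t).1 = (g, z)) (N * 2).
Proof.
move=> h12 h23 h13 N0 hP hN; set A := (f2 - f3) * (f3 - f1) * (f1 - f2) in hN.
have A0 : A != 0 by rewrite !mulf_neq0 // subr_eq0 // eq_sym.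
move: g z hN => [[g1 g2] g3] [[z1 z2] z3] hN /=.
pose G := g1 * g2 * g3.
have facts t : P t -> (c t).1 = ((g1, g2, g3), (z1, z2, z3)) ->
   exists k m s : int, [/\ c t = ((g1, g2, g3), (z1, z2, z3), (k, m)), 0 < G, 0 < s,
      s * G = m * `|A| & (s%:~R : R) <= N].
  move=> Pt ec; have [hpt hd] := hP t Pt; have hNt := hN t Pt.
  case: (c t) ec hd hNt => [gz [k m]] /= -> hd hNt.
  have dv := conic_dec_dvd hd; rewrite -/A in dv.
  move: t Pt hpt hd hNt => [[n x] y] Pt _ [sl k0 m0 E _] hNt.
  have G0 : 0 < G by rewrite -(pmulr_rgt0 _ k0) -E mulr_gt0.
  have /dvdzP[s0 es] : (G %| m * `|A|)%Z.
    by case: (lerP 0 A) => h; [rewrite ger0_norm | rewrite ltr0_norm // mulrN rpredN].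
  have s00 : 0 < s0.
    by rewrite -(pmulr_lgt0 _ G0) -es mulr_gt0 // normr_gt0.
  exists k, m, s0; split => //.
  rewrite -(@ler_pXn2r _ 2) // ?nnegrE ?ler0z ?(ltW s00) //.
  have GR : 0 < G%:~R :> R by rewrite ltr0z.
  rewrite -(ler_pM2r GR); apply: le_trans hNt.
  have -> : s0%:~R ^+ 2 * G%:~R = (`|A| ^+ 2 * k)%:~R :> R.
    have e : s0 ^+ 2 * G = `|A| ^+ 2 * k.
      apply: (mulIf (lt0r_neq0 G0)).
      have -> : s0 ^+ 2 * G * G = (s0 * G) ^+ 2 by ring.
      rewrite -es; have -> : (m * `|A|) ^+ 2 = `|A| ^+ 2 * (m * m) by ring.
      by rewrite E /G; ring.
    by rewrite -e intrM rmorphXn.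
  by rewrite intrM.
have sel t : exists s : int, P t /\ (c t).1 = ((g1, g2, g3), (z1, z2, z3)) ->
    [/\ 0 < G, 0 < s, s * G = (c t).2.2 * `|A| & (s%:~R : R) <= N].
  have [[Pt ec]|h] := pselect (P t /\ (c t).1 = ((g1, g2, g3), (z1, z2, z3))); last by exists 0.
  by have [k [m [s [e h1 h2 h3 h4]]]] := facts t Pt ec; exists s => _; rewrite e.
have [S hS] := choice sel.
have hcp := cardle_prod (cardle_int_pos N0) cardle_bool.
apply: (@cardle_inj _ _ _ _ _ (fun t => (S t, 0 < t.2))) hcp.
  by move=> t /hS [h1 h2 h3 h4].
move=> t t' Ht Ht' [eS ey].
have [G0 _ e1 _] := hS t Ht; have [_ _ e2 _] := hS t' Ht'.
case: Ht => Pt ec; case: Ht' => Pt' ec'.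
have [hpt hd] := hP t Pt; have [hpt' hd'] := hP t' Pt'.
have em : (c t).2.2 = (c t').2.2.
  by apply: (mulIf (_ : `|A| != 0)); rewrite ?normr_eq0 // -e1 -e2 eS.
case: (c t) ec em hd {e1 e2} => [gz [k m]] /= -> em hd.
case: (c t') ec' em hd' => [gz' [k' m']] /= -> em hd'.
move: t t' {Pt Pt' eS} hpt hpt' ey hd hd' => [[n x] y] [[n' x'] y'] [n0 y0 E _] [n0' y0' E' _] /= ey.
move=> [_ k0 m0 Em [X1 X2 X3]] [_ k0' m0' Em' [X1' X2' X3']].
have ek : k = k'.
  by apply: (mulIf (lt0r_neq0 G0)); rewrite -[k * _]Em -[k' * _]Em' em.
rewrite -ek in X1' X2' X3'.
have en : n%:Z = n'%:Z.
  have d0 : f1 - f2 != 0 by rewrite subr_eq0.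
  apply: (mulfI d0).
  have -> : (f1 - f2) * n%:Z = (x - f2 * n%:Z) - (x - f1 * n%:Z) by ring.
  have -> : (f1 - f2) * n'%:Z = (x' - f2 * n'%:Z) - (x' - f1 * n'%:Z) by ring.
  by rewrite X1 X2 X1' X2'.
have ex : x = x'.
  have : x - f1 * n%:Z = x' - f1 * n'%:Z by rewrite X1 X1'.
  by rewrite en => /addIr.
have yy : y * y = y' * y' by rewrite E E' ex en.
have ey2 : y = y'.
  move: yy ey y0 y0'; clear => yy ey y0 y0'.
  have : (y - y') * (y + y') = 0.
    by rewrite (_ : _ * _ = y * y - y' * y'); [rewrite yy subrr | ring].
  move/eqP; rewrite mulf_eq0 => /orP[|]; first by rewrite subr_eq0 => /eqP.
  rewrite addr_eq0 => /eqP e; move: ey; rewrite e oppr_gt0.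
  by move: y0' e; case: (ltrgt0P y').
by congr (_, _, _) => //; case: en.
Qed.

End Fiber11.

(** * Summation over boxes *)

Lemma in_level_trunc_log (x : int) : x != 0 -> in_level (trunc_log 64 `|x|) x.
Proof.
move=> x0; have h : (0 < `|x|)%N by rewrite absz_gt0.
have := @trunc_log_bounds 64 _ isT h; rewrite /in_level -abszE.
by move: (trunc_log _ _) => k; rewrite -!(natrX _ 64) !natz lez_nat ltz_nat.
Qed.

Lemma in_level_lt k (x : int) (L : nat) : in_level k x -> `|x| < 64 ^+ L -> (k < L)%N.
Proof.
move=> /andP[h _] h2; have := le_lt_trans h h2.
by rewrite -!(natrX _ 64) !natz ltz_nat ltn_exp2l.
Qed.

Section Sums12.
Variable R : realType.

Lemma cardle_sum4 (T : eqType) (P : T -> Prop) (f1 f2 f3 f4 : T -> nat) (L : nat)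
    (w : nat -> nat -> nat -> nat -> R) :
  (forall x, P x -> [/\ (f1 x < L)%N, (f2 x < L)%N, (f3 x < L)%N & (f4 x < L)%N]) ->
  (forall k1 k2 k3 k4, (k1 < L)%N -> (k2 < L)%N -> (k3 < L)%N -> (k4 < L)%N ->
     cardle (fun x => P x /\ [/\ f1 x = k1, f2 x = k2, f3 x = k3 & f4 x = k4]) (w k1 k2 k3 k4)) ->
  cardle P (\sum_(k1 <- iota 0 L) \sum_(k2 <- iota 0 L) \sum_(k3 <- iota 0 L)
     \sum_(k4 <- iota 0 L) w k1 k2 k3 k4).
Proof.
move=> hf hw.
apply: (@cardle_sum R _ _ _ f1); first by move=> x /hf []; rewrite mem_iota.
move=> k1; rewrite mem_iota => /= l1.
apply: (@cardle_sum R _ _ _ f2); first by move=> x [/hf []]; rewrite mem_iota.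
move=> k2; rewrite mem_iota => /= l2.
apply: (@cardle_sum R _ _ _ f3); first by move=> x [[/hf []]]; rewrite mem_iota.
move=> k3; rewrite mem_iota => /= l3.
apply: (@cardle_sum R _ _ _ f4); first by move=> x [[[/hf []]]]; rewrite mem_iota.
move=> k4; rewrite mem_iota => /= l4.
by apply: cardle_sub (hw _ _ _ _ l1 l2 l3 l4) => // x [[[[]]]].
Qed.

Lemma sum_const (L : nat) (c : R) : \sum_(k <- iota 0 L) c = L%:R * c.
Proof. by rewrite big_const_seq count_predT size_iota iter_addr addr0 mulr_natl. Qed.

Lemma sum_small (L M : nat) : \sum_(k <- iota 0 L) ((k <= M)%N%:R : R) <= M.+1%:R.
Proof.
rewrite -natr_sum ler_nat.
have -> : (\sum_(i <- iota 0 L) (i <= M)%N = count (fun i => i <= M) (iota 0 L))%N.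
  by rewrite -sum1_count [RHS]big_mkcond /=.
rewrite -size_filter -(size_iota 0 M.+1); apply: uniq_leq_size.
  by rewrite filter_uniq // iota_uniq.
by move=> i; rewrite mem_filter !mem_iota /= add0n ltnS => /andP[].
Qed.

(** A pair of levels that are both at most M can be chosen in (M + 1)^2 ways, and only the third
    level runs freely. With l = L the exceptional boxes therefore contribute L^2, less than the main
    term L^3. *)
Lemma sum_exc (L M : nat) (l : R) : 0 <= l ->
  \sum_(k1 <- iota 0 L) \sum_(k2 <- iota 0 L) \sum_(k3 <- iota 0 L)
     (1 + l * (small_pairs M k1 k2 k3)%:R) <= L%:R ^+ 3 + 3 * l * L%:R * M.+1%:R ^+ 2.
Proof.
move=> l0.
pose i (k : nat) : R := (k <= M)%N%:R.
pose s := \sum_(k <- iota 0 L) i k.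
have s0 : 0 <= s by rewrite sumr_ge0.
have sM : s <= M.+1%:R by exact: sum_small.
have E k1 k2 k3 : (small_pairs M k1 k2 k3)%:R = i k2 * i k3 + i k3 * i k1 + i k1 * i k2.
  by rewrite /small_pairs /i; do 3 case: (_ <= M)%N; rewrite /= ?(mulr0, mul0r, mulr1, addr0, add0r) // -!natrD.
have lin (a b : R) : \sum_(k <- iota 0 L) (a + b * i k) = L%:R * a + b * s.
  by rewrite big_split /= sum_const mulr_sumr.
have S3 k1 k2 : \sum_(k3 <- iota 0 L) (1 + l * (small_pairs M k1 k2 k3)%:R) =
    L%:R * (1 + l * (i k1 * i k2)) + l * (i k2 + i k1) * s.
  by rewrite -lin; apply: eq_bigr => k _; rewrite E; ring.
have S2 k1 : \sum_(k2 <- iota 0 L) \sum_(k3 <- iota 0 L) (1 + l * (small_pairs M k1 k2 k3)%:R) =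
    L%:R * (L%:R + l * i k1 * s) + (L%:R * l * i k1 + l * s) * s.
  by rewrite -lin; apply: eq_bigr => k _; rewrite S3; ring.
have -> : \sum_(k1 <- iota 0 L) \sum_(k2 <- iota 0 L) \sum_(k3 <- iota 0 L)
     (1 + l * (small_pairs M k1 k2 k3)%:R) = L%:R * (L%:R * L%:R + l * s * s) + (L%:R * l * s + L%:R * l * s) * s.
  by rewrite -lin; apply: eq_bigr => k _; rewrite S2; ring.
have -> : L%:R * (L%:R * L%:R + l * s * s) + (L%:R * l * s + L%:R * l * s) * s =
   L%:R ^+ 3 + 3 * l * L%:R * (s * s) by ring.
rewrite lerD2l; apply: ler_wpM2l; first by nonneg.
by rewrite expr2 ler_pM.
Qed.

End Sums12.

Section Count12.
Variable R : realType.
Variables (f1 f2 f3 : int).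
Hypotheses (h12 : f1 != f2) (h23 : f2 != f3) (h13 : f1 != f3).
Let a1 := f2 - f3.
Let a2 := f3 - f1.
Let a3 := f1 - f2.
Let A := a1 * a2 * a3.

Lemma disc_neq0 : a1 * a2 * a3 != 0.
Proof. by rewrite !mulf_neq0 // subr_eq0 // eq_sym. Qed.

Lemma box_points (C : R) (k1 k2 k3 p q : nat) (N : R)
    (P : nat * int * int -> Prop) (c : nat * int * int -> V3 * V3 * (int * int)) :
  0 <= N -> cardle (conic_box a1 a2 a3 k1 k2 k3 p q) C ->
  (forall t, P t -> sorted_point f1 f2 f3 t /\ conic_dec f1 f2 f3 t (c t)) ->
  (forall t, P t -> conic_box a1 a2 a3 k1 k2 k3 p q (c t).1) ->
  (forall t g1 g2 g3 z k m, P t -> c t = ((g1, g2, g3), z, (k, m)) ->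
      (`|A| ^+ 2)%:~R * k%:~R <= N ^+ 2 * (g1 * g2 * g3)%:~R) ->
  cardle P (C * (N * 2)).
Proof.
move=> N0 hC hP hb hN.
apply: (@cardle_fiber R _ _ _ (conic_box a1 a2 a3 k1 k2 k3 p q) (fun t => (c t).1)) => //.
  by rewrite mulr_ge0.
move=> [[[g1 g2] g3] z] _.
have := @conic_dec_fiber R f1 f2 f3 (g1, g2, g3) z N
   (fun t => P t /\ (c t).1 = ((g1, g2, g3), z)) c h12 h23 h13 N0.
have H1 : forall t, P t /\ (c t).1 = ((g1, g2, g3), z) -> sorted_point f1 f2 f3 t /\ conic_dec f1 f2 f3 t (c t).
  by move=> t [/hP].
have H2 : forall t, P t /\ (c t).1 = ((g1, g2, g3), z) ->
    (`|A| ^+ 2)%:~R * (c t).2.1%:~R <= N ^+ 2 * (g1 * g2 * g3)%:~R.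
  move=> t [Pt e]; apply: (hN t _ _ _ z _ (c t).2.2) => //.
  by case: (c t) e => ? [k m] /= ->.
move=> /(_ H1 H2); apply: cardle_sub => // t [Pt e].
by [].
Qed.

Lemma conic_dec_sorted t g1 g2 g3 z1 z2 z3 k m :
  sorted_point f1 f2 f3 t -> conic_dec f1 f2 f3 t ((g1, g2, g3), (z1, z2, z3), (k, m)) ->
  [/\ 0 < g1 * g2 * g3, `|g1 * (z1 * z1)| <= `|g2 * (z2 * z2)| <= `|g3 * (z3 * z3)|,
      g1 * (z1 * z1) != 0, `|g1| <= `|g1 * (z1 * z1)| &
      [/\ `|g2| <= `|g2 * (z2 * z2)| & `|g3| <= `|g3 * (z3 * z3)|]].
Proof.
move: t => [[n x] y] [n0 y0 E hs] [sl k0 m0 Em [X1 X2 X3]].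
have ge (g z : int) : 0 < z -> `|g| <= `|g * (z * z)|.
  by move=> z0; rewrite normrM ler_peMr // normrM mulr_ege1 //; move: z0; clear; lia.
have z10 := sol_z1 sl; have z20 := sol_z2 sl; have z30 := sol_z3 sl.
split; rewrite ?ge //.
- by rewrite -(pmulr_rgt0 _ k0) -Em mulr_gt0.
- by move: hs; rewrite X1 X2 X3 !(normrM k) !ler_pM2l // normr_gt0 gt_eqF.
- by rewrite !mulf_neq0 ?(sqfree_neq0 (sol_sq1 sl)) // gt_eqF.
Qed.

Definition level_of (x : int) : nat := trunc_log 64 (absz x).

Lemma conic_dec_levels t g1 g2 g3 z1 z2 z3 k m (L : nat) :
  sorted_point f1 f2 f3 t -> conic_dec f1 f2 f3 t ((g1, g2, g3), (z1, z2, z3), (k, m)) ->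
  `|g3 * (z3 * z3)| < 64 ^+ L ->
  [/\ [/\ (level_of g1 < L)%N, (level_of g2 < L)%N & (level_of g3 < L)%N],
      (level_of (g3 * (z3 * z3)) < L)%N, (level_of (g1 * (z1 * z1)) <= level_of (g3 * (z3 * z3)))%N &
      conic_box a1 a2 a3 (level_of g1) (level_of g2) (level_of g3) (level_of (g3 * (z3 * z3))) (level_of (g1 * (z1 * z1)))
        (g1, g2, g3, (z1, z2, z3))].
Proof.
move=> hp hd hL; have [G0 hs p10 b1 [b2 b3]] := conic_dec_sorted hp hd.
have /andP[s12 s23] := hs.
have : conic_sol a1 a2 a3 g1 g2 g3 z1 z2 z3 by move: t hp hd => [[n x] y] _ [].
move=> sl.
have g10 := sqfree_neq0 (sol_sq1 sl); have g20 := sqfree_neq0 (sol_sq2 sl).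
have g30 := sqfree_neq0 (sol_sq3 sl).
have p30 : g3 * (z3 * z3) != 0 by rewrite -normr_gt0 (lt_le_trans _ (le_trans s12 s23)) // normr_gt0.
have L1 := in_level_trunc_log g10; have L2 := in_level_trunc_log g20; have L3 := in_level_trunc_log g30.
have P3 := in_level_trunc_log p30; have P1 := in_level_trunc_log p10.
split.
- split; [apply: (in_level_lt L1) | apply: (in_level_lt L2) | apply: (in_level_lt L3)]; apply: le_lt_trans hL.
  + exact: le_trans b1 (le_trans s12 s23).
  + exact: le_trans b2 s23.
  + exact: b3.
- exact: in_level_lt P3 hL.
- rewrite /level_of; apply: leq_trunc_log; rewrite -lez_nat !abszE; exact: le_trans s12 s23.
- by split => //; case/andP: P1.
Qed.

Lemma level_G (g1 g2 g3 : int) (k1 k2 k3 : nat) : 0 < g1 * g2 * g3 ->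
  in_level k1 g1 -> in_level k2 g2 -> in_level k3 g3 -> 64 ^+ (k1 + k2 + k3) <= (g1 * g2 * g3)%:~R :> R.
Proof.
move=> G0 /andP[l1 _] /andP[l2 _] /andP[l3 _].
have h : 64 ^+ (k1 + k2 + k3) <= `|g1 * g2 * g3|.
  by rewrite !exprD !normrM !ler_pM // ?mulr_ge0 ?exprn_ge0.
by rewrite gtr0_norm // -(ler_int R) rmorphXn in h.
Qed.

(** Here k 64^p = O(T^2), so a pair (g, z) has O(T / (8^(k1+k2+k3) 8^p)) choices of k, which cancels
    the box count taken with q = p. The smallest term needs no level of its own, each ordinary box
    contributes O(T), and the four levels give L^4; the exceptional boxes add only O(T L^3), by
    [sum_exc]. *)
Lemma count_bounded : exists2 C : R, 0 < C &
  forall (L : nat) (T : R) (P : nat * int * int -> Prop)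
    (c : nat * int * int -> V3 * V3 * (int * int)), 0 <= T ->
  (forall t, P t -> sorted_point f1 f2 f3 t /\ conic_dec f1 f2 f3 t (c t)) ->
  (forall t g1 g2 g3 z1 z2 z3 k m, P t -> c t = ((g1, g2, g3), (z1, z2, z3), (k, m)) ->
     (k * `|g3 * (z3 * z3)|)%:~R <= T ^+ 2 /\ `|g3 * (z3 * z3)| < 64 ^+ L) ->
  cardle P (C * T * L%:R ^+ 4).
Proof.
have [C C0 hC] := @box_count R a1 a2 a3 disc_neq0.
set M := abs6 a1 a2 a3 in hC.
pose B : R := `|A|%:~R; have B0 : 0 <= B by rewrite ler0z.
pose D : R := 2 * C * B * (1 + 3 * M.+1%:R ^+ 2).
exists (D + 1); first by rewrite ltr_wpDl // /D; nonneg.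
move=> L T P c T0 hP hT.
pose F1 t := level_of (c t).1.1.1.1; pose F2 t := level_of (c t).1.1.1.2; pose F3 t := level_of (c t).1.1.2.
pose F4 t := level_of ((c t).1.1.2 * ((c t).1.2.2 * (c t).1.2.2)).
have key := @cardle_sum4 R _ P F1 F2 F3 F4 L (fun k1 k2 k3 p =>
  C * (1 + (L * small_pairs M k1 k2 k3)%:R) * (8 ^+ (k1 + k2 + k3) * 4 ^+ p * 2 ^+ p) *
  (B * T / (8 ^+ (k1 + k2 + k3) * 8 ^+ p) * 2)).
have dl t : P t -> exists g1 g2 g3 z1 z2 z3 k m, c t = ((g1, g2, g3), (z1, z2, z3), (k, m)).
  by case: (c t) => -[[[g1 g2] g3] [[z1 z2] z3]] [k m]; exists g1, g2, g3, z1, z2, z3, k, m.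
have n8 k : 0 < 8 ^+ k :> R by rewrite exprn_gt0.
apply: cardle_sub (key _ _) => //.
- have -> : \sum_(k1 <- iota 0 L) \sum_(k2 <- iota 0 L) \sum_(k3 <- iota 0 L) \sum_(p <- iota 0 L)
    (C * (1 + (L * small_pairs M k1 k2 k3)%:R) * (8 ^+ (k1 + k2 + k3) * 4 ^+ p * 2 ^+ p) *
     (B * T / (8 ^+ (k1 + k2 + k3) * 8 ^+ p) * 2)) =
    2 * C * B * T * L%:R * \sum_(k1 <- iota 0 L) \sum_(k2 <- iota 0 L) \sum_(k3 <- iota 0 L)
      (1 + L%:R * (small_pairs M k1 k2 k3)%:R).
    rewrite mulr_sumr; apply: eq_bigr => k1 _; rewrite mulr_sumr; apply: eq_bigr => k2 _.
    rewrite mulr_sumr; apply: eq_bigr => k3 _.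
    have -> : 2 * C * B * T * L%:R * (1 + L%:R * (small_pairs M k1 k2 k3)%:R) =
      L%:R * (2 * C * B * T * (1 + L%:R * (small_pairs M k1 k2 k3)%:R)) by ring.
    rewrite -sum_const; apply: eq_bigr => p _.
    have -> : 8 ^+ p = 4 ^+ p * 2 ^+ p :> R by rewrite -exprMn; congr (_ ^+ _); ring.
    have n4 : 0 < 4 ^+ p :> R by rewrite exprn_gt0.
    have n2 : 0 < 2 ^+ p :> R by rewrite exprn_gt0.
    move: (8 ^+ _) (n8 (k1 + k2 + k3)%N) (4 ^+ p) n4 (2 ^+ p) n2 => x x0 y y0 z z0.
    by rewrite natrM; field; rewrite !gt_eqF.
  have := sum_exc L M (ler0n R L); set S := \sum_(_ <- _) _ => hS.
  apply: (@le_trans _ _ (2 * C * B * T * L%:R * (L%:R ^+ 3 + 3 * L%:R * L%:R * M.+1%:R ^+ 2))).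
    by apply: ler_wpM2l => //; nonneg.
  case: (posnP L) => [->|L0]; first by rewrite mulr0 mul0r expr0n mulr0.
  have L1 : 1 <= L%:R :> R by rewrite ler1n.
  apply: (@le_trans _ _ (D * T * L%:R ^+ 4)).
    have -> : D * T * L%:R ^+ 4 = 2 * C * B * T * L%:R * (L%:R ^+ 3 + 3 * M.+1%:R ^+ 2 * L%:R ^+ 3).
      by rewrite /D; ring.
    apply: ler_wpM2l; first by nonneg.
    rewrite lerD2l (_ : 3 * L%:R * L%:R * M.+1%:R ^+ 2 = 3 * M.+1%:R ^+ 2 * L%:R ^+ 2); last by ring.
    by apply: ler_wpM2l; [nonneg | rewrite ler_weXn2l].
  by apply: ler_wpM2r; [nonneg | apply: ler_wpM2r => //; rewrite lerDl].
- move=> t Pt; have [g1 [g2 [g3 [z1 [z2 [z3 [k [m e]]]]]]]] := dl t Pt.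
  have [hp hd] := hP t Pt; rewrite e in hd; have [_ hL] := hT _ _ _ _ _ _ _ _ _ Pt e.
  by have [[l1 l2 l3] l4 _ _] := conic_dec_levels hp hd hL; rewrite /F1 /F2 /F3 /F4 e /=.
move=> k1 k2 k3 p l1 l2 l3 l4.
have N0 : 0 <= B * T / (8 ^+ (k1 + k2 + k3) * 8 ^+ p) by nonneg.
have bp := box_points (c := c) (P := fun t => P t /\ [/\ F1 t = k1, F2 t = k2, F3 t = k3 & F4 t = p])
  N0 (hC k1 k2 k3 p p L l1 l2 l3 (leqnn p)).
apply: cardle_sub (bp _ _ _) => //.
- by move=> t [/hP].
- move=> t [Pt]; have [g1 [g2 [g3 [z1 [z2 [z3 [k [m e]]]]]]]] := dl t Pt.
  have [hp hd] := hP t Pt; rewrite e in hd; have [_ hL] := hT _ _ _ _ _ _ _ _ _ Pt e.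
  have [_ _ lq [sl [b1 b2 b3] b4 b5 b6]] := conic_dec_levels hp hd hL.
  rewrite /F1 /F2 /F3 /F4 e /= => -[e1 e2 e3 e4]; rewrite e1 e2 e3 e4 in b1 b2 b3 b4 *.
  split => //; apply: (le_lt_trans _ (proj2 (andP b4))).
  by case/andP: b6 => b6 b7; exact: le_trans b6 b7.
- move=> t g1 g2 g3 [[z1 z2] z3] k m [Pt [e1 e2 e3 e4]] e.
  have [hp hd] := hP t Pt; rewrite e in hd; have [hk hL] := hT _ _ _ _ _ _ _ _ _ Pt e.
  have [_ _ _ [sl [b1 b2 b3] b4 _ _]] := conic_dec_levels hp hd hL.
  have [G0 _ _ _ _] := conic_dec_sorted hp hd.
  have k0 : 0 < k by move: t hp hd {Pt e e1 e2 e3 e4} => [[n x] y] _ [].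
  rewrite /F1 /F2 /F3 /F4 e /= in e1 e2 e3 e4; rewrite e1 e2 e3 e4 in b1 b2 b3 b4.
  have hG := level_G G0 b1 b2 b3.
  have hp3 : 64 ^+ p <= `|g3 * (z3 * z3)|%:~R :> R by have /andP[] := in_level_real R b4.
  rewrite rmorphXn /= -/B.
  set g : R := (g1 * g2 * g3)%:~R in hG *.
  have -> : (B * T / (8 ^+ (k1 + k2 + k3) * 8 ^+ p)) ^+ 2 * g =
     B ^+ 2 * (T ^+ 2 / 64 ^+ p * (g / 64 ^+ (k1 + k2 + k3))).
    by rewrite !exp64; field; rewrite !gt_eqF.
  apply: ler_wpM2l; first by nonneg.
  have n64 j : 0 < 64 ^+ j :> R by rewrite exprn_gt0.
  have kR : 0 <= k%:~R :> R by rewrite ler0z ltW.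
  have h1 : k%:~R <= T ^+ 2 / 64 ^+ p.
    rewrite ler_pdivlMr //; apply: le_trans hk; rewrite intrM.
    by apply: ler_wpM2l.
  apply: le_trans h1 _; rewrite ler_peMr //; first by nonneg.
  by rewrite ler_pdivlMr // mul1r.
Qed.

(** Here k^3 64^(q + 2 p) = O(T^6), the middle term being of the order of the largest. Hence k has
    O(T / (8^(k1+k2+k3) 4^p 2^q)) choices, which cancels the box count only if q is fixed too. There
    are L^5 boxes, and the exceptional factor is at most 1 + 3 L <= 4 L in each. *)
Lemma count_unbounded : exists2 C : R, 0 < C &
  forall (L : nat) (T : R) (P : nat * int * int -> Prop)
    (c : nat * int * int -> V3 * V3 * (int * int)), 0 <= T ->
  (forall t, P t -> sorted_point f1 f2 f3 t /\ conic_dec f1 f2 f3 t (c t)) ->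
  (forall t g1 g2 g3 z1 z2 z3 k m, P t -> c t = ((g1, g2, g3), (z1, z2, z3), (k, m)) ->
     (k ^+ 3 * (`|g1 * (z1 * z1)| * `|g2 * (z2 * z2)| * `|g3 * (z3 * z3)|))%:~R <= T ^+ 6
      /\ `|g3 * (z3 * z3)| < 64 ^+ L) ->
  cardle P (C * T * L%:R ^+ 6).
Proof.
have [C C0 hC] := @box_count R a1 a2 a3 disc_neq0.
set M := abs6 a1 a2 a3 in hC.
have [A1 _ _ _] := absz_le_mul disc_neq0 erefl; rewrite -/A in A1.
pose B : R := `|A|%:~R; have B1 : 1 <= B by rewrite ler1z.
have B0 : 0 <= B by rewrite (le_trans ler01).
pose D : R := C * (2 * B) ^+ 2 * 4.
exists (D + 1); first by rewrite ltr_wpDl // /D; nonneg.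
move=> L T P c T0 hP hT.
pose F1 t := level_of (c t).1.1.1.1; pose F2 t := level_of (c t).1.1.1.2; pose F3 t := level_of (c t).1.1.2.
pose F4 t := level_of ((c t).1.1.2 * ((c t).1.2.2 * (c t).1.2.2)).
pose F5 t := level_of ((c t).1.1.1.1 * ((c t).1.2.1.1 * (c t).1.2.1.1)).
have dl t : P t -> exists g1 g2 g3 z1 z2 z3 k m, c t = ((g1, g2, g3), (z1, z2, z3), (k, m)).
  by case: (c t) => -[[[g1 g2] g3] [[z1 z2] z3]] [k m]; exists g1, g2, g3, z1, z2, z3, k, m.
have n8 k : 0 < 8 ^+ k :> R by rewrite exprn_gt0.
have n4 k : 0 < 4 ^+ k :> R by rewrite exprn_gt0.
have n2 k : 0 < 2 ^+ k :> R by rewrite exprn_gt0.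
have lvs t : P t -> [/\ (F1 t < L)%N, (F2 t < L)%N, (F3 t < L)%N, (F4 t < L)%N & (F5 t <= F4 t)%N].
  move=> Pt; have [g1 [g2 [g3 [z1 [z2 [z3 [k [m e]]]]]]]] := dl t Pt.
  have [hp hd] := hP t Pt; rewrite e in hd; have [_ hL] := hT _ _ _ _ _ _ _ _ _ Pt e.
  by have [[l1 l2 l3] l4 l5 _] := conic_dec_levels hp hd hL; rewrite /F1 /F2 /F3 /F4 /F5 e /=.
have main q : (q < L)%N -> cardle (fun t => P t /\ F5 t = q) (D * T * L%:R ^+ 5).
  move=> qL.
  apply: cardle_sub (@cardle_sum4 R _ (fun t => P t /\ F5 t = q) F1 F2 F3 F4 L
     (fun _ _ _ _ => D * T * L%:R) _ _) => //.
  - by rewrite !sum_const le_eqVlt; apply/orP; left; apply/eqP; ring.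
  - by move=> t [/lvs []].
  move=> k1 k2 k3 p l1 l2 l3 l4.
  have [qp|pq] := leqP q p; last first.
    move=> [|t s] us hs; first by nonneg.
    have [[Pt e5] [_ _ _ e4]] := hs t (mem_head _ _); have [_ _ _ _] := lvs t Pt.
    by rewrite e5 e4 leqNgt pq.
  pose N : R := 2 * B ^+ 2 * T / (8 ^+ (k1 + k2 + k3) * 4 ^+ p * 2 ^+ q).
  have N0 : 0 <= N by rewrite /N; nonneg.
  have bp := box_points (c := c) (P := fun t => (P t /\ F5 t = q) /\ [/\ F1 t = k1, F2 t = k2, F3 t = k3 & F4 t = p])
    N0 (hC k1 k2 k3 p q L l1 l2 l3 qp).
  apply: cardle_sub (bp _ _ _) => //.
  - have -> : C * (1 + (L * small_pairs M k1 k2 k3)%:R) * (8 ^+ (k1 + k2 + k3) * 4 ^+ p * 2 ^+ q) * (N * 2) =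
      C * (2 * B) ^+ 2 * T * (1 + (L * small_pairs M k1 k2 k3)%:R).
      by rewrite /N; move: (8 ^+ _) (n8 (k1 + k2 + k3)%N) (4 ^+ p) (n4 p) (2 ^+ q) (n2 q) => x x0 y y0 z z0; field; rewrite !gt_eqF.
    have -> : D * T * L%:R = C * (2 * B) ^+ 2 * T * (4 * L%:R) by rewrite /D; ring.
    apply: ler_wpM2l; first by nonneg.
    have e3 : (small_pairs M k1 k2 k3 <= 3)%N by rewrite /small_pairs; do 3 case: (_ <= M)%N.
    rewrite -[4]/(4%:R) -natrM -[1]/(1%:R) -natrD ler_nat.
    by have := leq_mul (leqnn L) e3; move: (L * small_pairs _ _ _ _)%N => v; move: qL; clear; lia.
  - by move=> t [[/hP]].
  - move=> t [[Pt e5]]; have [g1 [g2 [g3 [z1 [z2 [z3 [k [m e]]]]]]]] := dl t Pt.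
    have [hp hd] := hP t Pt; rewrite e in hd; have [_ hL] := hT _ _ _ _ _ _ _ _ _ Pt e.
    have [_ _ _ bx] := conic_dec_levels hp hd hL.
    rewrite /F5 e /= in e5.
    by rewrite /F1 /F2 /F3 /F4 e /= => -[e1 e2 e3 e4]; rewrite e1 e2 e3 e4 e5 in bx.
  - move=> t g1 g2 g3 [[z1 z2] z3] k m [[Pt e5] [e1 e2 e3 e4]] e.
    have [hp hd] := hP t Pt; rewrite e in hd; have [hk hL] := hT _ _ _ _ _ _ _ _ _ Pt e.
    have [_ _ _ [sl [b1 b2 b3] b4 _ /andP[s12 _]]] := conic_dec_levels hp hd hL.
    have [G0 _ p10 _ _] := conic_dec_sorted hp hd.
    have k0 : 0 < k by move: t hp hd {Pt e e1 e2 e3 e4 e5} => [[n x] y] _ [].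
    rewrite /F1 /F2 /F3 /F4 /F5 e /= in e1 e2 e3 e4 e5.
    have b5 := in_level_trunc_log p10; rewrite -/(level_of _) e5 in b5.
    rewrite e1 e2 e3 e4 in b1 b2 b3 b4.
    have hG := level_G G0 b1 b2 b3.
    have hp3 : 64 ^+ p <= `|g3 * (z3 * z3)|%:~R :> R by have /andP[] := in_level_real R b4.
    have hp1 : 64 ^+ q <= `|g1 * (z1 * z1)|%:~R :> R by have /andP[] := in_level_real R b5.
    have hmid := sol_middle disc_neq0 sl s12; rewrite -/A in hmid.
    have hp2 : 64 ^+ p <= 2 * B * `|g2 * (z2 * z2)|%:~R.
      by apply: le_trans hp3 _; move: hmid; rewrite -(ler_int R) !intrM.
    rewrite [(k ^+ 3 * _)%:~R]intrM (rmorphXn _ 3 k) /= !intrM in hk.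
    rewrite rmorphXn /= -/B.
    set g : R := (g1 * g2 * g3)%:~R in hG *.
    set x1 : R := `|g1 * (z1 * z1)|%:~R in hk hp1.
    set x2 : R := `|g2 * (z2 * z2)|%:~R in hk hp2.
    set x3 : R := `|g3 * (z3 * z3)|%:~R in hk hp3.
    set kk : R := k%:~R in hk *.
    have kk0 : 0 <= kk by rewrite ler0z ltW.
    have n64 j : 0 < 64 ^+ j :> R by rewrite exprn_gt0.
    have [u eu] : exists u : R, u = 4 ^+ p by eexists.
    have [v ev] : exists v : R, v = 2 ^+ q by eexists.
    have u0 : 0 < u by rewrite eu.
    have v0 : 0 < v by rewrite ev.
    have p64 : 64 ^+ p = u ^+ 3 by rewrite eu -exprM mulnC exprM; congr (_ ^+ _); ring.
    have q64 : 64 ^+ q = v ^+ 6 by rewrite ev -exprM mulnC exprM; congr (_ ^+ _); ring.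
    have key : kk * (u * v) ^+ 2 <= (2 * B * T) ^+ 2.
      rewrite -(@ler_pXn2r _ 3) // ?nnegrE; [|by nonneg|by nonneg].
      have -> : (kk * (u * v) ^+ 2) ^+ 3 = kk ^+ 3 * (v ^+ 6 * u ^+ 3 * u ^+ 3) by ring.
      apply: (@le_trans _ _ (2 * B * T ^+ 6)).
        apply: (@le_trans _ _ (2 * B * (kk ^+ 3 * (x1 * x2 * x3)))); last first.
          by apply: ler_wpM2l => //; nonneg.
        have -> : 2 * B * (kk ^+ 3 * (x1 * x2 * x3)) = kk ^+ 3 * (x1 * (2 * B * x2) * x3) by ring.
        apply: ler_wpM2l; first by nonneg.
        rewrite -p64 -q64.
        apply: ler_pM; [by nonneg | by nonneg | | exact: hp3].
        by apply: ler_pM; [nonneg | nonneg | exact: hp1 | exact: hp2].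
      have -> : ((2 * B * T) ^+ 2) ^+ 3 = 2 * B * T ^+ 6 * (2 * B) ^+ 5 by ring.
      rewrite ler_peMr //; first by nonneg.
      by rewrite exprn_ege1 //; lra.
    have -> : N ^+ 2 * g = B ^+ 2 * ((2 * B * T) ^+ 2 / (u * v) ^+ 2 * (g / 64 ^+ (k1 + k2 + k3))).
      rewrite /N -eu -ev !exp64.
      by move: (8 ^+ _) (n8 (k1 + k2 + k3)%N) => x x0; field; rewrite !gt_eqF.
    apply: ler_wpM2l; first by nonneg.
    have h1 : kk <= (2 * B * T) ^+ 2 / (u * v) ^+ 2.
      by rewrite ler_pdivlMr // exprn_gt0 // mulr_gt0.
    apply: le_trans h1 _; rewrite ler_peMr //; first by nonneg.
    by rewrite ler_pdivlMr // mul1r.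
apply: cardle_sub (@cardle_sum R _ _ P F5 (iota 0 L) (fun=> D * T * L%:R ^+ 5) _ _) => //.
- rewrite sum_const (_ : _ * _ = D * T * L%:R ^+ 6); last by ring.
  by apply: ler_wpM2r; [nonneg | apply: ler_wpM2r => //; rewrite lerDl].
- by move=> t /lvs [_ _ _ l4 l5]; rewrite mem_iota /=; apply: leq_ltn_trans l5 l4.
- by move=> q; rewrite mem_iota => /= qL; exact: main.
Qed.

End Count12.

(** * Points of bounded height *)

Section Levels13.
Variable R : realType.

Lemma expR1_le64 : expR 1 <= 64 :> R.
Proof.
have h : 2^-1 <= expR (- 2^-1) :> R.
  by apply: le_trans (expR_ge1Dx _); lra.
have p : 0 < expR 2^-1 :> R by exact: expR_gt0.
have h2 : expR 2^-1 <= 2 :> R.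
  by have := ler_wpM2l (ltW p) h; rewrite -expRD subrr expR0; lra.
have -> : expR 1 = expR 2^-1 * expR 2^-1 :> R.
  by rewrite -expRD; congr expR; field.
apply: (@le_trans _ _ (2 * 2)); last by lra.
by apply: ler_pM => //; exact: ltW.
Qed.

(** For L = floor(7 ln B) + 1 one has L <= 7 ln B + 1 <= 8 ln B because ln B >= 1, and 64^L >= e^L >
    B^6 because L exceeds 6 ln B. *)
Lemma level_bound (B : R) : expR 1 <= B ->
  exists L : nat, L%:R <= 8 * ln B /\ B ^+ 6 < 64 ^+ L.
Proof.
move=> hB; have B0 : 0 < B by apply: lt_le_trans hB; exact: expR_gt0.
have l1 : 1 <= ln B by rewrite -[1](expRK 1) ler_ln ?posrE ?expR_gt0.
have f0 : 0 <= Num.floor (7 * ln B) by rewrite floor_ge0; lra.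
exists (absz (Num.floor (7 * ln B))).+1.
have e : (absz (Num.floor (7 * ln B))).+1%:R = (Num.floor (7 * ln B) + 1)%:~R :> R.
  by rewrite -natr1 intrD; congr (_ + _); rewrite pmulrn gez0_abs.
split.
  by rewrite e intrD; have := floor_le (7 * ln B); lra.
have -> : B ^+ 6 = expR (6%:R * ln B) by rewrite expRM_natl lnK.
apply: (@lt_le_trans _ _ (expR ((absz (Num.floor (7 * ln B))).+1%:R * 1))).
  rewrite ltr_expR mulr1 e; apply: le_lt_trans (floorD1_gt _).
  by rewrite ler_pM2r ?ler_nat //; lra.
by rewrite expRM_natl; apply: lerXn2r; rewrite ?nnegrE ?expR_ge0 ?expR1_le64.
Qed.

End Levels13.

Section Sorted13.
Variable R : realType.

Definition bounded_point (f1 f2 f3 : int) (B : R) (t : nat * int * int) : Prop :=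
  let: (n, x, y) := t in
  [/\ (0 < n)%N, y != 0, y * y = (x - f1 * n%:Z) * (x - f2 * n%:Z) * (x - f3 * n%:Z),
      `|x|%:~R <= B ^+ 2 & `|y|%:~R <= B ^+ 3].

(** If n > 2 B^2, then |x - f1 n| >= n - |x| > B^2. As this is the smallest of the three factors,
    y^2 would exceed B^6. *)
Lemma n_bound (f1 f2 f3 : int) (B : R) (n : nat) (x y : int) : f1 != 0 -> 0 < B ->
  bounded_point f1 f2 f3 B (n, x, y) -> sorted_point f1 f2 f3 (n, x, y) -> n%:R <= 2 * B ^+ 2.
Proof.
move=> f0 B0 [_ _ E hx hy] [_ _ _ /andP[h12 h23]].
rewrite leNgt; apply/negP => hn.
have X1 : n%:R / 2 < `|x - f1 * n%:Z|%:~R :> R.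
  have h : n%:Z - `|x| <= `|x - f1 * n%:Z|.
    have : `|f1 * n%:Z| <= `|x - f1 * n%:Z| + `|x|.
      by rewrite -[X in `|X| <= _](subKr x) (le_trans (ler_normB _ _)) // addrC.
    have : n%:Z <= `|f1 * n%:Z|.
      by rewrite normrM ler_peMl //; move: f0; clear; lia.
    by move: (`|x - _|) (`|f1 * _|) (`|x|) => *; lia.
  rewrite -(ler_int R) intrB in h; apply: lt_le_trans h.
  have -> : n%:Z%:~R = n%:R :> R by [].
  by move: (n%:R : R) (`|x|%:~R : R) (B ^+ 2) hn hx => *; lra.
have X1' : B ^+ 2 < `|x - f1 * n%:Z|%:~R :> R.
  by apply: lt_trans X1; move: (n%:R : R) (B ^+ 2) hn => *; lra.
have B20 : 0 <= B ^+ 2 by rewrite sqr_ge0.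
have X2 : B ^+ 2 < `|x - f2 * n%:Z|%:~R :> R by apply: lt_le_trans X1' _; rewrite ler_int.
have X3 : B ^+ 2 < `|x - f3 * n%:Z|%:~R :> R by apply: lt_le_trans X2 _; rewrite ler_int.
have : (`|y| * `|y|)%:~R <= B ^+ 3 * B ^+ 3 :> R.
  by rewrite intrM ler_pM // ler0z.
rewrite -normrM E !normrM !intrM leNgt.
have -> : B ^+ 3 * B ^+ 3 = B ^+ 2 * B ^+ 2 * B ^+ 2 by ring.
set Z := (X in _ < X); have -> // : B ^+ 2 * B ^+ 2 * B ^+ 2 < Z.
by apply: ltr_pM => //; [rewrite mulr_ge0 | apply: ltr_pM].
Qed.

(** What decides is [f1], attached to the smallest factor. If it is 0, n is not controlled and only
    y^2 <= B^6 is used, with six logarithms. Otherwise four suffice, even when another coefficient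
    vanishes and [delta] is 6. *)
Lemma sorted_count (f1 f2 f3 : int) : f1 != f2 -> f2 != f3 -> f1 != f3 ->
  exists2 C : R, 0 < C & exists B0 : R, forall B : R, B0 <= B -> 1 <= ln B ->
    cardle (fun t => bounded_point f1 f2 f3 B t /\ sorted_point f1 f2 f3 t)
      (C * (B * ln B ^+ delta f1 f2 f3)).
Proof.
move=> h12 h23 h13.
have ex (t : nat * int * int) : exists c, sorted_point f1 f2 f3 t -> conic_dec f1 f2 f3 t c.
  have [/conic_dec_exists [c hc]|h] := pselect (sorted_point f1 f2 f3 t); first by exists c.
  by exists ((0, 0, 0), (0, 0, 0), (0, 0)).
have [c hc] := choice ex.
have [C1 C10 H1] := @count_bounded R f1 f2 f3 h12 h23 h13.
have [C2 C20 H2] := @count_unbounded R f1 f2 f3 h12 h23 h13.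
(* [E] is chosen so that |x - f3 n| <= E B^2 follows from |x| <= B^2 and n <= 2 B^2. *)
pose E : R := 1 + 2 * `|f3|%:~R.
have E1 : 1 <= E by rewrite lerDl mulr_ge0 // ler0z.
exists (C1 * E * 8 ^+ 4 + C2 * 8 ^+ 6); first by rewrite addr_gt0 // !mulr_gt0 // ?exprn_gt0 //; lra.
exists (expR 1 + E) => B hB l1.
have hB1 : expR 1 <= B by apply: le_trans hB; rewrite lerDl; lra.
have hBE : E <= B by apply: le_trans hB; rewrite lerDr expR_ge0.
have B0 : 0 < B by lra.
have B1 : 1 <= B by lra.
have [L [L8 L64]] := level_bound hB1.
have lnB0 : 0 <= ln B by lra.
have Ln (j : nat) : L%:R ^+ j <= 8 ^+ j * ln B ^+ j.
  by rewrite -exprMn lerXn2r ?nnegrE //; lra.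
set P := fun t => _.
have hP t : P t -> sorted_point f1 f2 f3 t /\ conic_dec f1 f2 f3 t (c t) by move=> [_ h]; split => //; exact: hc.
have p64 (p : int) : `|p|%:~R <= B ^+ 6 -> `|p| < 64 ^+ L.
  by move=> h; rewrite -(ltr_int R) rmorphXn /=; apply: le_lt_trans h L64.
have [f10|f10] := eqVneq f1 0.
  have -> : delta f1 f2 f3 = 6%N by rewrite /delta f10 !mul0r eqxx.
  have key := H2 L B P c (ltW B0) hP; apply: cardle_sub (key _) => //.
    apply: (@le_trans _ _ (C2 * B * (8 ^+ 6 * ln B ^+ 6))).
      by apply: ler_wpM2l => //; nonneg.
    have -> : (C1 * E * 8 ^+ 4 + C2 * 8 ^+ 6) * (B * ln B ^+ 6) =
      C2 * B * (8 ^+ 6 * ln B ^+ 6) + C1 * E * 8 ^+ 4 * (B * ln B ^+ 6) by ring.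
    rewrite lerDl; have E0 : 0 <= E by lra.
    by nonneg.
  move=> t g1 g2 g3 z1 z2 z3 k m Pt e; have [_ hd] := hP t Pt; rewrite e in hd.
  move: t Pt e hd => [[n x] y] [[n0 y0 Ey hx hy] hpt] e hd.
  have hs := conic_dec_sorted hpt hd.
  move: hd => [sl k0 m0 Em [X1 X2 X3]].
  have EY : k ^+ 3 * (`|g1 * (z1 * z1)| * `|g2 * (z2 * z2)| * `|g3 * (z3 * z3)|) = `|y| * `|y|.
    rewrite -[in RHS]normrM Ey X1 X2 X3 !normrM (gtr0_norm k0); ring.
  have Y6 : (`|y| * `|y|)%:~R <= B ^+ 6 :> R.
    rewrite intrM (_ : B ^+ 6 = B ^+ 3 * B ^+ 3); last by ring.
    by rewrite ler_pM // ler0z.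
  rewrite EY; split => //; apply: p64; apply: le_trans Y6; rewrite ler_int -EY.
  have [G0 /andP[s12 s23] p10 _ _] := hs.
  have q1 : 1 <= `|g1 * (z1 * z1)| by move: p10; move: (g1 * _) => u; clear; lia.
  have q2 : 1 <= `|g2 * (z2 * z2)| by exact: le_trans q1 s12.
  have k1 : 1 <= k ^+ 3 by rewrite exprn_ege1 //; move: k0; clear; lia.
  rewrite (mulrA (k ^+ 3)); apply: ler_peMl; first exact: normr_ge0.
  by apply: mulr_ege1 => //; apply: mulr_ege1.
have key := H1 L (E * B) P c (mulr_ge0 (le_trans ler01 E1) (ltW B0)) hP.
apply: cardle_sub (key _) => //.
  have ld : ln B ^+ 4 <= ln B ^+ delta f1 f2 f3.
    by rewrite ler_weXn2l // /delta; case: ifP.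
  have E0 : 0 <= E by lra.
  apply: (@le_trans _ _ (C1 * (E * B) * (8 ^+ 4 * ln B ^+ delta f1 f2 f3))).
    apply: ler_wpM2l; first by nonneg.
    by apply: le_trans (Ln 4%N) _; apply: ler_wpM2l => //; rewrite exprn_ge0.
  have -> : (C1 * E * 8 ^+ 4 + C2 * 8 ^+ 6) * (B * ln B ^+ delta f1 f2 f3) =
    C1 * (E * B) * (8 ^+ 4 * ln B ^+ delta f1 f2 f3) + C2 * 8 ^+ 6 * (B * ln B ^+ delta f1 f2 f3) by ring.
  by rewrite lerDl; nonneg.
move=> t g1 g2 g3 z1 z2 z3 k m Pt e; have [_ hd] := hP t Pt; rewrite e in hd.
move: t Pt e hd => [[n x] y] [hb hpt] e [sl k0 m0 Em [X1 X2 X3]].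
have hn := n_bound f10 B0 hb hpt.
case: hb => n0 y0 Ey hx hy.
have hX3 : `|x - f3 * n%:Z|%:~R <= E * B ^+ 2 :> R.
  apply: (@le_trans _ _ (`|x|%:~R + `|f3|%:~R * n%:R)).
    have -> : n%:R = n%:Z%:~R :> R by [].
    rewrite -intrM -intrD ler_int (le_trans (ler_normB _ _)) // normrM.
    by rewrite (ger0_norm (_ : 0 <= n%:Z)).
  have -> : E * B ^+ 2 = B ^+ 2 + `|f3|%:~R * (2 * B ^+ 2) by rewrite /E; ring.
  by apply: lerD => //; apply: ler_wpM2l => //; rewrite ler0z.
have hk : (k * `|g3 * (z3 * z3)|)%:~R <= E * B ^+ 2 :> R.
  by move: hX3; rewrite X3 (normrM k) (gtr0_norm k0).
split.
  apply: le_trans hk _; rewrite exprMn; apply: ler_wpM2r; first exact: sqr_ge0.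
  by rewrite expr2 ler_peMl //; lra.
apply: p64; apply: (@le_trans _ _ (E * B ^+ 2)).
  apply: le_trans hk; rewrite ler_int ler_peMl //; move: k0; clear; lia.
apply: (@le_trans _ _ (B * B ^+ 2)); first by apply: ler_wpM2r => //; exact: sqr_ge0.
by rewrite -exprS ler_weXn2l.
Qed.

End Sorted13.

Section Final14.
Context {R : realType}.

Lemma bounded_point_swap12 (f1 f2 f3 : int) (B : R) t :
  bounded_point f1 f2 f3 B t -> bounded_point f2 f1 f3 B t.
Proof. by move: t => [[n x] y] [n0 y0 E hx hy]; split => //; rewrite E; ring. Qed.

Lemma bounded_point_swap23 (f1 f2 f3 : int) (B : R) t :
  bounded_point f1 f2 f3 B t -> bounded_point f1 f3 f2 B t.
Proof. by move: t => [[n x] y] [n0 y0 E hx hy]; split => //; rewrite E; ring. Qed.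

Lemma delta_swap12 (f1 f2 f3 : int) : delta f2 f1 f3 = delta f1 f2 f3.
Proof. by rewrite /delta (mulrC f2). Qed.

Lemma delta_swap23 (f1 f2 f3 : int) : delta f1 f3 f2 = delta f1 f2 f3.
Proof. by rewrite /delta (mulrAC f1). Qed.

Lemma sorted_cases (f1 f2 f3 : int) (B : R) t : bounded_point f1 f2 f3 B t ->
  (sorted_point f1 f2 f3 t \/ sorted_point f2 f1 f3 t) \/ (sorted_point f1 f3 f2 t \/ sorted_point f3 f1 f2 t) \/
  (sorted_point f2 f3 f1 t \/ sorted_point f3 f2 f1 t).
Proof.
move: t => [[n x] y] [n0 y0 E _ _]; rewrite /sorted_point.
have E1 : y * y = (x - f2 * n%:Z) * (x - f1 * n%:Z) * (x - f3 * n%:Z) by rewrite E; ring.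
have E2 : y * y = (x - f1 * n%:Z) * (x - f3 * n%:Z) * (x - f2 * n%:Z) by rewrite E; ring.
have E3 : y * y = (x - f3 * n%:Z) * (x - f1 * n%:Z) * (x - f2 * n%:Z) by rewrite E; ring.
have E4 : y * y = (x - f2 * n%:Z) * (x - f3 * n%:Z) * (x - f1 * n%:Z) by rewrite E; ring.
have E5 : y * y = (x - f3 * n%:Z) * (x - f2 * n%:Z) * (x - f1 * n%:Z) by rewrite E; ring.
set p1 := `|x - f1 * n%:Z|; set p2 := `|x - f2 * n%:Z|; set p3 := `|x - f3 * n%:Z|.
have [h12|/ltW h12] := leP p1 p2; have [h23|/ltW h23] := leP p2 p3; have [h13|/ltW h13] := leP p1 p3.
- by left; left; split => //; rewrite h12.
- by left; left; split => //; rewrite h12.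
- by right; left; left; split => //; rewrite h13.
- by right; left; right; split => //; rewrite h13.
- by left; right; split => //; rewrite h12.
- by right; right; left; split => //; rewrite h23.
- by right; right; right; split => //; rewrite h23.
- by right; right; right; split => //; rewrite h23.
Qed.

Lemma all_count (f1 f2 f3 : int) : f1 != f2 -> f2 != f3 -> f1 != f3 ->
  exists2 C : R, 0 < C & exists B0 : R, forall B : R, B0 <= B -> 1 <= ln B ->
    cardle (bounded_point f1 f2 f3 B) (C * (B * ln B ^+ delta f1 f2 f3)).
Proof.
move=> h12 h23 h13.
have h21 : f2 != f1 by rewrite eq_sym.
have h32 : f3 != f2 by rewrite eq_sym.
have h31 : f3 != f1 by rewrite eq_sym.
have [C1 P1 [B1 H1]] := sorted_count R h12 h23 h13.
have [C2 P2 [B2 H2]] := sorted_count R h21 h13 h23.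
have [C3 P3 [B3 H3]] := sorted_count R h13 h32 h12.
have [C4 P4 [B4 H4]] := sorted_count R h31 h12 h32.
have [C5 P5 [B5 H5]] := sorted_count R h23 h31 h21.
have [C6 P6 [B6 H6]] := sorted_count R h32 h21 h31.
exists ((C1 + C2) + ((C3 + C4) + (C5 + C6))); first by rewrite !addr_gt0.
exists (Num.max B1 (Num.max B2 (Num.max B3 (Num.max B4 (Num.max B5 B6))))) => B.
rewrite !ge_max => /and4P[g1 g2 g3 /and3P[g4 g5 g6]] l1.
have {}H1 := H1 B g1 l1.
have {}H2 := H2 B g2 l1; rewrite delta_swap12 in H2.
have {}H3 := H3 B g3 l1; rewrite delta_swap23 in H3.
have {}H4 := H4 B g4 l1; rewrite delta_swap12 delta_swap23 in H4.
have {}H5 := H5 B g5 l1; rewrite delta_swap23 delta_swap12 in H5.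
have {}H6 := H6 B g6 l1; rewrite delta_swap12 delta_swap23 delta_swap12 in H6.
rewrite !mulrDl.
pose bp := bounded_point f1 f2 f3 B.
have K1 : cardle (fun t => bp t /\ sorted_point f1 f2 f3 t) _ := H1.
have K2 : cardle (fun t => bp t /\ sorted_point f2 f1 f3 t) (C2 * (B * ln B ^+ delta f1 f2 f3)).
  by apply: cardle_sub H2 => // t [h1 h2]; split => //; exact: bounded_point_swap12.
have K3 : cardle (fun t => bp t /\ sorted_point f1 f3 f2 t) (C3 * (B * ln B ^+ delta f1 f2 f3)).
  by apply: cardle_sub H3 => // t [h1 h2]; split => //; exact: bounded_point_swap23.
have K4 : cardle (fun t => bp t /\ sorted_point f3 f1 f2 t) (C4 * (B * ln B ^+ delta f1 f2 f3)).
  by apply: cardle_sub H4 => // t [h1 h2]; split => //; exact/bounded_point_swap12/bounded_point_swap23.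
have K5 : cardle (fun t => bp t /\ sorted_point f2 f3 f1 t) (C5 * (B * ln B ^+ delta f1 f2 f3)).
  by apply: cardle_sub H5 => // t [h1 h2]; split => //; exact/bounded_point_swap23/bounded_point_swap12.
have K6 : cardle (fun t => bp t /\ sorted_point f3 f2 f1 t) (C6 * (B * ln B ^+ delta f1 f2 f3)).
  apply: cardle_sub H6 => // t [h1 h2]; split => //.
  exact/bounded_point_swap12/bounded_point_swap23/bounded_point_swap12.
have J1 := @cardle_or R _ (fun t => bp t /\ (sorted_point f1 f2 f3 t \/ sorted_point f2 f1 f3 t)) _ _ _ _ _ K1 K2.
have J2 := @cardle_or R _ (fun t => bp t /\ (sorted_point f1 f3 f2 t \/ sorted_point f3 f1 f2 t)) _ _ _ _ _ K3 K4.
have J3 := @cardle_or R _ (fun t => bp t /\ (sorted_point f2 f3 f1 t \/ sorted_point f3 f2 f1 t)) _ _ _ _ _ K5 K6.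
have D (T : Type) (P Q Q' : T -> Prop) t : P t /\ (Q t \/ Q' t) -> (P t /\ Q t) \/ (P t /\ Q' t) by tauto.
apply: (@cardle_or R _ _ _ _ _ _ _ (J1 (D _ _ _ _)) (@cardle_or R _ (fun t =>
   (bp t /\ (sorted_point f1 f3 f2 t \/ sorted_point f3 f1 f2 t)) \/ (bp t /\ (sorted_point f2 f3 f1 t \/ sorted_point f3 f2 f1 t)))
   _ _ _ _ (fun t h => h) (J2 (D _ _ _ _)) (J3 (D _ _ _ _)))).
by move=> t ht; have := sorted_cases ht; tauto.
Qed.

(** * From rational points and the height to integral triples *)

Lemma height_le (x y : int) (B : R) : 0 <= B ->
  (height R (x%:~R, y%:~R) <= B) = (`|x|%:~R <= B ^+ 2) && (`|y|%:~R <= B ^+ 3).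
Proof.
move=> B0; rewrite /height /= !ratr_int -!intr_norm ge_max andbC.
have root (z : R) (n : nat) : 0 <= z -> (z `^ n.+1%:R^-1 <= B) = (z <= B ^+ n.+1).
  move=> z0.
  have e (w : R) : 0 <= w -> (w `^ n.+1%:R^-1) ^+ n.+1 = w.
    by move=> w0; rewrite -powR_mulrn ?powR_ge0 // -powRrM mulVf ?pnatr_eq0 // powRr1.
  by rewrite -(@ler_pXn2r _ n.+1) // ?nnegrE ?powR_ge0 // e.
by rewrite -[3^-1]/(3%:R^-1) -[2^-1]/(2%:R^-1) !root // ler0z.
Qed.

Lemma rat_sqrt_int (q : rat) (z : int) : q ^+ 2 = z%:~R -> q = (numq q)%:~R.
Proof.
move=> h; have d0 : denq q != 0 by rewrite denq_neq0.
have e : numq q * numq q = z * (denq q * denq q).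
  have d0' : (denq q)%:~R != 0 :> rat by rewrite intr_eq0.
  have h2 : ((numq q)%:~R / (denq q)%:~R) ^+ 2 = z%:~R :> rat by rewrite divq_num_den.
  apply/eqP; rewrite -(eqr_int rat) !intrM -h2; apply/eqP.
  by field.
have dv : (denq q %| numq q)%Z by apply: dvdz_sqr; rewrite e dvdz_mull.
have := coprime_num_den q; rewrite /coprime => /eqP c.
have : denq q = 1.
  have : (absz (denq q) %| gcdn (absz (numq q)) (absz (denq q)))%N by rewrite dvdn_gcd dvdnn andbT.
  by rewrite c dvdn1 => /eqP; have := denq_gt0 q; case: (denq q) => // n _ /= ->.
by move=> d1; rewrite -{1}(divq_num_den q) d1 divr1.
Qed.

Lemma E_star_int (e1 e2 e3 : int) (n : nat) (P : rat * rat) : E_star e1 e2 e3 n P ->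
  exists x y : int, [/\ P = (x%:~R, y%:~R), y != 0 &
    y * y = (x - e1 * n%:Z) * (x - e2 * n%:Z) * (x - e3 * n%:Z)].
Proof.
case: P => px py [[/= E /intrP[x ex]] y0]; rewrite /E_rat /= ex in E.
have E' : py ^+ 2 = ((x - e1 * n%:Z) * (x - e2 * n%:Z) * (x - e3 * n%:Z))%:~R.
  by rewrite E !(intrM, intrB) -!pmulrn.
have ey := rat_sqrt_int E'.
exists x, (numq py); split.
- by rewrite ex -ey.
- by apply: contra_neq y0 => h; rewrite ey h.
- by apply/eqP; rewrite -(eqr_int rat) -E' intrM -ey expr2.
Qed.

Lemma E_star_mem (e1 e2 e3 : int) (n : nat) (x y : int) : y != 0 ->
  y * y = (x - e1 * n%:Z) * (x - e2 * n%:Z) * (x - e3 * n%:Z) ->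
  E_star e1 e2 e3 n (x%:~R, y%:~R).
Proof.
move=> y0 E; split; last by rewrite /= intr_eq0.
split => /=; last by rewrite intr_int.
by rewrite /E_rat /= expr2 -intrM E !(intrM, intrB) -!pmulrn.
Qed.

Lemma bounded_of_star (e1 e2 e3 : int) (n : nat) (B : R) (P : rat * rat) : 0 <= B -> (0 < n)%N ->
  E_star e1 e2 e3 n P -> height R P <= B -> bounded_point e1 e2 e3 B (n, numq P.1, numq P.2).
Proof.
move=> B0 n0 /E_star_int [x [y [-> y0 E]]]; rewrite height_le // /= !numq_int => /andP[hx hy].
by split.
Qed.

Lemma star_eq (e1 e2 e3 : int) (n : nat) (P Q : rat * rat) :
  E_star e1 e2 e3 n P -> E_star e1 e2 e3 n Q -> numq P.1 = numq Q.1 -> numq P.2 = numq Q.2 -> P = Q.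
Proof.
by move=> /E_star_int [x [y [-> _ _]]] /E_star_int [x' [y' [-> _ _]]] /=; rewrite !numq_int => -> ->.
Qed.

Lemma counting_ge0 (T : choiceType) (X : set T) : (0 <= counting X :> \bar R)%E.
Proof. by rewrite /counting; case: ifP => _; rewrite ?lee_fin // leey. Qed.

Lemma point_count_le (e1 e2 e3 : int) (B K : R) : 0 <= B ->
  cardle (bounded_point e1 e2 e3 B) K -> (point_count e1 e2 e3 B <= K%:E)%E.
Proof.
move=> B0 hK; rewrite /point_count.
set S := fun n : nat => [set P | E_star e1 e2 e3 n P /\ (height R P <= B)%R].
(* A finite subset with more than K elements would already give too long a list, so the bound on
   lists also yields finiteness; it is needed since [counting] is +oo on infinite sets. *)
have fin n : (0 < n)%N -> finite_set (S n).
  move=> n0; apply: contrapT => /infinite_set_fset.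
  move=> /(_ (absz (Num.floor K)).+1) [F FS hF].
  have h : (size (finmap.enum_fset F))%:R <= K.
    rewrite -(size_map (fun P : rat * rat => (n, numq P.1, numq P.2))); apply: hK.
      rewrite map_inj_in_uniq ?finmap.fset_uniq // => P Q /FS [hP _] /FS [hQ _] [h1 h2].
      exact: star_eq hP hQ h1 h2.
    by move=> t /mapP[P /FS [hP hh] ->]; exact: bounded_of_star.
  have K0 := cardle_ge0 hK.
  have : (absz (Num.floor K)).+1%:R <= K by apply: le_trans h; rewrite ler_nat.
  have f0 : 0 <= Num.floor K by rewrite floor_ge0.
  rewrite -natr1 pmulrn gez0_abs // leNgt.
  by have := floorD1_gt K; rewrite intrD => ->.
(* The points are tagged with their n, so the lists for different n can be concatenated without
   repetition, and one bound covers each partial sum. *)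
have key N : exists s : seq (nat * int * int), [/\ uniq s,
    forall t, t \in s -> bounded_point e1 e2 e3 B t /\ (t.1.1 < N)%N &
    (\sum_(1 <= n < N) counting (S n))%E = (((size s)%:R)%:E : \bar R)].
  elim: N => [|N [s [us hs es]]].
    by exists [::]; split => //; rewrite big_geq.
  case: (posnP N) => [N0|N0].
    by exists [::]; split => //; rewrite N0 big_geq.
  have fN := fin N N0.
  pose s' := map (fun P : rat * rat => (N, numq P.1, numq P.2)) (finmap.enum_fset (fset_set (S N))).
  have memS P : P \in finmap.enum_fset (fset_set (S N)) -> S N P.
    by move=> h; rewrite -(fset_setK fN).
  exists (s ++ s'); split.
  - rewrite cat_uniq us /=; apply/andP; split.
      apply/hasPn => t /mapP[P _ ->]; apply/negP => /hs [_ /=].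
      by rewrite ltnn.
    rewrite map_inj_in_uniq ?finmap.fset_uniq // => P Q /memS [hP _] /memS [hQ _] [h1 h2].
    exact: star_eq hP hQ h1 h2.
  - move=> t; rewrite mem_cat => /orP[/hs [h1 h2]|/mapP[P /memS [hP hh] ->]].
      by split => //; apply: ltn_trans h2 _.
    by split => //; exact: bounded_of_star.
  - rewrite big_nat_recr //= es size_cat size_map natrD EFinD; congr (_ + _)%E.
    by rewrite /counting asboolT.
apply: lime_le.
  by apply: is_cvg_nneseries => n _ _; exact: counting_ge0.
apply: nearW => N; have [s [us hs ->]] := key N; rewrite lee_fin.
by apply: hK => // t /hs [].
Qed.

(** * The lower bound, and the theorem *)

Lemma point_count_ge (e1 e2 e3 : int) : exists2 c : R, 0 < c &
  exists B0 : R, forall B, B0 <= B -> ((c * B)%:E <= point_count e1 e2 e3 B)%E.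
Proof.
(* This choice makes each x0 - e_i at least 1. *)
pose x0 : int := `|e1| + `|e2| + `|e3| + 1.
have x01 : 1 <= x0 by rewrite /x0; lia.
have [v ev] : exists v : int, v = (x0 - e1) * (x0 - e2) * (x0 - e3) by eexists.
have v1 : 1 <= v.
  have h1 : 1 <= x0 - e1 by rewrite /x0; lia.
  have h2 : 1 <= x0 - e2 by rewrite /x0; lia.
  have h3 : 1 <= x0 - e3 by rewrite /x0; lia.
  by rewrite ev mulr_ege1 // mulr_ege1.
have vN : (absz v)%:Z = v by rewrite gez0_abs // (le_trans _ v1).
have vn0 : (0 < absz v)%N by rewrite absz_gt0 gt_eqF // (lt_le_trans _ v1).
(* The point with parameter t has x <= (t w)^2 and y <= (t w)^3, so its height is at most t w. *)
pose w : R := (v * x0)%:~R.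
have w1 : 1 <= w by rewrite ler1z mulr_ege1.
have w0 : 0 < w by lra.
exists (2 * w)^-1; first by rewrite invr_gt0 mulr_gt0.
exists (2 * w) => B hB.
have B0 : 0 < B by lra.
rewrite /point_count.
set S := fun n : nat => [set P | E_star e1 e2 e3 n P /\ (height R P <= B)%R].
have one (t : nat) : (0 < t)%N -> t%:R * w <= B -> (1 <= counting (S (absz v * (t * t))%N) :> \bar R)%E.
  move=> t0 ht; set n := (_ * _)%N.
  have nZ : n%:Z = v * (t%:Z * t%:Z) by rewrite /n !PoszM vN.
  pose X : int := v * (t%:Z * t%:Z) * x0; pose Y : int := v * v * (t%:Z * t%:Z * t%:Z).
  have tZ : 1 <= t%:Z by rewrite lez_nat.
  have mem : S n (X%:~R, Y%:~R).
    split.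
      apply: E_star_mem.
        have tn : t%:Z != 0 by move: t0; clear; lia.
        by rewrite !mulf_neq0 // -absz_gt0.
      have -> : Y * Y = v * v * v * (t%:Z * t%:Z * t%:Z) ^+ 2 * v by rewrite /Y; ring.
      by rewrite [in X in _ * X]ev nZ /X; ring.
    rewrite height_le ?(ltW B0) //.
    have tR : 0 <= t%:R :> R by [].
    have vR : 1 <= v%:~R :> R by rewrite ler1z.
    have xR : 1 <= x0%:~R :> R by rewrite ler1z.
    have v0 : 0 <= v by exact: le_trans v1.
    have x00 : 0 <= x0 by exact: le_trans x01.
    have tw0 : 0 <= t%:R * w by rewrite mulr_ge0 // ltW.
    apply/andP; split.
      rewrite ger0_norm ?mulr_ge0 //.
      apply: (@le_trans _ _ ((t%:R * w) ^+ 2)); last by rewrite lerXn2r ?nnegrE // ltW.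
      have -> : (t%:R * w) ^+ 2 = X%:~R * w :> R.
        by rewrite /X /w !intrM -!pmulrn; ring.
      by rewrite ler_peMr // ler0z !mulr_ge0.
    rewrite ger0_norm ?mulr_ge0 //.
    apply: (@le_trans _ _ ((t%:R * w) ^+ 3)); last by rewrite lerXn2r ?nnegrE // ltW.
    have -> : (t%:R * w) ^+ 3 = Y%:~R * (v * x0 ^+ 3)%:~R :> R.
      by rewrite /Y /w !intrM -!pmulrn; ring.
    rewrite ler_peMr // ?ler0z ?mulr_ge0 //.
    by rewrite ler1z mulr_ege1 // exprn_ege1.
  rewrite /counting; case: ifPn => [/asboolP fS|_]; last by rewrite leey.
  rewrite lee_fin ler1n; case E : (finmap.enum_fset _) => //.
  have h := mem; rewrite -(fset_setK fS) in h.
  have : (X%:~R, Y%:~R) \in finmap.enum_fset (fset_set (S n)) by exact: h.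
  by rewrite E.
(* The values n = v t^2 increase strictly with t, so one point for each of them suffices and all
   other terms are dropped. Afterwards T = floor(B / w), which is at least B / (2 w) once B >= 2
   w. *)
have part (T : nat) : T%:R * w <= B ->
    (T%:R%:E <= \sum_(1 <= n < (absz v * (T * T)).+1) counting (S n) :> \bar R)%E.
  elim: T => [|T IH] hT.
    by rewrite sume_ge0 // => n _; exact: counting_ge0.
  have hT' : T%:R * w <= B.
    by apply: le_trans hT; apply: ler_wpM2r; [exact: ltW | rewrite ler_nat].
  set a := (absz v * (T * T))%N in IH *; set b := (absz v * (T.+1 * T.+1))%N.
  have ab : (a < b)%N by rewrite /a /b ltn_pmul2l // ltn_mul.
  rewrite big_nat_recr /=; last exact: leq_ltn_trans (leq0n a) ab.
  rewrite -natr1 EFinD; apply: leeD; last exact: one.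
  apply: le_trans (IH hT') _.
  by apply: lee_sum_nneg_natr => // n _ _; exact: counting_ge0.
have q0 : 0 <= Num.floor (B / w) by rewrite floor_ge0 divr_ge0 // ltW.
have fl : (absz (Num.floor (B / w)))%:R = (Num.floor (B / w))%:~R :> R by rewrite pmulrn gez0_abs.
pose m := absz (Num.floor (B / w)).
have hm : m%:R * w <= B.
  by rewrite /m fl -ler_pdivlMr //; exact: floor_le.
apply: (@le_trans _ _ ((m%:R : R)%:E)).
  rewrite lee_fin /m fl.
  have := floorD1_gt (B / w); rewrite intrD.
  have -> : (2 * w)^-1 * B = B / w / 2 by clear -w0; move: w w0 => u u0; field; rewrite gt_eqF.
  have : 2 <= B / w by rewrite ler_pdivlMr.
  by move: (B / w) => q; lra.
apply: le_trans (part m hm) _.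
apply: nneseries_lim_ge => n _ _; exact: counting_ge0.
Qed.

End Final14.

Unset Implicit Arguments.

Theorem theorem2 (R : realType) (e1 e2 e3 : int)
    (h12 : e1 <> e2) (h13 : e1 <> e3) (h23 : e2 <> e3) :
  exists c C : R, [/\ 0 < c, 0 < C &
    exists B0 : R, forall B : R, B0 <= B ->
      ((c * B)%:E <= point_count e1 e2 e3 B)%E /\
      (point_count e1 e2 e3 B <= (C * (B * ln B ^+ delta e1 e2 e3))%:E)%E].
Proof.
have [c c0 [B1 H1]] := @point_count_ge R e1 e2 e3.
have [C C0 [B2 H2]] := @all_count R e1 e2 e3 (introN eqP h12) (introN eqP h23) (introN eqP h13).
exists c, C; split => //.
exists (Num.max B1 (Num.max B2 (expR 1))) => B; rewrite !ge_max => /and3P[g1 g2 g3].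
split; first exact: H1.
have B0 : 0 < B by apply: lt_le_trans g3; exact: expR_gt0.
apply: point_count_le; first exact: ltW.
by apply: H2 => //; rewrite -[1](expRK 1) ler_ln ?posrE ?expR_gt0.
Qed.
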